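(* Let $p\in[1,+\infty)$. For any $\alpha\ge1$ the space $\mathcal{F}_\alpha^p$ contains nontrivial infinite-dimensional nearly invariant subspaces without common zeros.
   Context: For $\alpha>0$, $\mathcal{F}_\alpha^p$ denotes any of the Banach spaces of entire functions $F$ with $\|F\|^p=\int_{\mathbb{C}}|F(z)|^p e^{-a|z|^\alpha}\,dm_2(z)<+\infty$, where $a>0$ and $m_2$ is planar Lebesgue measure. A closed linear subspace $\mathcal{M}$ of $\mathcal{F}_\alpha^p$ is nearly invariant if $\frac{f(z)}{z}\in\mathcal{M}$ whenever $f\in\mathcal{M}$ and $f(0)=0$. It is without common zeros if for every $w\in\mathbb{C}$ there is $f\in\mathcal{M}$ with $f(w)\neq0$. A subspace is nontrivial if it is different from $\{0\}$ and from the whole space. *)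

(* Defs.v *)
From mathcomp Require Import all_boot all_order all_algebra.
From mathcomp Require Import complex.
From mathcomp Require Import all_classical all_reals all_analysis.
Import Order.TTheory GRing.Theory Num.Theory.
Import numFieldNormedType.Exports.
Import ComplexField.

Set Implicit Arguments.
Unset Strict Implicit.
Unset Printing Implicit Defensive.

Local Open Scope classical_set_scope.
Local Open Scope ring_scope.
Local Open Scope complex_scope.

Section FockSpaces.
Variable R : realType.
Local Notation C := R[i].

(* On [C^o] both the scalars and the vectors are complex, so [derivable] in
   direction 1 is existence of the complex derivative. *)
Definition entire (F : C -> C) : Prop :=
  forall z : C, derivable (F : C^o -> C^o) z 1.

(* C is identified with R * R through (x, y) |-> x +i* y. *)
Local Notation planar_measure := (@lebesgue_measure R \x @lebesgue_measure R)%E.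

Section Space.
Variables p alpha a : R.

(* [Normc.normc] is the real-valued modulus ([`|z|] would be of type C). *)
Definition fock_norm (F : C -> C) : \bar R :=
  ((\int[planar_measure]_(xy in setT)
     (Normc.normc (F (xy.1 +i* xy.2)) `^ p
      * expR (- (a * Normc.normc (xy.1 +i* xy.2) `^ alpha)))%:E) `^ p^-1)%E.

Definition fock : set (C -> C) :=
  [set F | entire F /\ (fock_norm F < +oo)%E].

Definition closed_subspace (M : set (C -> C)) : Prop :=
  [/\ M `<=` fock,
      M (fun=> 0),
      forall (c : C) f g, M f -> M g -> M (fun z => c * f z + g z) &
      forall f, fock f ->
        (forall e : R, 0 < e ->
           exists2 g, M g & (fock_norm (fun z => (f z - g z)%R) < e%:E)%E) ->
        M f].

Definition nontrivial_subspace (M : set (C -> C)) : Prop :=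
  M <> [set (fun=> 0)] /\ M <> fock.

End Space.

(* [g] is f(z)/z with its removable singularity at 0 filled in: when [M]
   consists of entire functions, [g 0] is determined by continuity. *)
Definition nearly_invariant (M : set (C -> C)) : Prop :=
  forall f, M f -> f 0 = 0 ->
    exists2 g, M g & forall z, z != 0 -> g z = f z / z.

Definition without_common_zeros (M : set (C -> C)) : Prop :=
  forall w : C, exists2 f, M f & f w != 0.

Definition finite_dimensional (M : set (C -> C)) : Prop :=
  exists (n : nat) (e : 'I_n -> C -> C),
    (forall i, M (e i)) /\
    forall f, M f -> exists c : 'I_n -> C, forall z, f z = \sum_i c i * e i z.

Definition infinite_dimensional (M : set (C -> C)) : Prop :=
  ~ finite_dimensional M.

End FockSpaces.

(* Main.v *)
Require Import Defs.
From mathcomp Require Import all_boot all_order all_algebra.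
From mathcomp Require Import complex.
From mathcomp Require Import all_classical all_reals all_analysis.
From mathcomp Require Import measurable_realfun ring lra.
Import Order.TTheory GRing.Theory Num.Theory.
Import numFieldNormedType.Exports.
Import ComplexField.

Set Implicit Arguments.
Unset Strict Implicit.
Unset Printing Implicit Defensive.

Local Open Scope classical_set_scope.
Local Open Scope ring_scope.
Local Open Scope complex_scope.

Local Notation Re := complex.Re.
Local Notation Im := complex.Im.

(** Put [b = a / p]. The subspace consists of the [f] in the Fock space for which
[f(z) exp (b z^alpha - z^(alpha/2))] grows at most like a power of [|z|] in the
sector [|arg z| <= pi / (4 alpha)]. Every [f] in the Fock space is at most a fixed
power of [1 + |z|] times [exp (b |z|^alpha)], with a constant controlled by its norm.
On the rays [|arg z| = pi / alpha] one has [z^alpha = - |z|^alpha] and [z^(alpha/2)]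
is imaginary, so the factor exactly compensates this growth, and the
Phragmen-Lindelof principle in [|arg z| <= pi / alpha] turns the unspecified
power bound of a member into one depending only on its norm. Hence the subspace is
closed. It does not contain [1], and it is stable under division by [z - w] at a
zero [w], which gives near invariance and, as a nonzero entire function has zeros
of finite order only, the absence of common zeros. Members come from the integrals
of [exp (A e^w - B z e^(nu w) - m w)] over a Hankel-type contour, with
[A = b (alpha - 1)], [B = b alpha], [nu = 1 - 1 / alpha] (a Bessel-type integral
replaces them when [alpha = 1]). They are [O(|z|^-m exp (b |z|^alpha))] and, in the
sector, [O(|exp (- b z^alpha)|)]; as [m] is arbitrary, they may be multiplied by
polynomials, so the dimension is infinite. *)

(** * Modulus, real and imaginary parts *)

Section Modulus.
Variable R : realType.
Local Notation C := R[i].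
Implicit Types (z w : C) (x y : R).

(** The constants in the membership condition may depend on the member, which makes the condition
    linear and stable under polynomial factors, but not visibly closed. A Fock bound has order
    [alpha], whereas the Phragmen-Lindelof principle in an opening [2 pi / alpha] admits only orders
    below [alpha / 2]. The power bound in the small sector bridges this gap: it leaves two lateral
    sectors of opening [3 pi / (4 alpha)], in which order [alpha] is admissible. They yield a power
    bound in the whole opening, with constants still depending on the member; a second application
    there, to a function now known to have power growth, keeps only the constants of the edges. The
    factor [exp (- z^(alpha/2))] is bounded in the sector and leaves room at [alpha = 1]. There the
    sector is the slit plane, and if [f(z) exp (b z)] itself had power growth, it would be a
    polynomial [P]; but [P(z) exp (- b z)] lies in the Fock space only for [P = 0], the weighted
    modulus not being integrable near the negative axis. *)

Definition cabs : C -> R := @Normc.normc R.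

Lemma cabsE z : cabs z = Num.sqrt (Re z ^+ 2 + Im z ^+ 2).
Proof. by case: z. Qed.

Lemma le_of_eq x y : x = y -> x <= y.
Proof. by move=> ->. Qed.

Lemma cabs_ge0 z : 0 <= cabs z. Proof. by rewrite cabsE sqrtr_ge0. Qed.

Lemma cabs0 : cabs 0 = 0. Proof. exact: Normc.normc0. Qed.

Lemma cabs1 : cabs 1 = 1. Proof. exact: Normc.normc1. Qed.

Lemma cabsM z w : cabs (z * w) = cabs z * cabs w. Proof. exact: Normc.normcM. Qed.

Lemma cabsN z : cabs (- z) = cabs z. Proof. exact: normcN. Qed.

Lemma cabsV z : cabs z^-1 = (cabs z)^-1. Proof. exact: Normc.normcV. Qed.

Lemma cabsD z w : cabs (z + w) <= cabs z + cabs w. Proof. exact: le_normcD. Qed.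

Lemma cabsB z w : cabs (z - w) <= cabs z + cabs w.
Proof. by rewrite -(cabsN w) cabsD. Qed.

Lemma cabs_distC z w : cabs (z - w) = cabs (w - z).
Proof. by rewrite -cabsN opprB. Qed.

Lemma cabs_eq0 z : (cabs z == 0) = (z == 0).
Proof.
apply/eqP/eqP => [|->]; last exact: cabs0.
exact: Normc.eq0_normc.
Qed.

Lemma cabs_gt0 z : (0 < cabs z) = (z != 0).
Proof. by rewrite lt_neqAle cabs_ge0 andbT eq_sym cabs_eq0. Qed.

Lemma cabsX z n : cabs (z ^+ n) = cabs z ^+ n.
Proof. by elim: n => [|n IH]; rewrite ?expr0 ?cabs1// !exprS cabsM IH. Qed.

Lemma cabs_real x : cabs x%:C = `|x|.
Proof. by rewrite cabsE /= expr0n addr0 sqrtr_sqr. Qed.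

Lemma cabs_i : cabs 'i%C = 1.
Proof. by rewrite cabsE /= expr0n add0r expr1n sqrtr1. Qed.

Lemma sqr_cabs z : cabs z ^+ 2 = Re z ^+ 2 + Im z ^+ 2.
Proof. by rewrite cabsE sqr_sqrtr// addr_ge0// sqr_ge0. Qed.

Lemma normr_Re_le z : `|Re z| <= cabs z.
Proof. by rewrite cabsE -sqrtr_sqr ler_wsqrtr// lerDl sqr_ge0. Qed.

Lemma normr_Im_le z : `|Im z| <= cabs z.
Proof. by rewrite cabsE -sqrtr_sqr ler_wsqrtr// lerDr sqr_ge0. Qed.

Lemma Re_le_cabs z : Re z <= cabs z.
Proof. exact: le_trans (ler_norm _) (normr_Re_le z). Qed.

Lemma cplxE z : z = (Re z)%:C + 'i%C * (Im z)%:C.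
Proof. exact: complexE. Qed.

Lemma cabs_le_ReIm z : cabs z <= `|Re z| + `|Im z|.
Proof.
rewrite {1}(cplxE z); apply: le_trans (cabsD _ _) _.
by rewrite cabsM cabs_i mul1r !cabs_real.
Qed.

Lemma cabs_dist z w : `|cabs z - cabs w| <= cabs (z - w).
Proof.
rewrite ler_norml; apply/andP; split.
  have := cabsD z (w - z); rewrite addrC subrK cabs_distC; lra.
by have := cabsD w (z - w); rewrite addrC subrK; lra.
Qed.

Lemma cplx_ext z w : Re z = Re w -> Im z = Im w -> z = w.
Proof. by case: z w => [a b] [c d] /= -> ->. Qed.

Lemma reD z w : Re (z + w) = Re z + Re w. Proof. by case: z w => [a b] []. Qed.
Lemma imD z w : Im (z + w) = Im z + Im w. Proof. by case: z w => [a b] []. Qed.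
Lemma reN z : Re (- z) = - Re z. Proof. by case: z. Qed.
Lemma imN z : Im (- z) = - Im z. Proof. by case: z. Qed.
Lemma reM z w : Re (z * w) = Re z * Re w - Im z * Im w.
Proof. by case: z w => [a b] []. Qed.
Lemma imM z w : Im (z * w) = Re z * Im w + Im z * Re w.
Proof. by case: z w => [a b] [c d]. Qed.

End Modulus.

Arguments cabs {R}.

(** * Complex differentiability in epsilon-delta form *)

Section ComplexDerivative.
Variable R : realType.
Local Notation C := R[i].
Implicit Types (f g : C -> C) (z l m h c : C).

(** Multiplied out by [cabs h], so that [h = 0] needs no exclusion and all estimates stay in [R];
    [cderivE] ties it to [derivable]. *)
Definition cderiv f z l := forall e : R, 0 < e ->
  exists2 d : R, 0 < d &
    forall h, cabs h < d -> cabs (f (z + h) - f z - l * h) <= e * cabs h.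

Definition ccont f z := forall e : R, 0 < e ->
  exists2 d : R, 0 < d & forall h, cabs h < d -> cabs (f (z + h) - f z) <= e.

Lemma cderiv_lip f z l : cderiv f z l ->
  exists2 d : R, 0 < d &
    forall h, cabs h < d -> cabs (f (z + h) - f z) <= (cabs l + 1) * cabs h.
Proof.
move=> /(_ 1 ltr01)[d d0 H]; exists d => // h /H; rewrite mul1r => Hh.
rewrite -(subrK (l * h) (f (z + h) - f z)).
by apply: le_trans (cabsD _ _) _; rewrite cabsM; lra.
Qed.

Lemma cderiv_ccont f z l : cderiv f z l -> ccont f z.
Proof.
move=> /cderiv_lip[d d0 H] e e0.
have l0 : 0 < cabs l + 1 by have := cabs_ge0 l; lra.
exists (Num.min d (e / (cabs l + 1))); first by rewrite lt_min d0 divr_gt0.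
move=> h; rewrite lt_min => /andP[/H hd he]; apply: le_trans hd _.
by rewrite mulrC -ler_pdivlMr// ltW.
Qed.

Lemma cderiv_cst c z : cderiv (fun=> c) z 0.
Proof.
by move=> e e0; exists 1 => // h _; rewrite (_ : c - c - 0 * h = 0) ?cabs0 ?mulr_ge0 ?cabs_ge0 ?ltW//; ring.
Qed.

Lemma cderiv_id z : cderiv id z 1.
Proof.
move=> e e0; exists 1 => // h _; rewrite (_ : z + h - z - 1 * h = 0) ?cabs0; last by ring.
by rewrite mulr_ge0 ?cabs_ge0 ?ltW.
Qed.

Lemma cderivD f g z l m : cderiv f z l -> cderiv g z m ->
  cderiv (fun w => f w + g w) z (l + m).
Proof.
move=> Hf Hg e e0; have e2 : 0 < e / 2 by lra.
have [d1 d10 H1] := Hf _ e2; have [d2 d20 H2] := Hg _ e2.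
exists (Num.min d1 d2); first by rewrite lt_min d10.
move=> h; rewrite lt_min => /andP[/H1 h1 /H2 h2].
have -> : f (z + h) + g (z + h) - (f z + g z) - (l + m) * h
  = (f (z + h) - f z - l * h) + (g (z + h) - g z - m * h) by ring.
by apply: le_trans (cabsD _ _) _; lra.
Qed.

Lemma cderivZ f z l c : cderiv f z l -> cderiv (fun w => c * f w) z (c * l).
Proof.
move=> Hf e e0; have c1 : 0 < cabs c + 1 by have := cabs_ge0 c; lra.
have [d d0 H] := Hf (e / (cabs c + 1)) (divr_gt0 e0 c1).
exists d => // h /H Hh.
have -> : c * f (z + h) - c * f z - c * l * h = c * (f (z + h) - f z - l * h) by ring.
rewrite cabsM; apply: (@le_trans _ _ ((cabs c + 1) * (e / (cabs c + 1) * cabs h))).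
  by apply: ler_pM => //; [exact: cabs_ge0|exact: cabs_ge0|lra].
by rewrite mulrA mulrCA mulfV ?gt_eqF// mulr1.
Qed.

Lemma cderivN f z l : cderiv f z l -> cderiv (fun w => - f w) z (- l).
Proof.
move=> /(cderivZ (-1)); rewrite mulN1r => H e /H[d d0 Hd]; exists d => // h /Hd.
by rewrite !mulN1r.
Qed.

Lemma cderivB f g z l m : cderiv f z l -> cderiv g z m ->
  cderiv (fun w => f w - g w) z (l - m).
Proof. by move=> Hf /cderivN; exact: cderivD. Qed.

Lemma cderiv_subC w z : cderiv (fun z => z - w) z 1.
Proof. by rewrite -[1]subr0; apply: cderivB; [exact: cderiv_id|exact: cderiv_cst]. Qed.

Lemma cderiv_comp f g z l m : cderiv f z l -> cderiv g (f z) m ->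
  cderiv (g \o f) z (m * l).
Proof.
move=> Hf Hg e e0.
have [d1 d10 H1] := cderiv_lip Hf.
have l0 : 0 < cabs l + 1 by have := cabs_ge0 l; lra.
have m0 : 0 < cabs m + 1 by have := cabs_ge0 m; lra.
have a0 : 0 < e / 2 / (cabs l + 1) by rewrite divr_gt0//; lra.
have b0 : 0 < e / 2 / (cabs m + 1) by rewrite divr_gt0//; lra.
have [d2 d20 H2] := Hg _ a0; have [d3 d30 H3] := Hf _ b0.
exists (Num.min d1 (Num.min d3 (d2 / (cabs l + 1)))).
  by rewrite !lt_min d10 d30 divr_gt0.
move=> h; rewrite !lt_min => /andP[/H1 h1 /andP[/H3 h3 hd]].
set k := f (z + h) - f z in h1 h3 *.
have kd : cabs k < d2.
  by apply: le_lt_trans h1 _; rewrite mulrC -ltr_pdivlMr.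
have K2 := H2 _ kd; have fzk : f z + k = f (z + h) by rewrite addrC subrK.
rewrite fzk in K2.
have -> : (g \o f) (z + h) - (g \o f) z - m * l * h =
  (g (f (z + h)) - g (f z) - m * k) + m * (k - l * h) by rewrite /=; ring.
apply: le_trans (cabsD _ _) _; rewrite cabsM.
have A : e / 2 / (cabs l + 1) * cabs k <= e / 2 * cabs h.
  apply: le_trans (ler_wpM2l (ltW a0) h1) _.
  by rewrite mulrA -mulrA mulrA divfK ?gt_eqF.
have B : cabs m * cabs (k - l * h) <= e / 2 * cabs h.
  apply: (@le_trans _ _ ((cabs m + 1) * (e / 2 / (cabs m + 1) * cabs h))).
    by apply: ler_pM => //; [exact: cabs_ge0|exact: cabs_ge0|lra].
  by apply: le_of_eq; field; rewrite gt_eqF.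
clear H1 H2 H3 Hf Hg; lra.
Qed.

Lemma cderiv_sqr z : cderiv (fun w => w * w) z (z + z).
Proof.
move=> e e0; exists e => // h he.
have -> : (z + h) * (z + h) - z * z - (z + z) * h = h * h by ring.
by rewrite cabsM ler_wpM2r ?cabs_ge0// ltW.
Qed.

(* Polarization, so that the product rule follows from the chain rule for squares. *)
Lemma cderivM f g z l m : cderiv f z l -> cderiv g z m ->
  cderiv (fun w => f w * g w) z (l * g z + f z * m).
Proof.
move=> Hf Hg.
have HD := cderiv_comp (cderivD Hf Hg) (@cderiv_sqr _).
have HB := cderiv_comp (cderivB Hf Hg) (@cderiv_sqr _).
have := cderivZ (4%:R)^-1 (cderivB HD HB).
have n4 : (4%:R : C) != 0 by rewrite pnatr_eq0.
have -> : (4%:R)^-1 * ((f z + g z + (f z + g z)) * (l + m)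
   - (f z - g z + (f z - g z)) * (l - m)) = l * g z + f z * m.
  by field.
have -> : (fun w => (4%:R)^-1 * (((fun w => w * w) \o (fun w => f w + g w)) w
   - ((fun w => w * w) \o (fun w => f w - g w)) w)) = (fun w => f w * g w).
  by apply/funext => w /=; field.
by [].
Qed.

(** The remainder is [h^2 / (z^2 (z + h))], and [cabs h < cabs z / 2] keeps [z + h] at distance at
    least [cabs z / 2] from 0. *)
Lemma cderiv_inv z : z != 0 -> cderiv (fun w => w^-1) z (- (z ^- 2)).
Proof.
move=> z0 e e0; have a0 : 0 < cabs z by rewrite cabs_gt0.
have p30 : 0 < cabs z ^+ 3 by rewrite exprn_gt0.
exists (Num.min (cabs z / 2) (e * cabs z ^+ 3 / 2)).
  by rewrite lt_min !divr_gt0// mulr_gt0.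
move=> h; rewrite lt_min => /andP[h1 h2].
have b : cabs z / 2 <= cabs (z + h).
  by have := cabsD (z + h) (- h); rewrite addrK cabsN; lra.
have zh0 : z + h != 0 by rewrite -cabs_gt0; apply: lt_le_trans b; lra.
have -> : (z + h)^-1 - z^-1 - - z ^- 2 * h = h * (h * (z ^- 2 * (z + h)^-1)).
  by field; rewrite z0 zh0.
rewrite cabsM mulrC ler_wpM2r ?cabs_ge0// !cabsM !cabsV cabsX.
have -> : e = e * cabs z ^+ 3 / 2 * (cabs z ^- 2 * (cabs z / 2)^-1).
  by field; rewrite gt_eqF.
apply: ler_pM; rewrite ?cabs_ge0 ?mulr_ge0 ?invr_ge0 ?exprn_ge0 ?cabs_ge0//; first exact: ltW.
by rewrite ler_wpM2l ?invr_ge0 ?exprn_ge0 ?cabs_ge0// lef_pV2// posrE; lra.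
Qed.

Lemma cderiv_near f g z l (d : R) : 0 < d ->
  (forall h, cabs h < d -> f (z + h) = g (z + h)) -> cderiv f z l -> cderiv g z l.
Proof.
move=> d0 fg Hf e /Hf[d' d'0 H]; exists (Num.min d d'); first by rewrite lt_min d0.
move=> h; rewrite lt_min => /andP[/fg <- /H].
by have := fg 0; rewrite cabs0 addr0 => ->.
Qed.

Lemma normC_cabs z : `|z| = (cabs z)%:C.
Proof. by rewrite normc_def cabsE. Qed.

Lemma cderivE f z : derivable (f : C^o -> C^o) z 1 <-> exists l, cderiv f z l.
Proof.
have E (l h : C) : h != 0 ->
    cabs (l - h^-1 *: (f (h *: (1 : C^o) + z) - f z)) * cabs h = cabs (f (z + h) - f z - l * h).
  move=> h0; rewrite -cabsM -cabsN /GRing.scale/= mulr1 [h + z]addrC; congr cabs.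
  by field.
split.
  move=> /cvg_ex[/= l /cvgrPdist_le Hl]; exists l => e e0.
  have /Hl : 0 < e%:C :> C by rewrite ltcR.
  rewrite /dnbhs near_withinE => /(@nbhs_norm0P C C^o)[/= d d0 H].
  move: d0; rewrite ltcE/= => /andP[/eqP di d0].
  exists (Re d) => // h hd; have [->|h0] := eqVneq h 0.
    by rewrite addr0 subrr mulr0 subrr cabs0 mulr0.
  have : `|h| < d by rewrite normC_cabs ltcE /= di eqxx.
  move=> /H /(_ h0); rewrite normC_cabs lecR => He.
  by rewrite -E// ler_wpM2r ?cabs_ge0.
move=> [l Hl]; apply/cvg_ex; exists l; apply/cvgrPdist_le => /= e.
rewrite ltcE/= => /andP[/eqP ei e0].
have [d d0 H] := Hl _ e0.
rewrite /dnbhs near_withinE; apply/(@nbhs_norm0P C C^o); exists d%:C; first by rewrite /= ltcR.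
move=> h /=; rewrite normC_cabs ltcR => /H + h0.
by rewrite -E// ler_pM2r ?cabs_gt0// normC_cabs lecE /= ei eqxx.
Qed.

Lemma entireP f : entire f <-> forall z, exists l, cderiv f z l.
Proof. by split => H z; apply/cderivE; exact: H. Qed.

End ComplexDerivative.

(** * Real derivatives, monotonicity and primitives *)

Section RealPrimitive.
Variable R : realType.
Implicit Types (f F : R -> R) (t x l : R).

Lemma is_derive_epsP f t l : is_derive t (1 : R^o) (f : R^o -> R^o) l <->
  (forall e : R, 0 < e -> exists2 d : R, 0 < d &
     forall s, `|s| < d -> `|f (t + s) - f t - l * s| <= e * `|s|).
Proof.
have E (h : R) : h != 0 ->
    `|l - h^-1 *: (f (h *: (1 : R^o) + t) - f t)| * `|h| = `|f (t + h) - f t - l * h|.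
  move=> h0; rewrite -normrM -normrN /GRing.scale/= mulr1 [h + t]addrC; congr `|_|.
  by field.
split.
  move=> [/cvgP Hd Hl] e e0.
  have : (fun h => h^-1 *: (f (h *: (1 : R^o) + t) - f t)) @ 0^' --> l.
    by move: Hd; rewrite /derive in Hl; rewrite Hl.
  move=> /cvgrPdist_le/(_ _ e0).
  rewrite /dnbhs near_withinE => /(@nbhs_norm0P R R^o)[/= d d0 H].
  exists d => // h hd; have [->|h0] := eqVneq h 0.
    by rewrite addr0 subrr mulr0 subrr normr0 mulr0.
  by rewrite -E// ler_wpM2r// H.
move=> H.
have {H} : (fun h => h^-1 *: (f (h *: (1 : R^o) + t) - f t)) @ 0^' --> l.
  apply/cvgrPdist_le => e /H[d d0 {}H].
  rewrite /dnbhs near_withinE; apply/(@nbhs_norm0P R R^o); exists d => //.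
  by move=> h /= /H + h0; rewrite -E// ler_pM2r// normr_gt0.
move=> H; split; first by apply/cvg_ex; exists l.
exact/cvg_lim.
Qed.

Lemma is_derive_mull (c x : R) : is_derive x (1 : R^o) ((fun t => c * t) : R^o -> R^o) c.
Proof.
have : is_derive x (1 : R^o) (( *:%R c : R^o -> R^o) \o id) (c *: (1 : R^o)).
  exact: is_deriveZ.
by rewrite /GRing.scale/= mulr1.
Qed.

Lemma is_derive_cont f t l : is_derive t (1 : R^o) (f : R^o -> R^o) l -> {for t, continuous f}.
Proof. by move=> [Hd _]; apply/differentiable_continuous/derivable1_diffP. Qed.

Lemma derive_ge0_le (f df : R -> R) (a b : R) : a <= b ->
  (forall x, a <= x <= b -> is_derive x (1 : R^o) (f : R^o -> R^o) (df x)) ->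
  (forall x, a <= x <= b -> 0 <= df x) -> f a <= f b.
Proof.
move=> ab Hd H.
have [||c cab E] := @MVT_segment _ f df a b ab.
- by move=> c; rewrite in_itv/= => /andP[ac cb]; apply: Hd; rewrite (ltW ac) ltW.
- apply: continuous_in_subspaceT => x; rewrite inE/= in_itv/= => xab.
  exact: is_derive_cont (Hd _ xab).
- rewrite -subr_ge0 E mulr_ge0// ?subr_ge0//; apply: H.
  by move: cab; rewrite in_itv.
Qed.

Lemma derive_cst (f : R -> R) (a b : R) : a <= b ->
  (forall x, a <= x <= b -> is_derive x (1 : R^o) (f : R^o -> R^o) 0) -> f a = f b.
Proof.
move=> ab Hd; apply/eqP; rewrite eq_le; apply/andP; split.
  exact: (@derive_ge0_le f (fun=> 0)).
rewrite -lerN2; apply: (@derive_ge0_le (fun x => - f x) (fun=> 0)) => // x /Hd H.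
by rewrite -oppr0; exact: is_deriveN.
Qed.

Local Notation mu := (@lebesgue_measure R).

Lemma continuous_integrable f (a b : R) : continuous f -> mu.-integrable `[a, b] (EFin \o f).
Proof.
move=> cf; apply: continuous_compact_integrable; first exact: segment_compact.
by apply: continuous_subspaceT.
Qed.

(** An integral with lower endpoint [- n] is differentiated only to the right of that endpoint.
    Normalised at 0, any two of these integrals agree where both are differentiated, so they glue to
    a primitive on the whole line, with [n] depending on [x]. *)
Lemma continuous_primitive f : continuous f ->
  exists F : R -> R, forall x, is_derive x (1 : R^o) (F : R^o -> R^o) (f x).
Proof.
move=> cf.
pose I (a x : R) := (\int[mu]_(t in `[a, x]) f t)%R.
have dI a x : a < x -> is_derive x (1 : R^o) (I a : R^o -> R^o) (f x).
  move=> ax.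
  have x1 : x < x + 1 by rewrite ltrDl.
  have [d e] := continuous_FTC1_closed x1 (continuous_integrable a (x + 1) cf) ax (cf x).
  by move: e; rewrite derive1E => e; split.
pose G n x := I (- n%:R) x - I (- n%:R) 0.
have dG n x : - n%:R < x -> is_derive x (1 : R^o) (G n : R^o -> R^o) (f x).
  by move=> /dI d; rewrite -[f x]subr0; apply: is_deriveB.
have GE n m x : (0 < n)%N -> (n <= m)%N -> - n%:R < x -> G n x = G m x.
  move=> n0 nm nx; apply/eqP; rewrite -subr_eq0; apply/eqP.
  have mn : - m%:R <= - n%:R :> R by rewrite lerN2 ler_nat.
  have nn0 : - n%:R < 0 :> R by rewrite oppr_lt0 ltr0n.
  have D (y : R) : - n%:R < y -> is_derive y (1 : R^o) ((fun y => G n y - G m y) : R^o -> R^o) 0.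
    move=> ny; rewrite -(subrr (f y)); apply: is_deriveB; apply: dG => //.
    exact: le_lt_trans ny.
  have -> : 0 = G n 0 - G m 0 by rewrite /G !subrr.
  have [x0|/ltW x0] := leP x 0.
    apply: (@derive_cst (fun y => G n y - G m y) x 0 x0) => y /andP[xy _].
    by apply: D; exact: lt_le_trans xy.
  symmetry; apply: (@derive_cst (fun y => G n y - G m y) 0 x x0) => y /andP[xy _].
  by apply: D; exact: lt_le_trans xy.
pose nx x := (Num.truncn `|x|).+1.
have nxP x : `|x| < (nx x)%:R by rewrite /nx; exact: truncnS_gt.
exists (fun x => G (nx x) x) => x.
have := dG (nx x) x; have /ltr_normlP[nx1 nx2] := nxP x.
rewrite ltrNl => /(_ nx1) /is_derive_epsP H.
apply/is_derive_epsP => e /H[d d0 {}H].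
exists (Num.min d ((nx x)%:R - `|x|)); first by rewrite lt_min d0 subr_gt0 nxP.
move=> s; rewrite lt_min => /andP[/H {}H sx].
have xs : `|x + s| < (nx x)%:R by apply: le_lt_trans (ler_normD _ _) _; rewrite -ltrBrDl.
suff -> : G (nx (x + s)) (x + s) = G (nx x) (x + s) by [].
have /ltr_normlP[xs1 xs2] := xs; have /ltr_normlP[ys1 ys2] := nxP (x + s).
have [h|/ltnW h] := leqP (nx (x + s)) (nx x); first by apply: GE => //; rewrite ltrNl.
by symmetry; apply: GE => //; rewrite ltrNl.
Qed.

End RealPrimitive.

(** * Integration of complex functions of a real variable *)

Section ComplexIntegral.
Variable R : realType.
Local Notation C := R[i].
Implicit Types (p g : R -> C) (t a b : R) (l c z : C).

Definition rderiv p t l := forall e : R, 0 < e -> exists2 d : R, 0 < d &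
  forall s : R, `|s| < d -> cabs (p (t + s) - p t - l * s%:C) <= e * `|s|.

Definition rcont g t := forall e : R, 0 < e -> exists2 d : R, 0 < d &
  forall s : R, `|s| < d -> cabs (g (t + s) - g t) <= e.

Lemma realcD (x y : R) : (x + y)%:C = x%:C + y%:C. Proof. exact: rmorphD. Qed.
Lemma realcN (x : R) : (- x)%:C = - x%:C. Proof. exact: rmorphN. Qed.
Lemma realcB (x y : R) : (x - y)%:C = x%:C - y%:C. Proof. exact: rmorphB. Qed.
Lemma reZr (c : C) (x : R) : Re (c * x%:C) = Re c * x.
Proof. by rewrite reM /= mulr0 subr0. Qed.
Lemma imZr (c : C) (x : R) : Im (c * x%:C) = Im c * x.
Proof. by rewrite imM /= mulr0 add0r. Qed.

Lemma reZl (x : R) (c : C) : Re (x%:C * c) = x * Re c.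
Proof. by rewrite mulrC reZr mulrC. Qed.
Lemma imZl (x : R) (c : C) : Im (x%:C * c) = x * Im c.
Proof. by rewrite mulrC imZr mulrC. Qed.

Lemma rderiv_ReIm p t l :
  is_derive t (1 : R^o) ((fun s => Re (p s)) : R^o -> R^o) (Re l) ->
  is_derive t (1 : R^o) ((fun s => Im (p s)) : R^o -> R^o) (Im l) -> rderiv p t l.
Proof.
move=> /is_derive_epsP Hr /is_derive_epsP Hi e e0; have e2 : 0 < e / 2 by lra.
have [d1 d10 H1] := Hr _ e2; have [d2 d20 H2] := Hi _ e2.
exists (Num.min d1 d2); first by rewrite lt_min d10.
move=> s; rewrite lt_min => /andP[/H1 h1 /H2 h2]; apply: le_trans (cabs_le_ReIm _) _.
rewrite !(reD, reN, imD, imN) reZr imZr; lra.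
Qed.

Lemma rderivRe p t l : rderiv p t l ->
  is_derive t (1 : R^o) ((fun s => Re (p s)) : R^o -> R^o) (Re l).
Proof.
move=> H; apply/is_derive_epsP => e /H[d d0 {}H]; exists d => // s /H.
by apply: le_trans; rewrite -reZr -!reN -!reD normr_Re_le.
Qed.

Lemma rderivIm p t l : rderiv p t l ->
  is_derive t (1 : R^o) ((fun s => Im (p s)) : R^o -> R^o) (Im l).
Proof.
move=> H; apply/is_derive_epsP => e /H[d d0 {}H]; exists d => // s /H.
by apply: le_trans; rewrite -imZr -!imN -!imD normr_Im_le.
Qed.

Lemma rderiv_affine (f : C -> C) z c t l : cderiv f (z + t%:C * c) l ->
  rderiv (fun s => f (z + s%:C * c)) t (l * c).
Proof.
move=> H e e0; have c1 : 0 < cabs c + 1 by have := cabs_ge0 c; lra.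
have [d d0 {}H] := H (e / (cabs c + 1)) (divr_gt0 e0 c1).
exists (d / (cabs c + 1)); first by rewrite divr_gt0.
move=> s sd; have E : cabs (s%:C * c) <= (cabs c + 1) * `|s|.
  by rewrite cabsM cabs_real mulrC ler_wpM2r//; lra.
have : cabs (s%:C * c) < d.
  by apply: le_lt_trans E _; rewrite mulrC -ltr_pdivlMr.
move=> /H h; rewrite realcD mulrDl addrA (_ : l * c * s%:C = l * (s%:C * c)); last by ring.
apply: le_trans h _.
apply: le_trans (ler_wpM2l _ E) _; first by rewrite ltW// divr_gt0.
by rewrite mulrA divfK// gt_eqF.
Qed.

Lemma rderivD p q t l m : rderiv p t l -> rderiv q t m ->
  rderiv (fun s => p s + q s) t (l + m).
Proof.
move=> Hf Hg e e0; have e2 : 0 < e / 2 by lra.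
have [d1 d10 H1] := Hf _ e2; have [d2 d20 H2] := Hg _ e2.
exists (Num.min d1 d2); first by rewrite lt_min d10.
move=> h; rewrite lt_min => /andP[/H1 h1 /H2 h2].
have -> : p (t + h) + q (t + h) - (p t + q t) - (l + m) * h%:C
  = (p (t + h) - p t - l * h%:C) + (q (t + h) - q t - m * h%:C) by ring.
by apply: le_trans (cabsD _ _) _; lra.
Qed.

Lemma rderivZ p t l c : rderiv p t l -> rderiv (fun s => c * p s) t (c * l).
Proof.
move=> H e e0; have c1 : 0 < cabs c + 1 by have := cabs_ge0 c; lra.
have [d d0 {}H] := H (e / (cabs c + 1)) (divr_gt0 e0 c1).
exists d => // s /H h.
have -> : c * p (t + s) - c * p t - c * l * s%:C = c * (p (t + s) - p t - l * s%:C) by ring.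
rewrite cabsM; apply: (@le_trans _ _ ((cabs c + 1) * (e / (cabs c + 1) * `|s|))).
  by apply: ler_pM => //; [exact: cabs_ge0|exact: cabs_ge0|lra].
by rewrite mulrA mulrCA mulfV ?gt_eqF// mulr1.
Qed.

Lemma rderivN p t l : rderiv p t l -> rderiv (fun s => - p s) t (- l).
Proof.
move=> /(rderivZ (-1)); rewrite mulN1r => H e /H[d d0 Hd]; exists d => // h /Hd.
by rewrite !mulN1r.
Qed.

Lemma rderivB p q t l m : rderiv p t l -> rderiv q t m ->
  rderiv (fun s => p s - q s) t (l - m).
Proof. by move=> Hf /rderivN; exact: rderivD. Qed.

Lemma rcont_real (phi : C -> R) g t :
  (forall z w, `|phi z - phi w| <= cabs (z - w)) -> rcont g t ->
  {for t, continuous (fun s => phi (g s))}.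
Proof.
move=> Hphi H; apply/cvgrPdist_le => e /H[d d0 {}H].
apply/nbhs_normP; exists d => // s /=; rewrite -normrN opprB => /H.
by rewrite subrKC => h; apply: le_trans (Hphi _ _) _; rewrite cabs_distC.
Qed.

Lemma rcont_continuousRe g : (forall t, rcont g t) -> continuous (fun s => Re (g s)).
Proof.
move=> H t; apply: (@rcont_real (@complex.Re R)); last exact: H.
by move=> z w; rewrite -reN -reD normr_Re_le.
Qed.

Lemma rcont_continuousIm g : (forall t, rcont g t) -> continuous (fun s => Im (g s)).
Proof.
move=> H t; apply: (@rcont_real (@complex.Im R)); last exact: H.
by move=> z w; rewrite -imN -imD normr_Im_le.
Qed.

Lemma rcont_continuous_cabs g : (forall t, rcont g t) -> continuous (fun s => cabs (g s)).
Proof. by move=> H t; apply: rcont_real; [exact: cabs_dist|exact: H]. Qed.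

Lemma rcont_affine (f : C -> C) z c t : ccont f (z + t%:C * c) ->
  rcont (fun s => f (z + s%:C * c)) t.
Proof.
move=> H e e0; have c1 : 0 < cabs c + 1 by have := cabs_ge0 c; lra.
have [d d0 {}H] := H e e0.
exists (d / (cabs c + 1)); first by rewrite divr_gt0.
move=> s sd; have E : cabs (s%:C * c) <= (cabs c + 1) * `|s|.
  by rewrite cabsM cabs_real mulrC ler_wpM2r//; lra.
have : cabs (s%:C * c) < d.
  by apply: le_lt_trans E _; rewrite mulrC -ltr_pdivlMr.
by move=> /H; rewrite realcD mulrDl addrA.
Qed.

Lemma rcontD g h t : rcont g t -> rcont h t -> rcont (fun s => g s + h s) t.
Proof.
move=> Hf Hg e e0; have e2 : 0 < e / 2 by lra.
have [d1 d10 H1] := Hf _ e2; have [d2 d20 H2] := Hg _ e2.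
exists (Num.min d1 d2); first by rewrite lt_min d10.
move=> s; rewrite lt_min => /andP[/H1 h1 /H2 h2].
rewrite opprD addrACA; apply: le_trans (cabsD _ _) _; lra.
Qed.

Lemma rcont_cst c t : rcont (fun=> c) t.
Proof. by move=> e e0; exists 1 => // s _; rewrite subrr cabs0 ltW. Qed.

Lemma rcontZ g t c : rcont g t -> rcont (fun s => c * g s) t.
Proof.
move=> H e e0; have c1 : 0 < cabs c + 1 by have := cabs_ge0 c; lra.
have [d d0 {}H] := H (e / (cabs c + 1)) (divr_gt0 e0 c1).
exists d => // s /H h; rewrite -mulrBr cabsM.
apply: (@le_trans _ _ ((cabs c + 1) * (e / (cabs c + 1)))).
  by apply: ler_pM => //; [exact: cabs_ge0|exact: cabs_ge0|lra].
by rewrite mulrCA mulfV ?gt_eqF// mulr1.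
Qed.

Lemma rcontN g t : rcont g t -> rcont (fun s => - g s) t.
Proof.
by move=> H e /H[d d0 {}H]; exists d => // s /H; rewrite -opprD cabsN.
Qed.

Lemma rcontB g h t : rcont g t -> rcont h t -> rcont (fun s => g s - h s) t.
Proof. by move=> Hg /rcontN; exact: rcontD. Qed.

Lemma unit_direction z : exists2 c : C, cabs c <= 1 & Re (c * z) = cabs z.
Proof.
have [->|z0] := eqVneq z 0; first by exists 0; rewrite ?cabs0 ?mul0r.
have a0 : 0 < cabs z by rewrite cabs_gt0.
exists ((Re z / cabs z) +i* (- Im z / cabs z)).
  rewrite cabsE /= !expr_div_n sqrrN -mulrDl -sqr_cabs divff ?sqrtr1//.
  by rewrite expf_neq0 ?gt_eqF.
rewrite reM /=; apply: (@mulIf _ (cabs z)); first by rewrite gt_eqF.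
by rewrite -expr2 sqr_cabs; field; rewrite gt_eqF.
Qed.

(** A factor [c] of modulus at most 1 turns the increment of [p] into its modulus, which leaves a
    real statement: [q - Re (c p)] is nondecreasing, as [Re (c p')] is at most [cabs p']. *)
Lemma cmean_value p p' (q q' : R -> R) a b : a <= b ->
  (forall t, a <= t <= b -> rderiv p t (p' t)) ->
  (forall t, a <= t <= b -> is_derive t (1 : R^o) (q : R^o -> R^o) (q' t)) ->
  (forall t, a <= t <= b -> cabs (p' t) <= q' t) ->
  cabs (p b - p a) <= q b - q a.
Proof.
move=> ab Hp Hq Hle; have [c c1 cE] := unit_direction (p b - p a).
rewrite -cE mulrBr reD reN.
suff : q a - Re (c * p a) <= q b - Re (c * p b) by lra.
apply: (@derive_ge0_le _ (fun t => q t - Re (c * p t)) (fun t => q' t - Re (c * p' t)) a b ab).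
  move=> t tab; apply: is_deriveB; first exact: Hq.
  by apply: (rderivRe (p := fun s => c * p s)); apply: rderivZ; exact: Hp.
move=> t tab; rewrite subr_ge0; apply: le_trans (Re_le_cabs _) _.
rewrite cabsM; apply: le_trans (Hle _ tab).
by rewrite -[X in _ <= X]mul1r ler_wpM2r ?cabs_ge0.
Qed.

Lemma cmean_value_bound p p' a b (M : R) : a <= b ->
  (forall t, a <= t <= b -> rderiv p t (p' t)) ->
  (forall t, a <= t <= b -> cabs (p' t) <= M) ->
  cabs (p b - p a) <= M * (b - a).
Proof.
move=> ab Hp HM; rewrite mulrBr.
apply: (@cmean_value p p' (fun t => M * t) (fun=> M)) => // t _.
exact: is_derive_mull.
Qed.

Definition is_primitive p g := forall t, rderiv p t (g t).

Lemma rcont_primitive g : (forall t, rcont g t) -> exists p, is_primitive p g.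
Proof.
move=> H; have [P HP] := continuous_primitive (rcont_continuousRe H).
have [Q HQ] := continuous_primitive (rcont_continuousIm H).
by exists (fun s => P s +i* Q s) => t; apply: rderiv_ReIm.
Qed.

Lemma primitive_unique p q g a b : is_primitive p g -> is_primitive q g ->
  p b - p a = q b - q a.
Proof.
move=> Hp Hq; suff W (x y : R) : x <= y -> p y - p x = q y - q x.
  have [ab|/ltW ab] := leP a b; first exact: W.
  by apply: oppr_inj; rewrite !opprB; exact: W.
move=> xy; apply/eqP; rewrite -subr_eq0 -cabs_eq0 eq_le cabs_ge0 andbT.
have -> : p y - p x - (q y - q x) = (p y - q y) - (p x - q x) by ring.
rewrite -[leRHS](mul0r (y - x)).
apply: (@cmean_value_bound (fun t => p t - q t) (fun=> 0)) => // [t _|t _]; last by rewrite cabs0.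
by rewrite -(subrr (g t)); apply: rderivB.
Qed.

(* Junk value 0 when [g] has no primitive; a continuous [g] has one. *)
Definition cint g a b : C :=
  match pselect (exists p, is_primitive p g) with
  | left H => projT1 (cid H) b - projT1 (cid H) a
  | right _ => 0
  end.

Lemma cint_FTC p g a b : is_primitive p g -> cint g a b = p b - p a.
Proof.
move=> H; rewrite /cint; case: pselect => [H'|]; last by case; exists p.
by apply: primitive_unique H; exact: (projT2 (cid H')).
Qed.

Lemma cintD g h a b : (forall t, rcont g t) -> (forall t, rcont h t) ->
  cint (fun t => g t + h t) a b = cint g a b + cint h a b.
Proof.
move=> /rcont_primitive[p Hp] /rcont_primitive[q Hq].
rewrite (cint_FTC _ _ Hp) (cint_FTC _ _ Hq).
rewrite (@cint_FTC (fun t => p t + q t)) => [|t]; first by rewrite opprD addrACA.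
exact: rderivD.
Qed.

Lemma cintZ c g a b : (forall t, rcont g t) ->
  cint (fun t => c * g t) a b = c * cint g a b.
Proof.
move=> /rcont_primitive[p Hp]; rewrite (cint_FTC _ _ Hp).
by rewrite (@cint_FTC (fun t => c * p t)) => [|t]; [rewrite mulrBr|exact: rderivZ].
Qed.

Lemma cintB g h a b : (forall t, rcont g t) -> (forall t, rcont h t) ->
  cint (fun t => g t - h t) a b = cint g a b - cint h a b.
Proof.
move=> /rcont_primitive[p Hp] /rcont_primitive[q Hq].
rewrite (cint_FTC _ _ Hp) (cint_FTC _ _ Hq).
rewrite (@cint_FTC (fun t => p t - q t)) => [|t]; first by ring.
exact: rderivB.
Qed.

Lemma cint_cat g a b x : cint g a x + cint g x b = cint g a b.
Proof. by rewrite /cint; case: pselect => ?; rewrite ?addr0// addrC subrKA. Qed.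

Lemma cint_le g a b (M : R) : a <= b -> (forall t, rcont g t) ->
  (forall t, a <= t <= b -> cabs (g t) <= M) -> cabs (cint g a b) <= M * (b - a).
Proof.
move=> ab /rcont_primitive[p Hp] HM; rewrite (cint_FTC _ _ Hp).
exact: (cmean_value_bound ab (fun t _ => Hp t) HM).
Qed.

Lemma cint_le_primitive g a b (q q' : R -> R) : a <= b -> (forall t, rcont g t) ->
  (forall t, a <= t <= b -> is_derive t (1 : R^o) (q : R^o -> R^o) (q' t)) ->
  (forall t, a <= t <= b -> cabs (g t) <= q' t) -> cabs (cint g a b) <= q b - q a.
Proof.
move=> ab /rcont_primitive[p Hp] Hq HM; rewrite (cint_FTC _ _ Hp).
exact: (cmean_value ab (fun t _ => Hp t) Hq HM).
Qed.

(** Bridge from integrals defined by primitives to Lebesgue measure, for the point evaluations,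
    which average over families of segments. *)
Lemma cint_le_Rintegral g a b : a <= b -> (forall t, rcont g t) ->
  ((cabs (cint g a b))%:E <= \int[@lebesgue_measure R]_(t in `[a, b]) (cabs (g t))%:E)%E.
Proof.
move=> ab cg; have [Q HQ] := continuous_primitive (rcont_continuous_cabs cg).
have H : cabs (cint g a b) <= Q b - Q a by apply: cint_le_primitive.
move: ab; rewrite le_eqVlt => /orP[/eqP ab|ab].
  by rewrite ab in H *; rewrite set_itv1 integral_set1 lee_fin; move: H; rewrite subrr.
have cQ x : {for x, continuous Q} by exact: is_derive_cont (HQ x).
rewrite (@continuous_FTC2 _ _ Q)//.
- by apply: continuous_subspaceT; exact: rcont_continuous_cabs.
- split; first by move=> x _; case: (HQ x).
  + by apply: cvg_at_right_filter; exact: cQ.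
  + by apply: cvg_at_left_filter; exact: cQ.
- by move=> x _; rewrite derive1E; case: (HQ x).
Qed.

End ComplexIntegral.

(** * The complex exponential *)

Section ComplexExponential.
Variable R : realType.
Local Notation C := R[i].
Implicit Types (z w : C).

Definition cexp z : C := (expR (Re z))%:C * (cos (Im z) +i* sin (Im z)).

Lemma reCexp z : Re (cexp z) = expR (Re z) * cos (Im z).
Proof. by rewrite /cexp reM /= mul0r subr0. Qed.

Lemma imCexp z : Im (cexp z) = expR (Re z) * sin (Im z).
Proof. by rewrite /cexp imM /= mul0r addr0. Qed.

Lemma cabs_cexp z : cabs (cexp z) = expR (Re z).
Proof.
rewrite /cexp cabsM cabs_real ger0_norm ?expR_ge0//.
by rewrite cabsE /= cos2Dsin2 sqrtr1 mulr1.
Qed.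

Lemma cexp0 : cexp 0 = 1.
Proof. by rewrite /cexp /= expR0 cos0 sin0 mul1r. Qed.

Lemma cexpD z w : cexp (z + w) = cexp z * cexp w.
Proof.
apply: cplx_ext.
  by rewrite reCexp reD imD expRD cosD (reM (cexp z)) !reCexp !imCexp; ring.
by rewrite imCexp reD imD expRD sinD (imM (cexp z)) !reCexp !imCexp; ring.
Qed.

Lemma cexp_neq0 z : cexp z != 0.
Proof. by rewrite -cabs_gt0 cabs_cexp expR_gt0. Qed.

Lemma cexpN z : cexp (- z) = (cexp z)^-1.
Proof. by apply: (mulIf (cexp_neq0 z)); rewrite mulVf ?cexp_neq0// -cexpD addNr cexp0. Qed.

Lemma cderiv_cexp z : cderiv cexp z (cexp z).
Proof.
have D0 : cderiv cexp 0 1.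
  (* The four error terms below add up to at most [k |x| + 5 k |y|], hence the division by 6. *)
  move=> e e0; pose k := Num.min (e / 6) 1.
  have k0 : 0 < k by rewrite lt_min ltr01 andbT; lra.
  have k1 : k <= 1 by rewrite ge_min lexx orbT.
  have ke : k <= e / 6 by rewrite ge_min lexx.
  have [d1 d10 H1] := (is_derive_epsP _ _ _).1 (is_derive_expR 0) _ k0.
  have [d2 d20 H2] := (is_derive_epsP _ _ _).1 (is_derive_sin 0) _ k0.
  have [d3 d30 H3] := (is_derive_epsP _ _ _).1 (is_derive_cos 0) _ k0.
  exists (Num.min (k / 2) (Num.min d1 (Num.min d2 d3))).
    by rewrite !lt_min d10 d20 d30 divr_gt0.
  move=> h; rewrite !lt_min => /and4P[h0 h1 h2 h3].
  have xh := normr_Re_le h; have yh := normr_Im_le h.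
  set x := Re h in xh; set y := Im h in yh.
  have E1 : `|expR x - 1 - x| <= k * `|x|.
    by have := H1 x (le_lt_trans xh h1); rewrite add0r expR0 mul1r.
  have E2 : `|sin y - y| <= k * `|y|.
    by have := H2 y (le_lt_trans yh h2); rewrite add0r sin0 cos0 mul1r subr0.
  have E3 : `|cos y - 1| <= k * `|y|.
    by have := H3 y (le_lt_trans yh h3); rewrite add0r sin0 cos0 oppr0 mul0r subr0.
  clear H1 H2 H3; apply: le_trans (cabs_le_ReIm _) _.
  rewrite add0r cexp0 mul1r !(reD, reN, imD, imN) reCexp imCexp -/x -/y /= subr0.
  have ax : `|x| <= k / 2 by apply: le_trans xh _; lra.
  have dx : `|expR x - 1| <= k.
    have -> : expR x - 1 = (expR x - 1 - x) + x by ring.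
    apply: le_trans (ler_normD _ _) _.
    suff : k * `|x| <= `|x| by lra.
    by rewrite -[leRHS]mul1r ler_wpM2r.
  have ex : `|expR x| <= 2.
    by have := ler_normD (expR x - 1) 1; rewrite subrK normr1; lra.
  have -> : expR x * cos y - 1 - x = (expR x - 1 - x) + expR x * (cos y - 1) by ring.
  have -> : expR x * sin y - y = expR x * (sin y - y) + (expR x - 1) * y by ring.
  apply: le_trans (lerD (ler_normD _ _) (ler_normD _ _)) _; rewrite !normrM.
  have F1 : `|expR x| * `|cos y - 1| <= 2 * (k * `|y|) by apply: ler_pM.
  have F2 : `|expR x| * `|sin y - y| <= 2 * (k * `|y|) by apply: ler_pM.
  have F3 : `|expR x - 1| * `|y| <= k * `|y| by apply: ler_wpM2r.
  have kx : k * `|x| <= e / 6 * cabs h by apply: ler_pM => //; exact: ltW.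
  have ky : k * `|y| <= e / 6 * cabs h by apply: ler_pM => //; exact: ltW.
  by clear - E1 F1 F2 F3 kx ky; lra.
move=> e e0; have a0 : 0 < cabs (cexp z) by rewrite cabs_gt0 cexp_neq0.
have [d d0 H] := D0 _ (divr_gt0 e0 a0).
exists d => // h /H; rewrite add0r cexp0 mul1r => Hh.
have -> : cexp (z + h) - cexp z - cexp z * h = cexp z * (cexp h - 1 - h).
  by rewrite cexpD; ring.
rewrite cabsM; apply: le_trans (ler_wpM2l (ltW a0) Hh) _.
by rewrite mulrA mulrCA mulfV ?gt_eqF// mulr1.
Qed.

Lemma cderiv_cexp_comp (f : C -> C) z l : cderiv f z l ->
  cderiv (fun w => cexp (f w)) z (cexp (f z) * l).
Proof. by move=> H; apply: (cderiv_comp (g := cexp) H); exact: cderiv_cexp. Qed.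

End ComplexExponential.

(** * Integrals over rectangles and Goursat's theorem *)

Section Goursat.
Variable R : realType.
Local Notation C := R[i].
Implicit Types (f g : C -> C) (x y w h a b : R) (z : C).

Lemma horizE f y : (fun t : R => f (t +i* y)) = (fun t => f (0 +i* y + t%:C * 1)).
Proof. by apply/funext => t; congr f; apply: cplx_ext; rewrite /= ?mulr0 ?mulr1; ring. Qed.

Lemma vertE f x : (fun t : R => f (x +i* t)) = (fun t => f (x%:C + t%:C * 'i%C)).
Proof. by apply/funext => t; congr f; apply: cplx_ext; rewrite /= ?mulr0 ?mulr1; ring. Qed.

Lemma rcont_horiz f y t : ccont f (t +i* y) -> rcont (fun s : R => f (s +i* y)) t.
Proof.
move=> H; rewrite (horizE f y); apply: rcont_affine.
by move: H; congr ccont; apply: cplx_ext; rewrite /= ?mulr0 ?mulr1; ring.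
Qed.

Lemma rcont_vert f x t : ccont f (x +i* t) -> rcont (fun s : R => f (x +i* s)) t.
Proof.
move=> H; rewrite (vertE f x); apply: rcont_affine.
by move: H; congr ccont; apply: cplx_ext; rewrite /= ?mulr0 ?mulr1; ring.
Qed.

Lemma rderiv_horiz f y t l : cderiv f (t +i* y) l -> rderiv (fun s : R => f (s +i* y)) t l.
Proof.
move=> H; rewrite (horizE f y) -[l]mulr1; apply: rderiv_affine.
by move: H; congr (cderiv f _ l); apply: cplx_ext; rewrite /= ?mulr0 ?mulr1; ring.
Qed.

Lemma rderiv_vert f x t l : cderiv f (x +i* t) l ->
  rderiv (fun s : R => f (x +i* s)) t (l * 'i%C).
Proof.
move=> H; rewrite (vertE f x); apply: rderiv_affine.
by move: H; congr (cderiv f _ l); apply: cplx_ext; rewrite /= ?mulr0 ?mulr1; ring.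
Qed.

(** The boundary integral taken counterclockwise: the top and the left side enter with a minus
    sign. *)
Definition rint f x0 x1 y0 y1 : C :=
  cint (fun t => f (t +i* y0)) x0 x1 + 'i%C * cint (fun t => f (x1 +i* t)) y0 y1
  - cint (fun t => f (t +i* y1)) x0 x1 - 'i%C * cint (fun t => f (x0 +i* t)) y0 y1.

Lemma rint_splitx f x x0 x1 y0 y1 :
  rint f x0 x1 y0 y1 = rint f x0 x y0 y1 + rint f x x1 y0 y1.
Proof. by rewrite /rint -(cint_cat _ x0 x1 x) -(cint_cat _ x0 x1 x); ring. Qed.

Lemma rint_splity f y x0 x1 y0 y1 :
  rint f x0 x1 y0 y1 = rint f x0 x1 y0 y + rint f x0 x1 y y1.
Proof. by rewrite /rint -(cint_cat _ y0 y1 y) -(cint_cat _ y0 y1 y); ring. Qed.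

Lemma rint_le f x0 x1 y0 y1 (M : R) : x0 <= x1 -> y0 <= y1 ->
  (forall t, rcont (fun s => f (s +i* y0)) t) -> (forall t, rcont (fun s => f (s +i* y1)) t) ->
  (forall t, rcont (fun s => f (x0 +i* s)) t) -> (forall t, rcont (fun s => f (x1 +i* s)) t) ->
  (forall t, x0 <= t <= x1 -> cabs (f (t +i* y0)) <= M) ->
  (forall t, x0 <= t <= x1 -> cabs (f (t +i* y1)) <= M) ->
  (forall t, y0 <= t <= y1 -> cabs (f (x0 +i* t)) <= M) ->
  (forall t, y0 <= t <= y1 -> cabs (f (x1 +i* t)) <= M) ->
  cabs (rint f x0 x1 y0 y1) <= M * (2 * (x1 - x0 + (y1 - y0))).
Proof.
move=> hx hy c1 c2 c3 c4 b1 b2 b3 b4.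
have := cint_le hx c1 b1; have := cint_le hx c2 b2.
have := cint_le hy c3 b3; have := cint_le hy c4 b4.
rewrite /rint; set A := cint _ _ _; set B := cint _ _ _.
set D := cint _ _ _; set E := cint _ _ _ => hA hB hD hE.
have := cabsD E ('i%C * A); have := cabsB (E + 'i%C * A) D.
have := cabsB (E + 'i%C * A - D) ('i%C * B).
by rewrite !cabsM !cabs_i !mul1r; lra.
Qed.

Lemma rint_le_cont f x0 x1 y0 y1 (M : R) : x0 <= x1 -> y0 <= y1 ->
  (forall z, ccont f z) ->
  (forall s t, x0 <= s <= x1 -> y0 <= t <= y1 -> cabs (f (s +i* t)) <= M) ->
  cabs (rint f x0 x1 y0 y1) <= M * (2 * (x1 - x0 + (y1 - y0))).
Proof.
move=> hx hy cf b; have e0 : x0 <= x0 <= x1 by rewrite lexx hx.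
have e1 : x0 <= x1 <= x1 by rewrite lexx hx.
have e2 : y0 <= y0 <= y1 by rewrite lexx hy.
have e3 : y0 <= y1 <= y1 by rewrite lexx hy.
by apply: rint_le => // t; try (by exact: rcont_horiz); try (by exact: rcont_vert); move=> ?; exact: b.
Qed.

Lemma rintB f g x0 x1 y0 y1 : (forall z, ccont f z) -> (forall z, ccont g z) ->
  rint (fun z => f z - g z) x0 x1 y0 y1 = rint f x0 x1 y0 y1 - rint g x0 x1 y0 y1.
Proof.
move=> cf cg; rewrite /rint.
have H1 y := @rcont_horiz f y _ (cf _); have H2 x := @rcont_vert f x _ (cf _).
have H3 y := @rcont_horiz g y _ (cg _); have H4 x := @rcont_vert g x _ (cg _).
by do !rewrite cintB//; ring.
Qed.

Lemma rint_primitive f F x0 x1 y0 y1 : (forall z, cderiv F z (f z)) ->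
  (forall z, ccont f z) -> rint f x0 x1 y0 y1 = 0.
Proof.
move=> HF cf; rewrite /rint.
have H y a b : cint (fun t => f (t +i* y)) a b = F (b +i* y) - F (a +i* y).
  by rewrite (@cint_FTC _ (fun t => F (t +i* y))) // => t; exact: rderiv_horiz.
have V x a b : 'i%C * cint (fun t => f (x +i* t)) a b = F (x +i* b) - F (x +i* a).
  rewrite -cintZ => [|t]; last exact: rcont_vert.
  rewrite (@cint_FTC _ (fun t => F (x +i* t))) // => t.
  by rewrite mulrC; exact: rderiv_vert.
by rewrite !H !V; ring.
Qed.

Lemma nested_dyadic (u : nat -> R) w :
  (forall n, u n <= u n.+1) -> (forall n, u n.+1 + w / 2 ^+ n.+1 <= u n + w / 2 ^+ n) ->
  0 <= w -> exists l, forall n, u n <= l <= u n + w / 2 ^+ n.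
Proof.
move=> Hu Hv w0.
have mono n m : (n <= m)%N -> u n <= u m.
  by move=> nm; apply: (homo_leq (@lexx _ R) (fun _ _ _ => @le_trans _ R _ _ _)).
have mono2 n m : (n <= m)%N -> u m + w / 2 ^+ m <= u n + w / 2 ^+ n.
  move=> nm; rewrite -lerN2.
  apply: (homo_leq (f := fun n => - (u n + w / 2 ^+ n)) (@lexx _ R) (fun _ _ _ => @le_trans _ R _ _ _)) => // k.
  by rewrite lerN2.
have key n m : u n <= u m + w / 2 ^+ m.
  have pw k : 0 <= w / 2 ^+ k by rewrite divr_ge0// exprn_ge0.
  have [nm|/ltnW mn] := leqP n m; first by apply: le_trans (mono _ _ nm) _; rewrite lerDl.
  by apply: le_trans (mono2 _ _ mn); rewrite lerDl.
exists (sup (range u)) => n; apply/andP; split.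
  apply: ub_le_sup; last by exists n.
  by exists (u 0 + w / 2 ^+ 0) => _ [m _ <-].
by apply: ge_sup; [exists (u 0), 0 | move=> _ [m _ <-]].
Qed.

Lemma half_pow_lt (w d : R) : 0 < d -> exists n, w / 2 ^+ n < d.
Proof.
move=> d0; have [n Hn] : exists n : nat, w / d < n%:R.
  by exists (Num.truncn (w / d)).+1; exact: truncnS_gt.
exists n; rewrite ltr_pdivrMr ?exprn_gt0// mulrC -ltr_pdivrMr//.
apply: lt_le_trans Hn _; rewrite -natrX ler_nat; exact/ltnW/ltn_expl.
Qed.

Section Bisection.
Variables (P : R -> R -> nat -> bool) (w h : R).
Hypotheses (w0 : 0 <= w) (h0 : 0 <= h).
Hypothesis split4 : forall x y n, ~~ P x y n ->
  [|| ~~ P x y n.+1, ~~ P (x + w / 2 ^+ n.+1) y n.+1, ~~ P x (y + h / 2 ^+ n.+1) n.+1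
    | ~~ P (x + w / 2 ^+ n.+1) (y + h / 2 ^+ n.+1) n.+1].

(** [P x y n] stands for an estimate on the rectangle with lower left corner [(x, y)] and sides
    [w / 2 ^+ n] and [h / 2 ^+ n]. Following a failing quarter at each step produces nested failing
    rectangles around one point. *)
Lemma bisection x y : ~~ P x y 0 ->
  exists u v : nat -> R, exists lx ly, [/\ u 0 = x, v 0 = y,
   forall n, ~~ P (u n) (v n) n, forall n, u n <= lx <= u n + w / 2 ^+ n &
   forall n, v n <= ly <= v n + h / 2 ^+ n].
Proof.
move=> H0.
pose next n (s : R * R) := let: (x, y) := s in
  if ~~ P x y n.+1 then (x, y) else
  if ~~ P (x + w / 2 ^+ n.+1) y n.+1 then (x + w / 2 ^+ n.+1, y) else
  if ~~ P x (y + h / 2 ^+ n.+1) n.+1 then (x, y + h / 2 ^+ n.+1) else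
  (x + w / 2 ^+ n.+1, y + h / 2 ^+ n.+1).
pose s := fix s n := if n is m.+1 then next m (s m) else (x, y).
have sP n : ~~ P (s n).1 (s n).2 n.
  elim: n => // n; rewrite /= /next; case: (s n) => a b /= /split4.
  by case: ifP => //= _; case: ifP => //= _; case: ifP.
have E (k : R) n : k / 2 ^+ n = k / 2 ^+ n.+1 + k / 2 ^+ n.+1.
  by rewrite exprS; field; rewrite expf_neq0 ?pnatr_eq0.
have pw n : 0 <= w / 2 ^+ n by rewrite divr_ge0// exprn_ge0.
have ph n : 0 <= h / 2 ^+ n by rewrite divr_ge0// exprn_ge0.
have [lx Hx] : exists l, forall n, (s n).1 <= l <= (s n).1 + w / 2 ^+ n.
  apply: nested_dyadic => // n; rewrite /= /next; case: (s n) => a b /=; have := pw n.+1.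
    by do ! case: ifP => //= _; lra.
  by rewrite (E w n); do ! case: ifP => //= _; lra.
have [ly Hy] : exists l, forall n, (s n).2 <= l <= (s n).2 + h / 2 ^+ n.
  apply: nested_dyadic => // n; rewrite /= /next; case: (s n) => a b /=; have := ph n.+1.
    by do ! case: ifP => //= _; lra.
  by rewrite (E h n); do ! case: ifP => //= _; lra.
by exists (fun n => (s n).1), (fun n => (s n).2), lx, ly.
Qed.
End Bisection.

(** A nonzero integral persists, up to a factor [4 ^- n], on nested rectangles, while near their
    common point [f] is affine up to a small error. Continuity is asked everywhere but
    differentiability only on the rectangle, so that the result can be used around a point where
    only continuity is known. *)
Lemma goursat f x0 x1 y0 y1 : x0 <= x1 -> y0 <= y1 -> (forall z, ccont f z) ->
  (forall s t, x0 <= s <= x1 -> y0 <= t <= y1 -> exists l, cderiv f (s +i* t) l) ->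
  rint f x0 x1 y0 y1 = 0.
Proof.
move=> hx hy cf df; pose w := x1 - x0; pose h := y1 - y0.
have w0 : 0 <= w by rewrite subr_ge0. have h0 : 0 <= h by rewrite subr_ge0.
apply/eqP; rewrite -cabs_eq0 eq_le cabs_ge0 andbT leNgt; apply/negP => c0.
set c := cabs _ in c0.
pose S := (w + h) ^+ 2 + 1.
have S0 : 0 < S by rewrite /S ltr_pwDr// sqr_ge0.
(* Half of [c], so that the estimate fails on the initial rectangle as soon as [c > 0]. *)
pose P x y n := cabs (rint f x (x + w / 2 ^+ n) y (y + h / 2 ^+ n)) <= c / 2 / 4 ^+ n.
have split4 x y n : ~~ P x y n ->
  [|| ~~ P x y n.+1, ~~ P (x + w / 2 ^+ n.+1) y n.+1, ~~ P x (y + h / 2 ^+ n.+1) n.+1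
    | ~~ P (x + w / 2 ^+ n.+1) (y + h / 2 ^+ n.+1) n.+1].
  apply: contraR; rewrite !negb_or !negbK => /and4P[]; rewrite /P.
  rewrite -!addrA.
  have E (k : R) : k / 2 ^+ n.+1 + k / 2 ^+ n.+1 = k / 2 ^+ n.
    by rewrite exprS; field; rewrite expf_neq0 ?pnatr_eq0.
  rewrite !E => H1 H2 H3 H4.
  rewrite (@rint_splitx f (x + w / 2 ^+ n.+1) x (x + w / 2 ^+ n)).
  rewrite (@rint_splity f (y + h / 2 ^+ n.+1) x (x + w / 2 ^+ n.+1)).
  rewrite (@rint_splity f (y + h / 2 ^+ n.+1) (x + w / 2 ^+ n.+1) (x + w / 2 ^+ n)).
  have -> : c / 2 / 4 ^+ n = c / 2 / 4 ^+ n.+1 + c / 2 / 4 ^+ n.+1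
    + (c / 2 / 4 ^+ n.+1 + c / 2 / 4 ^+ n.+1).
    by rewrite exprS; field; rewrite expf_neq0 ?pnatr_eq0.
  have four (A B D F : C) (k : R) : cabs A <= k -> cabs B <= k -> cabs D <= k -> cabs F <= k ->
      cabs (A + B + (D + F)) <= k + k + (k + k).
    move=> hA hB hD hF; apply: le_trans (cabsD _ _) _.
    by apply: lerD; apply: le_trans (cabsD _ _) _; exact: lerD.
  exact: four.
have [|u [v [lx [ly [u0 v0 sP ux vy]]]]] := @bisection P w h w0 h0 split4 x0 y0.
  rewrite /P !expr0 !divr1 -ltNge /w /h !subrKC -/c; lra.
have [l Hl] : exists l, cderiv f (lx +i* ly) l.
  apply: df.
    by have := ux 0%N; rewrite expr0 divr1 u0 /w subrKC.
  by have := vy 0%N; rewrite expr0 divr1 v0 /h subrKC.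
(* On the [n]-th rectangle the deviation from the affine part is at most this number times
   [(w + h) / 2 ^+ n], and the perimeter is [2 (w + h) / 2 ^+ n]. Since [(w + h) ^+ 2 <= S], the
   integral is at most [c / 4 / 4 ^+ n], below the threshold. *)
have e0 : 0 < c / 8 / S by rewrite !divr_gt0.
have [d d0 {}Hl] := Hl _ e0.
have [n Hn] := half_pow_lt (w + h) d0.
have /negP := sP n; apply; rewrite /P.
set p := 2 ^+ n in Hn *; have p0 : 0 < p by rewrite exprn_gt0.
have pw : 0 <= w / p by rewrite divr_ge0// ltW.
have ph : 0 <= h / p by rewrite divr_ge0// ltW.
(* The affine part [g] has a primitive, so subtracting it does not change the integral. *)
pose z0 := lx +i* ly; pose g z := f z0 + l * (z - z0).
have dg z : cderiv (fun z => f z0 * z + l / 2 * ((z - z0) * (z - z0))) z (g z).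
  have D1 := cderiv_subC z0 z.
  have := cderivD (cderivZ (f z0) (@cderiv_id _ z)) (cderivZ (l / 2) (cderivM D1 D1)).
  suff -> : f z0 * 1 + l / 2 * (1 * (z - z0) + (z - z0) * 1) = g z by [].
  by rewrite /g; field.
have cg z : ccont g z.
  have D1 := cderiv_subC z0 z.
  exact: cderiv_ccont (cderivD (@cderiv_cst _ (f z0) z) (cderivZ l D1)).
have -> : rint f (u n) (u n + w / p) (v n) (v n + h / p)
  = rint (fun z => f z - g z) (u n) (u n + w / p) (v n) (v n + h / p).
  by rewrite rintB// (rint_primitive _ _ _ _ dg)// subr0.
have cfg z : ccont (fun z => f z - g z) z.
  move=> e ep; have e2 : 0 < e / 2 by lra.
  have [d1 d10 H1] := cf z _ e2; have [d2 d20 H2] := cg z _ e2.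
  exists (Num.min d1 d2); first by rewrite lt_min d10.
  move=> k; rewrite lt_min => /andP[/H1 h1 /H2 h2].
  have -> : f (z + k) - g (z + k) - (f z - g z) = (f (z + k) - f z) - (g (z + k) - g z) by ring.
  by apply: le_trans (cabsB _ _) _; clear - h1 h2; lra.
apply: (@le_trans _ _ (c / 8 / S * ((w + h) / p) * (2 * ((w + h) / p)))).
  have -> : 2 * ((w + h) / p) = 2 * (u n + w / p - u n + (v n + h / p - v n)).
    by field; rewrite gt_eqF.
  apply: rint_le_cont => //; rewrite ?lerDl// => s t sn tn.
  have zd : cabs (s +i* t - z0) <= (w + h) / p.
    apply: le_trans (cabs_le_ReIm _) _; rewrite /= mulrDl.
    have := ux n; have := vy n; rewrite -/p; move: sn tn pw ph; clear.
    move=> /andP[? ?] /andP[? ?] ? ? /andP[? ?] /andP[? ?].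
    by apply: lerD; rewrite ler_norml; apply/andP; split; lra.
  have := Hl (s +i* t - z0) (le_lt_trans zd Hn).
  rewrite -/z0 (addrC z0) subrK -addrA -opprD => H; apply: le_trans H _.
  by rewrite ler_wpM2l// ltW.
have -> : c / 8 / S * ((w + h) / p) * (2 * ((w + h) / p)) = c / 4 * ((w + h) ^+ 2 / S) / p ^+ 2.
  by field; rewrite !gt_eqF.
have -> : 4 ^+ n = p ^+ 2 :> R by rewrite /p -exprM mulnC exprM; congr (_ ^+ _); ring.
rewrite ler_pM2r ?invr_gt0 ?exprn_gt0//.
have : (w + h) ^+ 2 / S <= 1 by rewrite ler_pdivrMr// mul1r /S lerDl.
move=> /(ler_wpM2l (ltW c0)); rewrite mulr1; set q := _ / S => Hq; clear - Hq c0; lra.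
Qed.

End Goursat.

(** * Cauchy's formula on rectangles *)

Section CauchyFormula.
Variable R : realType.
Local Notation C := R[i].
Implicit Types (f g : C -> C) (x y a b : R) (z : C).

(** The four full lines, not just the sides they carry: [cint] rests on primitives defined on all of
    [R], so regularity has to hold along whole lines. *)
Definition on_lines (x0 x1 y0 y1 : R) (z : C) :=
  [|| Im z == y0, Im z == y1, Re z == x0 | Re z == x1].

Lemma on_lines_dist x0 x1 y0 y1 (z w : C) (r : R) :
  x0 <= Re w - r -> Re w + r <= x1 -> y0 <= Im w - r -> Im w + r <= y1 -> 0 <= r ->
  on_lines x0 x1 y0 y1 z -> r <= cabs (z - w).
Proof.
move=> h1 h2 h3 h4 r0; case/or4P => /eqP e.
- by apply: le_trans (normr_Im_le _); rewrite imD imN e ler_normr; apply/orP; right; lra.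
- by apply: le_trans (normr_Im_le _); rewrite imD imN e ler_normr; apply/orP; left; lra.
- by apply: le_trans (normr_Re_le _); rewrite reD reN e ler_normr; apply/orP; right; lra.
- by apply: le_trans (normr_Re_le _); rewrite reD reN e ler_normr; apply/orP; left; lra.
Qed.

Definition diff_on_lines f x0 x1 y0 y1 :=
  forall z, on_lines x0 x1 y0 y1 z -> exists l, cderiv f z l.

Lemma eq_rint f g x0 x1 y0 y1 :
  (forall z, on_lines x0 x1 y0 y1 z -> f z = g z) ->
  rint f x0 x1 y0 y1 = rint g x0 x1 y0 y1.
Proof.
move=> E; rewrite /rint; congr (_ + _ * _ - _ - _ * _); congr (cint _ _ _);
  by apply/funext => t; apply: E; rewrite /on_lines /= eqxx ?orbT.
Qed.

Section Lines.
Variables (x0 x1 y0 y1 : R).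
Local Notation dol f := (diff_on_lines f x0 x1 y0 y1).

Lemma dol_rcont f : dol f ->
  [/\ forall t, rcont (fun s => f (s +i* y0)) t, forall t, rcont (fun s => f (s +i* y1)) t,
      forall t, rcont (fun s => f (x0 +i* s)) t & forall t, rcont (fun s => f (x1 +i* s)) t].
Proof.
move=> H; have W z : on_lines x0 x1 y0 y1 z -> ccont f z.
  by move=> /H[l]; exact: cderiv_ccont.
by split=> t; (try apply: rcont_horiz); (try apply: rcont_vert); apply: W;
  rewrite /on_lines /= eqxx ?orbT.
Qed.

Lemma dolD f g : dol f -> dol g -> dol (fun z => f z + g z).
Proof.
move=> Hf Hg z Hz; have [l Hl] := Hf _ Hz; have [m Hm] := Hg _ Hz.
by exists (l + m); exact: cderivD.
Qed.

Lemma dolM f g : dol f -> dol g -> dol (fun z => f z * g z).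
Proof.
move=> Hf Hg z Hz; have [l Hl] := Hf _ Hz; have [m Hm] := Hg _ Hz.
by exists (l * g z + f z * m); exact: cderivM.
Qed.

Lemma dolZ c f : dol f -> dol (fun z => c * f z).
Proof. by move=> Hf z /Hf[l Hl]; exists (c * l); exact: cderivZ. Qed.

Lemma dol_inv w : ~~ on_lines x0 x1 y0 y1 w -> dol (fun z => (z - w)^-1).
Proof.
move=> Hw z Hz; have zw : z - w != 0.
  by rewrite subr_eq0; apply: contraNneq Hw => <-.
have D := cderiv_subC w z.
by eexists; exact: (cderiv_comp D (cderiv_inv zw)).
Qed.

Lemma dol_entire f : (forall z, exists l, cderiv f z l) -> dol f.
Proof. by move=> H z _. Qed.

Lemma rintD f g : dol f -> dol g ->
  rint (fun z => f z + g z) x0 x1 y0 y1 = rint f x0 x1 y0 y1 + rint g x0 x1 y0 y1.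
Proof.
move=> /dol_rcont[f1 f2 f3 f4] /dol_rcont[g1 g2 g3 g4].
by rewrite /rint !cintD//; ring.
Qed.

Lemma rintZ c f : dol f ->
  rint (fun z => c * f z) x0 x1 y0 y1 = c * rint f x0 x1 y0 y1.
Proof. by move=> /dol_rcont[f1 f2 f3 f4]; rewrite /rint !cintZ//; ring. Qed.

Lemma dol_rint_le f (M : R) : x0 <= x1 -> y0 <= y1 -> dol f ->
  (forall s t, x0 <= s <= x1 -> y0 <= t <= y1 -> on_lines x0 x1 y0 y1 (s +i* t) ->
     cabs (f (s +i* t)) <= M) ->
  cabs (rint f x0 x1 y0 y1) <= M * (2 * (x1 - x0 + (y1 - y0))).
Proof.
move=> hx hy /dol_rcont[f1 f2 f3 f4] H.
by apply: rint_le => // t ht; apply: H => //; rewrite ?lexx ?hx ?hy// /on_lines /= eqxx ?orbT.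
Qed.

End Lines.

(** Outside a small square of half-side [k] around the exceptional point, four rectangles are left
    to which [goursat] applies. Continuity bounds [f] by [M] on the square, which therefore
    contributes at most [8 M k]. *)
Lemma goursat_punctured f x0 x1 y0 y1 a b : x0 < a < x1 -> y0 < b < y1 ->
  (forall z, ccont f z) -> (forall z, z != a +i* b -> exists l, cderiv f z l) ->
  rint f x0 x1 y0 y1 = 0.
Proof.
move=> /andP[xa ax] /andP[yb by1] cf df.
have [d d0 H] := cf (a +i* b) 1 ltr01.
pose M := cabs (f (a +i* b)) + 1.
have M0 : 0 < M by rewrite /M; have := cabs_ge0 (f (a +i* b)); lra.
apply/eqP; rewrite -cabs_eq0 eq_le cabs_ge0 andbT; apply/ler_addgt0Pr => e e0; rewrite add0r.
pose k := Num.min (Num.min (Num.min (a - x0) (x1 - a)) (Num.min (b - y0) (y1 - b)))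
  (Num.min (d / 4) (e / (8 * M))).
have k0 : 0 < k.
  by rewrite !lt_min !subr_gt0 xa ax yb by1 !divr_gt0//= mulr_gt0.
have : k <= k by [].
rewrite {2}/k !le_min => /andP[/andP[/andP[k1 k2] /andP[k3 k4]] /andP[k5 k6]].
clearbody k.
have G u0 u1 v0 v1 : u0 <= u1 -> v0 <= v1 -> ~~ ((u0 <= a <= u1) && (v0 <= b <= v1)) ->
    rint f u0 u1 v0 v1 = 0.
  move=> hu hv nab; apply: goursat => // s t hs ht; apply: df.
  by apply: contraNneq nab => -[<- <-]; rewrite hs ht.
rewrite (rint_splitx f (a - k)) (rint_splitx f (a + k) (a - k)).
rewrite (rint_splity f (b - k) (a - k)) (rint_splity f (b + k) (a - k) _ (b - k)).
rewrite (G x0)//; try lra.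
rewrite (G (a + k))//; try lra.
rewrite (G (a - k) _ y0)//; try lra.
rewrite (G (a - k) _ (b + k))//; try lra.
rewrite !(addr0, add0r).
have : cabs (rint f (a - k) (a + k) (b - k) (b + k)) <=
    M * (2 * (a + k - (a - k) + (b + k - (b - k)))).
  apply: rint_le_cont => //; try lra; move=> s t /andP[s1 s2] /andP[t1 t2].
  have sd : cabs (s +i* t - (a +i* b)) < d.
    apply: le_lt_trans (cabs_le_ReIm _) _; rewrite /=.
    have : `|s - a| <= k by rewrite ler_norml; apply/andP; split; lra.
    have : `|t - b| <= k by rewrite ler_norml; apply/andP; split; lra.
    move: k0 k5; clear - d0; lra.
  have := H _ sd; rewrite subrKC.
  have := cabsD (f (s +i* t) - f (a +i* b)) (f (a +i* b)); rewrite subrK /M; clear; lra.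
move=> h; apply: le_trans h _.
have -> : M * (2 * (a + k - (a - k) + (b + k - (b - k)))) = 8 * M * k by ring.
by rewrite mulrC -ler_pdivlMr// mulr_gt0.
Qed.

Definition dquot f z0 l z := if z == z0 then l else (f z - f z0) / (z - z0).

Lemma dquot_cderiv f z0 l z : (forall z, exists l, cderiv f z l) -> z != z0 ->
  exists m, cderiv (dquot f z0 l) z m.
Proof.
move=> df zz0; have [m Hm] := df z.
have zw : z - z0 != 0 by rewrite subr_eq0.
have D := cderiv_subC z0 z.
have D2 : cderiv (fun z => f z - f z0) z m.
  by rewrite -[m]subr0; apply: cderivB => //; exact: cderiv_cst.
have := cderivM D2 (cderiv_comp D (cderiv_inv zw)); set n := (X in cderiv _ _ X) => Hn.
exists n; apply: (@cderiv_near _ _ _ _ _ (cabs (z - z0))) Hn; first by rewrite cabs_gt0.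
move=> h hz /=; rewrite /dquot ifN//; apply: contraTneq hz => E.
by rewrite -E opprD addrA subrr sub0r cabsN -leNgt lexx.
Qed.

Lemma dquot_ccont f z0 l : cderiv f z0 l -> (forall z, exists l, cderiv f z l) ->
  forall z, ccont (dquot f z0 l) z.
Proof.
move=> Hl df z; have [->|zz0] := eqVneq z z0; last first.
  by have [m] := dquot_cderiv l df zz0; exact: cderiv_ccont.
move=> e e0; have [d d0 H] := Hl _ e0; exists d => // h /H; rewrite /dquot eqxx.
have [->|h0] := eqVneq h 0; first by move=> _; rewrite addr0 eqxx subrr cabs0 ltW.
rewrite ifN; last by rewrite -subr_eq0 addrAC subrr add0r.
move=> He; rewrite (_ : z0 + h - z0 = h); last by ring.
have -> : (f (z0 + h) - f z0) / h - l = (f (z0 + h) - f z0 - l * h) / h by field.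
by rewrite cabsM cabsV ler_pdivrMr// cabs_gt0.
Qed.

(** For [z0] inside the rectangle this is the number [2 pi i]. It is kept as it stands: lower bounds
    for its modulus are all that is used. *)
Definition ckernel z0 x0 x1 y0 y1 := rint (fun z => (z - z0)^-1) x0 x1 y0 y1.

Lemma strictly_inside_lines x0 x1 y0 y1 z : x0 < Re z < x1 -> y0 < Im z < y1 ->
  ~~ on_lines x0 x1 y0 y1 z.
Proof.
move=> /andP[h1 h2] /andP[h3 h4]; rewrite /on_lines !negb_or.
by rewrite (gt_eqF h1) (lt_eqF h2) (gt_eqF h3) (lt_eqF h4).
Qed.

(** On the lines [f z / (z - z0)] is the difference quotient plus [f z0 / (z - z0)]. Completed by
    the derivative at [z0], the quotient is continuous everywhere and differentiable off [z0], so
    its integral vanishes. *)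
Lemma cauchy_formula f x0 x1 y0 y1 z0 : (forall z, exists l, cderiv f z l) ->
  x0 < Re z0 < x1 -> y0 < Im z0 < y1 ->
  rint (fun z => f z * (z - z0)^-1) x0 x1 y0 y1 = f z0 * ckernel z0 x0 x1 y0 y1.
Proof.
move=> df hx hy; have nl := strictly_inside_lines hx hy.
have [l Hl] := df z0.
have G0 : rint (dquot f z0 l) x0 x1 y0 y1 = 0.
  apply: (goursat_punctured hx hy); first exact: dquot_ccont.
  by move=> z zz; apply: dquot_cderiv => //; move: zz; case: (z0).
have dg : diff_on_lines (dquot f z0 l) x0 x1 y0 y1.
  by move=> z Hz; apply: dquot_cderiv => //; apply: contraNneq nl => <-.
rewrite /ckernel -rintZ; last exact: dol_inv.
rewrite -[RHS]add0r -G0 -rintD//; last by apply: dolZ; exact: dol_inv.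
apply: eq_rint => z Hz; have zz : z - z0 != 0.
  by rewrite subr_eq0; apply: contraNneq nl => <-.
by rewrite /dquot -subr_eq0 ifN//; field.
Qed.

Lemma im_cint_ge (g : R -> C) a b (m : R) : a <= b -> (forall t, rcont g t) ->
  (forall t, a <= t <= b -> m <= Im (g t)) -> m * (b - a) <= Im (cint g a b).
Proof.
move=> ab /rcont_primitive[p Hp] H; rewrite (cint_FTC _ _ Hp) imD imN.
suff : Im (p a) - m * a <= Im (p b) - m * b by lra.
apply: (@derive_ge0_le _ (fun t => Im (p t) - m * t) (fun t => Im (g t) - m) a b ab).
  move=> t _; apply: is_deriveB; first exact: rderivIm (Hp t).
  exact: is_derive_mull.
by move=> t tab; rewrite subr_ge0; exact: H.
Qed.

Lemma reV z : Re z^-1 = Re z / cabs z ^+ 2.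
Proof. by rewrite sqr_cabs; case: z. Qed.

Lemma imV z : Im z^-1 = - Im z / cabs z ^+ 2.
Proof. by rewrite sqr_cabs mulNr; case: z. Qed.

(** Along each side the integrand contributes to the imaginary part the distance from [z0] to that
    side divided by [|z - z0|^2], which is at most the squared diagonal. The distances to opposite
    sides add up to a side length. *)
Lemma ckernel_im_ge x0 x1 y0 y1 z0 : x0 < Re z0 < x1 -> y0 < Im z0 < y1 ->
  2 * (x1 - x0) * (y1 - y0) / ((x1 - x0) ^+ 2 + (y1 - y0) ^+ 2)
    <= Im (ckernel z0 x0 x1 y0 y1).
Proof.
move=> hx hy; have nl := strictly_inside_lines hx hy.
have /dol_rcont[c1 c2 c3 c4] := dol_inv nl.
move: (hx) (hy) => /andP[h1 h2] /andP[h3 h4].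
set S := (x1 - x0) ^+ 2 + _; have S0 : 0 < S by rewrite addr_gt0// exprn_gt0// subr_gt0; lra.
pose a := Re z0; pose b := Im z0; rewrite -/a in h1 h2; rewrite -/b in h3 h4.
have key s t : x0 <= s <= x1 -> y0 <= t <= y1 -> on_lines x0 x1 y0 y1 (s +i* t) ->
    0 < cabs (s +i* t - z0) ^+ 2 <= S.
  move=> /andP[s1 s2] /andP[t1 t2] Hl; apply/andP; split.
    rewrite exprn_gt0// cabs_gt0 subr_eq0; apply: contraNneq nl => <-.
    exact: Hl.
  rewrite sqr_cabs /S !(reD, imD, reN, imN) /= -/a -/b.
  have sq (u v : R) : - v <= u -> u <= v -> u ^+ 2 <= v ^+ 2.
    by move=> u1 u2; rewrite -subr_ge0 subr_sqr mulr_ge0//; lra.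
  by apply: lerD; apply: sq; lra.
have q (k D : R) : 0 <= k -> 0 < D <= S -> k / S <= k / D.
  move=> k0 /andP[D0 DS]; rewrite ler_wpM2l// lef_pV2// posrE//.
have B1 : (b - y0) / S * (x1 - x0) <= Im (cint (fun t => (t +i* y0 - z0)^-1) x0 x1).
  apply: im_cint_ge => //; first lra.
  move=> t ht; rewrite imV imD imN /= -/b opprB; apply: q; first lra.
  by apply: key => //; rewrite ?lexx /on_lines /= ?eqxx//; lra.
have B2 : (y1 - b) / S * (x1 - x0) <= - Im (cint (fun t => (t +i* y1 - z0)^-1) x0 x1).
  rewrite -imN -[- cint _ _ _]mulN1r -cintZ//; apply: im_cint_ge; first lra.
    by move=> t; exact: rcontZ.
  move=> t ht; rewrite mulN1r imN imV imD imN /= -/b mulNr opprK; apply: q; first lra.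
  by apply: key => //; rewrite ?lexx ?andbT /on_lines /= ?eqxx ?orbT//; lra.
have B3 : (a - x0) / S * (y1 - y0) <= - Im ('i%C * cint (fun t => (x0 +i* t - z0)^-1) y0 y1).
  rewrite -imN -mulNr -cintZ//; apply: im_cint_ge; first lra.
    by move=> t; exact: rcontZ.
  move=> t ht; rewrite imM reN imN /= oppr0 mul0r add0r mulN1r reV reD reN /= -/a -mulNr opprB.
  apply: q; first lra.
  by apply: key => //; rewrite ?lexx ?andbT /on_lines /= ?eqxx ?orbT//; lra.
have B4 : (x1 - a) / S * (y1 - y0) <= Im ('i%C * cint (fun t => (x1 +i* t - z0)^-1) y0 y1).
  rewrite -cintZ//; apply: im_cint_ge; first lra.
    by move=> t; exact: rcontZ.
  move=> t ht; rewrite imM /= mul0r mul1r add0r reV reD reN /= -/a.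
  apply: q; first lra.
  by apply: key => //; rewrite ?lexx ?andbT /on_lines /= ?eqxx ?orbT//; lra.
have -> : 2 * (x1 - x0) * (y1 - y0) / S = (b - y0) / S * (x1 - x0) + (y1 - b) / S * (x1 - x0)
   + ((a - x0) / S * (y1 - y0) + (x1 - a) / S * (y1 - y0)).
  by field; rewrite gt_eqF.
rewrite /ckernel /rint imD imN [Im (_ - _)]imD imN [Im (_ + _)]imD.
move: B1 B2 B3 B4; clear; lra.
Qed.

Lemma ckernel_gt0 x0 x1 y0 y1 z0 : x0 < Re z0 < x1 -> y0 < Im z0 < y1 ->
  0 < cabs (ckernel z0 x0 x1 y0 y1).
Proof.
move=> hx hy; have [h1 h2] := andP hx; have [h3 h4] := andP hy.
apply: lt_le_trans (le_trans (ler_norm _) (normr_Im_le _)).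
apply: lt_le_trans (ckernel_im_ge hx hy).
have w : 0 < x1 - x0 by lra.
have h : 0 < y1 - y0 by lra.
by rewrite divr_gt0 ?addr_gt0 ?exprn_gt0 ?mulr_gt0.
Qed.

End CauchyFormula.

(** * Entire functions: maximum principle, division at a zero, order of zeros *)

Section MaximumPrinciple.
Variable R : realType.
Local Notation C := R[i].
Implicit Types (f g : C -> C) (x y a b : R) (z : C).

Definition holo f := forall z, exists l, cderiv f z l.

Lemma holo_cst (c : C) : holo (fun=> c).
Proof. by move=> z; exists 0; exact: cderiv_cst. Qed.

Lemma holo_id : holo (fun z => z).
Proof. by move=> z; exists 1; exact: cderiv_id. Qed.

Lemma holoD f g : holo f -> holo g -> holo (fun z => f z + g z).
Proof. by move=> Hf Hg z; have [l Hl] := Hf z; have [m Hm] := Hg z; exists (l + m); exact: cderivD. Qed.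

Lemma holoM f g : holo f -> holo g -> holo (fun z => f z * g z).
Proof.
move=> Hf Hg z; have [l Hl] := Hf z; have [m Hm] := Hg z.
by exists (l * g z + f z * m); exact: cderivM.
Qed.

Lemma holoZ c f : holo f -> holo (fun z => c * f z).
Proof. by move=> Hf; apply: holoM => //; exact: holo_cst. Qed.

Lemma holoN f : holo f -> holo (fun z => - f z).
Proof. by move=> Hf z; have [l Hl] := Hf z; exists (- l); exact: cderivN. Qed.

Lemma holoB f g : holo f -> holo g -> holo (fun z => f z - g z).
Proof. by move=> Hf Hg; apply: holoD => //; exact: holoN. Qed.

Lemma holo_comp f g : holo f -> holo g -> holo (fun z => g (f z)).
Proof.
move=> Hf Hg z; have [l Hl] := Hf z; have [m Hm] := Hg (f z).
by exists (m * l); exact: (cderiv_comp Hl Hm).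
Qed.

Lemma holo_cexp f : holo f -> holo (fun z => cexp (f z)).
Proof. by move=> Hf; apply: (holo_comp Hf) => z; exists (cexp z); exact: cderiv_cexp. Qed.

Lemma holoX f n : holo f -> holo (fun z => f z ^+ n).
Proof.
move=> Hf; elim: n => [|n IH].
  by have -> : (fun z => f z ^+ 0) = (fun=> 1) by []; exact: holo_cst.
have -> : (fun z => f z ^+ n.+1) = (fun z => f z * f z ^+ n).
  by apply/funext => z; rewrite exprS.
exact: holoM.
Qed.

Lemma holo_ccont f z : holo f -> ccont f z.
Proof. by move=> /(_ z)[l]; exact: cderiv_ccont. Qed.

Lemma rcont_bounded (g : R -> C) a b : (forall t, rcont g t) ->
  exists2 M : R, 0 < M & forall t, a <= t <= b -> cabs (g t) <= M.
Proof.
move=> cg; have [ab|ba] := leP a b; last first.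
  by exists 1 => // t /andP[h1 h2]; have := lt_le_trans ba (le_trans h1 h2); rewrite ltxx.
have [c _ Hc] := EVT_max ab (continuous_subspaceT (rcont_continuous_cabs cg)).
exists (cabs (g c) + 1) => [|t tab]; first by have := cabs_ge0 (g c); lra.
have := Hc t; rewrite in_itv/= tab => /(_ isT); lra.
Qed.

Lemma dol_bounded f x0 x1 y0 y1 : diff_on_lines f x0 x1 y0 y1 ->
  exists2 M : R, 0 < M & forall s t, x0 <= s <= x1 -> y0 <= t <= y1 ->
    on_lines x0 x1 y0 y1 (s +i* t) -> cabs (f (s +i* t)) <= M.
Proof.
move=> /dol_rcont[c1 c2 c3 c4].
have [M1 m1 H1] := rcont_bounded x0 x1 c1; have [M2 m2 H2] := rcont_bounded x0 x1 c2.
have [M3 m3 H3] := rcont_bounded y0 y1 c3; have [M4 m4 H4] := rcont_bounded y0 y1 c4.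
exists (M1 + M2 + M3 + M4) => [|s t hs ht /or4P[] /= /eqP e]; first by lra.
- by have := H1 s hs; rewrite -e; lra.
- by have := H2 s hs; rewrite -e; lra.
- by have := H3 t ht; rewrite -e; lra.
- by have := H4 t ht; rewrite -e; lra.
Qed.

(** If [x = M (1 + e)] with [M, e > 0], Bernoulli's inequality gives [x^n >= M^n (1 + n e)], which
    outgrows [K M^n]. *)
Lemma le_of_powers (x M K : R) : 0 <= x -> 0 <= M -> (forall n, x ^+ n <= K * M ^+ n) -> x <= M.
Proof.
move=> x0 M0 H; rewrite leNgt; apply/negP => Mx.
have := M0; rewrite le_eqVlt => /orP[/eqP ME|Mp].
  by have := H 1%N; rewrite !expr1 -ME mulr0; lra.
pose e := (x - M) / M; have e0 : 0 < e by rewrite divr_gt0// subr_gt0.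
have xE : x = M * (1 + e) by rewrite /e; field; rewrite gt_eqF.
clearbody e.
have B n : M ^+ n * (1 + n%:R * e) <= x ^+ n.
  elim: n => [|n IH]; first by rewrite !expr0 mul0r addr0 mulr1.
  apply: (@le_trans _ _ (x * (M ^+ n * (1 + n%:R * e)))); last by rewrite exprS ler_wpM2l.
  rewrite xE -natr1 exprS -subr_ge0.
  have -> : M * (1 + e) * (M ^+ n * (1 + n%:R * e)) - M * M ^+ n * (1 + (n%:R + 1) * e)
    = M * M ^+ n * (n%:R * e * e) by ring.
  by rewrite !mulr_ge0// ?exprn_ge0// ltW.
pose n := (Num.truncn (K / e)).+1.
have : K / e < n%:R by exact: truncnS_gt.
rewrite ltr_pdivrMr// => Kn.
have := le_trans (B n) (H n); rewrite mulrC ler_pM2r ?exprn_gt0//; lra.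
Qed.

(** The order of quantifiers matters: [K] comes from the rectangle and the point alone, so that one
    constant serves all powers of a function. *)
Lemma cauchy_estimate f x0 x1 y0 y1 z0 : x0 < Re z0 < x1 -> y0 < Im z0 < y1 ->
  exists K, forall f M, holo f ->
    (forall s t, x0 <= s <= x1 -> y0 <= t <= y1 -> on_lines x0 x1 y0 y1 (s +i* t) ->
      cabs (f (s +i* t)) <= M) -> cabs (f z0) <= K * M.
Proof.
move=> hx hy; have nl := strictly_inside_lines hx hy.
have [h1 h2] := andP hx; have [h3 h4] := andP hy.
have I0 := ckernel_gt0 hx hy.
have dk := dol_inv nl; have [m m0 Hm] := dol_bounded dk.
exists (m * (2 * (x1 - x0 + (y1 - y0))) / cabs (ckernel z0 x0 x1 y0 y1)) => g M hg HM.
rewrite mulrAC ler_pdivlMr// -cabsM -cauchy_formula//.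
have -> : m * (2 * (x1 - x0 + (y1 - y0))) * M = M * m * (2 * (x1 - x0 + (y1 - y0))) by ring.
apply: dol_rint_le; try lra.
  by apply: dolM => //; exact: dol_entire.
by move=> s t hs ht hl; rewrite cabsM ler_pM ?cabs_ge0// ?HM ?Hm.
Qed.

(* Applied to the powers of [f], the constant of [cauchy_estimate] disappears. *)
Lemma maximum_principle f x0 x1 y0 y1 z0 (M : R) : x0 < Re z0 < x1 -> y0 < Im z0 < y1 ->
  holo f ->
  (forall s t, x0 <= s <= x1 -> y0 <= t <= y1 -> on_lines x0 x1 y0 y1 (s +i* t) ->
      cabs (f (s +i* t)) <= M) -> cabs (f z0) <= M.
Proof.
move=> hx hy hf HM; have [K HK] := cauchy_estimate f hx hy.
have [h1 h2] := andP hx; have [h3 h4] := andP hy.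
have M0 : 0 <= M.
  apply: le_trans (cabs_ge0 _) (HM x0 y0 _ _ _); rewrite ?lexx ?andTb /on_lines /= ?eqxx//; lra.
apply: (@le_of_powers _ _ K); rewrite ?cabs_ge0// => n.
rewrite -cabsX; apply: (HK (fun z => f z ^+ n)); first exact: holoX.
by move=> s t hs ht hl; rewrite cabsX lerXn2r// ?nnegrE ?cabs_ge0// HM.
Qed.

(** Expanding [1 / (w - z0 - h)] to second order in [h] leaves the remainder
    [h^2 / ((w - z0)^2 (w - z0 - h))]. The sides are at distance 1 from [z0], so for [|h| < 1/2] the
    last factor costs at most 2; the perimeter is 8. *)
Lemma cderiv_cauchy_type (phi : C -> C) z0 :
  diff_on_lines phi (Re z0 - 1) (Re z0 + 1) (Im z0 - 1) (Im z0 + 1) ->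
  exists l, cderiv (fun z => rint (fun w => phi w * (w - z)^-1)
      (Re z0 - 1) (Re z0 + 1) (Im z0 - 1) (Im z0 + 1)) z0 l.
Proof.
set x0 := Re z0 - 1; set x1 := Re z0 + 1; set y0 := Im z0 - 1; set y1 := Im z0 + 1.
move=> dphi.
have far w : on_lines x0 x1 y0 y1 w -> 1 <= cabs (w - z0).
  by apply: on_lines_dist; rewrite /x0 /x1 /y0 /y1; lra.
have far2 w h : on_lines x0 x1 y0 y1 w -> cabs h < 2^-1 -> 2^-1 <= cabs (w - (z0 + h)).
  move=> /far H hh; have := cabsB (w - (z0 + h)) (- h).
  by rewrite opprK opprD addrA subrK cabsN; lra.
have off h : cabs h < 2^-1 -> ~~ on_lines x0 x1 y0 y1 (z0 + h).
  move=> hh; apply/negP => /far2/(_ hh); rewrite subrr cabs0; lra.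
have h0 : cabs (0 : C) < 2^-1 by rewrite cabs0; lra.
have [M M0 HM] := dol_bounded dphi.
have di h : cabs h < 2^-1 -> diff_on_lines (fun w => (w - (z0 + h))^-1) x0 x1 y0 y1.
  by move=> /off; exact: dol_inv.
have d0 := di _ h0; rewrite addr0 in d0.
exists (rint (fun w => phi w * ((w - z0)^-1 * (w - z0)^-1)) x0 x1 y0 y1).
move=> e e0; pose k := M * 2 * 8.
have kp : 0 < k by rewrite !mulr_gt0.
exists (Num.min 2^-1 (e / k)); first by rewrite lt_min divr_gt0// andbT; lra.
move=> h; rewrite lt_min => /andP[hh he].
have dh := di _ hh.
have E : rint (fun w => phi w * (w - (z0 + h))^-1) x0 x1 y0 y1
   - rint (fun w => phi w * (w - z0)^-1) x0 x1 y0 y1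
   - rint (fun w => phi w * ((w - z0)^-1 * (w - z0)^-1)) x0 x1 y0 y1 * h
  = h * h * rint (fun w => phi w * ((w - z0)^-1 * (w - z0)^-1 * (w - (z0 + h))^-1)) x0 x1 y0 y1.
  have dpA := dolM dphi (dolM d0 d0).
  have dpB := dolM dphi (dolM (dolM d0 d0) dh).
  rewrite -(rintZ (h * h))//.
  have -> : rint (fun w => phi w * (w - (z0 + h))^-1) x0 x1 y0 y1 =
      rint (fun w => phi w * (w - z0)^-1) x0 x1 y0 y1 +
      (rint (fun w => h * (phi w * ((w - z0)^-1 * (w - z0)^-1))) x0 x1 y0 y1 +
       rint (fun w => h * h * (phi w * ((w - z0)^-1 * (w - z0)^-1 * (w - (z0 + h))^-1))) x0 x1 y0 y1).
    rewrite -rintD; [|exact: dolZ|exact: dolZ].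
    rewrite -rintD; [|exact: dolM|by apply: dolD; exact: dolZ].
    apply: eq_rint => w Hw.
    have n1 : w - z0 != 0 by rewrite -cabs_gt0; have := far _ Hw; lra.
    have n2 : w - (z0 + h) != 0 by rewrite -cabs_gt0; have := far2 _ _ Hw hh; lra.
    by field; rewrite n1 n2.
  by rewrite (rintZ h)//; ring.
rewrite E !cabsM -mulrA mulrCA mulrC.
have B : cabs (rint (fun w => phi w * ((w - z0)^-1 * (w - z0)^-1 * (w - (z0 + h))^-1)) x0 x1 y0 y1)
    <= M * 2 * (2 * (x1 - x0 + (y1 - y0))).
  apply: dol_rint_le; rewrite /x0 /x1 /y0 /y1; try lra.
    by apply: dolM => //; exact: dolM (dolM d0 d0) dh.
  move=> s t hs ht hl; rewrite !cabsM !cabsV.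
  have F1 := far _ hl; have F2 := far2 _ _ hl hh.
  have i1 : (cabs (s +i* t - z0))^-1 <= 1 by rewrite invf_le1//; lra.
  have i2 : (cabs (s +i* t - (z0 + h)))^-1 <= 2.
    by rewrite -[leRHS]invrK lef_pV2// posrE; lra.
  have p1 : 0 <= (cabs (s +i* t - z0))^-1 by rewrite invr_ge0 cabs_ge0.
  have p2 : 0 <= (cabs (s +i* t - (z0 + h)))^-1 by rewrite invr_ge0 cabs_ge0.
  apply: ler_pM; rewrite ?cabs_ge0 ?mulr_ge0//; first exact: HM.
  by rewrite -[leRHS]mul1r; apply: ler_pM; rewrite ?mulr_ge0// mulr_ile1.
have E8 : 2 * (x1 - x0 + (y1 - y0)) = 8 by rewrite /x0 /x1 /y0 /y1; ring.
rewrite E8 -/k in B; rewrite ler_wpM2r ?cabs_ge0//.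
apply: le_trans (ler_pM (cabs_ge0 _) (cabs_ge0 _) (ltW he) B) _.
by rewrite divfK// gt_eqF.
Qed.

(* Partial fractions exhibit the quotient, near the zero, as a Cauchy type integral. *)
Lemma holo_divide f z0 : holo f -> f z0 = 0 ->
  exists2 g, holo g & forall z, f z = (z - z0) * g z.
Proof.
move=> hf f0.
pose x0 := Re z0 - 1; pose x1 := Re z0 + 1; pose y0 := Im z0 - 1; pose y1 := Im z0 + 1.
have ins h : cabs h < 2^-1 -> x0 < Re (z0 + h) < x1 /\ y0 < Im (z0 + h) < y1.
  move=> hh; have := le_lt_trans (normr_Re_le h) hh; have := le_lt_trans (normr_Im_le h) hh.
  by rewrite !ltr_norml reD imD /x0 /x1 /y0 /y1 => /andP[? ?] /andP[? ?]; split; apply/andP; split; lra.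
have h0 : cabs (0 : C) < 2^-1 by rewrite cabs0; lra.
have [I1 I2] := ins _ h0; rewrite addr0 in I1 I2.
have di h : cabs h < 2^-1 -> diff_on_lines (fun w => (w - (z0 + h))^-1) x0 x1 y0 y1.
  by move=> /ins[i1 i2]; apply: dol_inv; exact: strictly_inside_lines.
have d0 := di _ h0; rewrite addr0 in d0.
have df : diff_on_lines f x0 x1 y0 y1 by exact: dol_entire.
have kn0 h : cabs h < 2^-1 -> ckernel (z0 + h) x0 x1 y0 y1 != 0.
  by move=> /ins[i1 i2]; rewrite -cabs_gt0; exact: ckernel_gt0.
pose N z := rint (fun w => (f w * (w - z0)^-1) * (w - z)^-1) x0 x1 y0 y1.
have [n Hn] := @cderiv_cauchy_type (fun w => f w * (w - z0)^-1) z0 (dolM df d0).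
have dc : diff_on_lines (fun=> 1) x0 x1 y0 y1 by move=> z _; exists 0; exact: cderiv_cst.
have [m] := @cderiv_cauchy_type (fun=> 1) z0 dc.
have -> : (fun z => rint (fun w => 1 * (w - z)^-1) (Re z0 - 1) (Re z0 + 1) (Im z0 - 1) (Im z0 + 1))
    = (fun z => ckernel z x0 x1 y0 y1).
  by apply/funext => z; apply: eq_rint => w _; rewrite mul1r.
move=> Hm.
have k0 := kn0 _ h0; rewrite addr0 in k0.
pose g z := if z == z0 then N z0 / ckernel z0 x0 x1 y0 y1 else f z / (z - z0).
have gE h : cabs h < 2^-1 -> N (z0 + h) * (ckernel (z0 + h) x0 x1 y0 y1)^-1 = g (z0 + h).
  move=> hh; rewrite /g; have [->//|hn] := eqVneq (z0 + h) z0.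
  have zn : z0 + h - z0 != 0 by rewrite subr_eq0.
  have [i1 i2] := ins _ hh.
  have := cauchy_formula hf i1 i2; have := cauchy_formula hf I1 I2.
  rewrite f0 mul0r => F0 F1.
  suff E : N (z0 + h) = f (z0 + h) * ckernel (z0 + h) x0 x1 y0 y1 / (z0 + h - z0).
    by rewrite E; field; rewrite kn0 ?zn.
  rewrite -F1 -[X in X / _]subr0 -F0; apply: (mulIf zn); rewrite divfK//.
  have -> : N (z0 + h) * (z0 + h - z0) = (z0 + h - z0) * N (z0 + h) by rewrite mulrC.
  rewrite /N -(rintZ (z0 + h - z0)); last by apply: dolM; [exact: dolM|exact: di].
  rewrite -[- rint _ _ _ _ _]mulN1r -(rintZ (-1)); last exact: dolM.
  rewrite -rintD; [|by apply: dolM => //; exact: di|by apply: dolZ; exact: dolM].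
  apply: eq_rint => w Hw.
  have n1 : w - z0 != 0.
    by rewrite subr_eq0; apply: contraTneq Hw => ->; exact: strictly_inside_lines.
  have n2 : w - (z0 + h) != 0.
    by rewrite subr_eq0; apply: contraTneq Hw => ->; exact: strictly_inside_lines.
  by field; rewrite n1 n2.
exists g => [z|z]; last first.
  rewrite /g; have [->|zz] := eqVneq z z0; first by rewrite subrr mul0r.
  by rewrite mulrC divfK// subr_eq0.
have [->|zz] := eqVneq z z0.
  have D := cderivM Hn (cderiv_comp Hm (cderiv_inv k0)).
  eexists; apply: (@cderiv_near _ _ g _ _ 2^-1 _ _ D); first by lra.
  by move=> h hh; rewrite -gE.
have [q Hq] := @dquot_cderiv _ f z0 0 z hf zz; exists q.
apply: (@cderiv_near _ _ g _ _ (cabs (z - z0)) _ _ Hq); first by rewrite cabs_gt0 subr_eq0.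
move=> h hz; have zh : z + h != z0.
  apply: contraTneq hz => E; rewrite -E opprD addrA subrr sub0r cabsN -leNgt lexx.
  by [].
by rewrite /dquot /g !ifN// f0 subr0.
Qed.

(** The half-side [d] is at least [2 |z - z0|]. The maximum principle for the [n]-th quotient bounds
    it at [z] by [M / d^n], whence [|f z| <= M / 2^n] for every [n]. *)
Lemma infinite_order_zero f z0 : holo f ->
  (forall n, exists2 g, holo g & forall z, f z = (z - z0) ^+ n * g z) -> forall z, f z = 0.
Proof.
move=> hf H z.
pose d := 2 * (cabs (z - z0) + 1).
have d0 : 0 < d by rewrite /d; have := cabs_ge0 (z - z0); lra.
pose x0 := Re z0 - d; pose x1 := Re z0 + d; pose y0 := Im z0 - d; pose y1 := Im z0 + d.
have hx : x0 < Re z < x1.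
  have := normr_Re_le (z - z0); rewrite reD reN ler_norml /x0 /x1 => /andP[? ?].
  by have cz := cabs_ge0 (z - z0); apply/andP; split; rewrite /d; lra.
have hy : y0 < Im z < y1.
  have := normr_Im_le (z - z0); rewrite imD imN ler_norml /y0 /y1 => /andP[? ?].
  by have cz := cabs_ge0 (z - z0); apply/andP; split; rewrite /d; lra.
have [M M0 HM] := dol_bounded (dol_entire (x0 := x0) (x1 := x1) (y0 := y0) (y1 := y1) hf).
have far w : on_lines x0 x1 y0 y1 w -> d <= cabs (w - z0).
  by apply: on_lines_dist; rewrite /x0 /x1 /y0 /y1; lra.
have key n : cabs (f z) * 2 ^+ n <= M.
  have [g hg Hg] := H n.
  have B : cabs (g z) <= M / d ^+ n.
    apply: (@maximum_principle g x0 x1 y0 y1) => // s t hs ht hl.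
    have := HM s t hs ht hl; rewrite Hg cabsM cabsX => h.
    have dn0 : 0 < d ^+ n by rewrite exprn_gt0.
    rewrite ler_pdivlMr// mulrC; apply: le_trans h.
    by rewrite ler_wpM2r ?cabs_ge0// lerXn2r ?nnegrE ?cabs_ge0 ?(ltW d0)// far.
  rewrite Hg cabsM cabsX mulrAC -exprMn.
  have e : cabs (z - z0) * 2 <= d by rewrite /d; lra.
  have dn0 : 0 < d ^+ n by rewrite exprn_gt0.
  rewrite ler_pdivlMr// in B; apply: le_trans B; rewrite mulrC ler_wpM2l ?cabs_ge0//.
  by rewrite lerXn2r ?nnegrE ?(ltW d0)// mulr_ge0 ?cabs_ge0.
apply/eqP; rewrite -cabs_eq0 eq_le cabs_ge0 andbT leNgt; apply/negP => c0.
have [n Hn] := half_pow_lt M c0.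
by move: Hn; rewrite ltr_pdivrMr ?exprn_gt0// ltNge key.
Qed.

End MaximumPrinciple.

(** * The Phragmen-Lindelof principle in a half-strip *)

Section PhragmenLindelof.
Variable R : realType.
Local Notation C := R[i].
Implicit Types (G : C -> C).

(** With [D = kap - lam], [expR (kap * U)] is at least [D U expR (lam * U)], while every other term
    is at most a multiple of [expR (lam * U)]; a large [U] decides. *)
Lemma expR_dominates (lam kap A N L e : R) : 0 < lam -> lam < kap -> 0 < A -> 0 < e ->
  forall u0 : R, exists2 U, u0 < U &
    A * expR (lam * U) - N * U - e * expR (kap * U) <= L.
Proof.
move=> lam0 lk A0 e0 u0.
pose D := kap - lam; have D0 : 0 < D by rewrite /D; lra.
pose K := A + `|N| / lam + `|L|.
have K0 : 0 <= K by rewrite /K !addr_ge0 ?divr_ge0// ltW.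
pose U := Num.max (u0 + 1) (Num.max 1 (K / (e * D))).
have U1 : u0 + 1 <= U by rewrite le_max lexx.
have U2 : 1 <= U by rewrite !le_max lexx !orbT.
have U3 : K / (e * D) <= U by rewrite !le_max lexx !orbT.
exists U; first lra.
have eD : 0 < e * D by rewrite mulr_gt0.
rewrite ler_pdivrMr// in U3.
pose X := expR (lam * U).
have X1 : 1 + lam * U <= X by exact: expR_ge1Dx.
have lU : 0 < lam * U by rewrite mulr_gt0//; lra.
have Y : e * expR (kap * U) >= X * (e * (D * U)).
  have -> : kap * U = lam * U + D * U by rewrite /D; ring.
  rewrite expRD -/X mulrCA ler_wpM2l//; first by lra.
  by rewrite ler_wpM2l ?(ltW e0)//; apply: le_trans (expR_ge1Dx _); lra.
have N1 : - N * U <= `|N| / lam * X.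
  apply: (@le_trans _ _ (`|N| / lam * (lam * U))).
    have -> : `|N| / lam * (lam * U) = `|N| * U by field; rewrite gt_eqF.
    by rewrite ler_wpM2r//; [lra|rewrite -normrN ler_norm].
  by rewrite ler_wpM2l ?divr_ge0 ?(ltW lam0)//; lra.
have L1 : - L <= `|L| * X.
  apply: (@le_trans _ _ (`|L| * 1)); first by rewrite mulr1 -normrN ler_norm.
  by rewrite ler_wpM2l//; lra.
have KX : K * X <= X * (e * (D * U)).
  by rewrite mulrC ler_wpM2l//; [lra|rewrite mulrA mulrC].
have KXE : K * X = A * X + `|N| / lam * X + `|L| * X by rewrite /K; ring.
rewrite -/X; lra.
Qed.

Lemma cos_ge_of_norm_le (x y : R) : `|x| <= y -> y <= pi -> cos y <= cos x.
Proof.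
move=> xy ypi; have -> : cos x = cos `|x|.
  by have [//|x0] := ger0P x; rewrite cosN.
have hx : `|x| \in `[0, pi]%R by rewrite in_itv/= normr_ge0 (le_trans xy).
have hy : y \in `[0, pi]%R by rewrite in_itv/= ypi (le_trans _ xy).
by rewrite leNgt ltr_cos// -leNgt.
Qed.

(** With [z = exp w] the half-strip is a sector, [expR (N * u)] is [|z|^N], and the last hypothesis
    is growth of order [lam], below the critical order [pi / (2 h)]. Multiplication by
    [exp (- e exp (kap (w - i c)))] reduces the claim to the maximum principle on long rectangles;
    then [e] tends to 0. *)
Lemma phragmen_lindelof G (c h K A N lam : R) : 0 < h -> 0 < K -> 0 < A -> 0 < lam ->
  lam * h < pi / 2 -> holo G ->
  (forall v, `|v - c| <= h -> cabs (G (0 +i* v)) <= K) ->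
  (forall u, 0 <= u -> cabs (G (u +i* (c - h))) <= K * expR (N * u)) ->
  (forall u, 0 <= u -> cabs (G (u +i* (c + h))) <= K * expR (N * u)) ->
  (forall u v, 0 <= u -> `|v - c| <= h -> cabs (G (u +i* v)) <= A * expR (A * expR (lam * u))) ->
  forall u v, 0 <= u -> `|v - c| <= h -> cabs (G (u +i* v)) <= K * expR (N * u).
Proof.
move=> h0 K0 A0 lam0 lh hG HL HB HT HA u v u0 vh.
have [->|un] := eqVneq u 0; first by rewrite mulr0 expR0 mulr1 HL.
have {un}u0 : 0 < u by rewrite lt_neqAle eq_sym un.
have [vb|nvb] := eqVneq v (c - h); first by rewrite vb; apply: HB; exact: ltW.
have [vt|nvt] := eqVneq v (c + h); first by rewrite vt; apply: HT; exact: ltW.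
have vin : c - h < v < c + h.
  by move: vh; rewrite ler_norml => /andP[? ?]; rewrite !lt_neqAle nvt eq_sym nvb /=; apply/andP; split; lra.
(* The midpoint of [lam] and [pi / (2 h)]: above [lam], so that the damping beats the a priori
   growth, and below [pi / (2 h)], so that [cos (kap (v - c))] stays positive on the strip. *)
pose kap := (lam + pi / 2 / h) / 2.
have lk2 : lam < pi / 2 / h by rewrite ltr_pdivlMr.
have lk : lam < kap by rewrite /kap; lra.
have kh : kap * h < pi / 2 by rewrite -ltr_pdivlMr// /kap; lra.
have kap0 : 0 < kap by lra.
have kh0 : 0 < kap * h by rewrite mulr_gt0.
have pi0 := pi_gt0 R.
have chk : 0 < cos (kap * h) by apply: cos_gt0_pihalf; apply/andP; split; lra.
have ck t : `|t - c| <= h -> cos (kap * h) <= cos (kap * (t - c)).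
  move=> th; apply: cos_ge_of_norm_le; last lra.
  by rewrite normrM gtr0_norm// ler_pM2l.
pose H e w := G w * cexp (- (N%:C * w) - e%:C * cexp (kap%:C * (w - (0 +i* c)))).
have hH e : holo (H e).
  apply: holoM => //; apply: holo_cexp; apply: holoB.
    by apply: holoN; apply: holoZ; exact: holo_id.
  apply: holoZ; apply: holo_cexp; apply: holoZ; apply: holoB; [exact: holo_id|exact: holo_cst].
have cH e s t : cabs (H e (s +i* t)) =
   cabs (G (s +i* t)) * expR (- (N * s) - e * (expR (kap * s) * cos (kap * (t - c)))).
  rewrite /H cabsM cabs_cexp; congr (_ * expR _).
  by rewrite reD !reN (reZl N) (reZl e) reCexp reZl imZl reD imD reN imN /= subr0.
have key e : 0 < e -> cabs (H e (u +i* v)) <= K.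
  move=> e0.
  have e1 : 0 < e * cos (kap * h) by rewrite mulr_gt0.
  (* [U] is so large that on the right side the damped a priori bound is at most [K]. *)
  have [U uU HU] := @expR_dominates lam kap A N (ln K - ln A) _ lam0 lk A0 e1 u.
  have drop s t (B : R) : 0 <= s -> `|t - c| <= h -> 0 <= B ->
      cabs (G (s +i* t)) <= B * expR (N * s) -> cabs (H e (s +i* t)) <= B.
    move=> s0 th B0 hB; rewrite cH expRD mulrA.
    have : cabs (G (s +i* t)) * expR (- (N * s)) <= B.
      by rewrite expRN ler_pdivrMr ?expR_gt0.
    move=> hh; rewrite -[leRHS]mulr1 ler_pM ?mulr_ge0 ?cabs_ge0 ?expR_ge0//.
    rewrite -expR0 ler_expR oppr_le0 !mulr_ge0 ?expR_ge0 ?(ltW e0)//.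
    by apply: le_trans (ck _ th); exact: ltW.
  apply: (@maximum_principle _ (H e) 0 U (c - h) (c + h)) => //.
    by rewrite /= u0.
  move=> s t /andP[s0 sU] ht hl.
  have th : `|t - c| <= h by rewrite ler_norml; move: ht => /andP[? ?]; apply/andP; split; lra.
  case/or4P: hl => /= /eqP E.
  - by apply: drop => //; [exact: ltW|rewrite E; exact: HB].
  - by apply: drop => //; [exact: ltW|rewrite E; exact: HT].
  - by apply: drop => //; [exact: ltW|rewrite E mulr0 expR0 mulr1; exact: HL].
  rewrite cH E.
  have U0 : 0 <= U by lra.
  apply: le_trans (ler_wpM2r (expR_ge0 _) (HA U t U0 th)) _.
  rewrite -mulrA -expRD -[K](lnK K0) -[X in X * _](lnK A0) -expRD ler_expR.
  have : e * (expR (kap * U) * cos (kap * (t - c))) >= e * cos (kap * h) * expR (kap * U).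
    rewrite -mulrA ler_pM2l// mulrC ler_wpM2l ?expR_ge0//; exact: ck.
  move: HU; clear; lra.
rewrite leNgt; apply/negP => lt.
have P0 : 0 < cabs (G (u +i* v)) by apply: le_lt_trans lt; rewrite mulr_ge0 ?expR_ge0 ?ltW.
(* [q] is the logarithmic excess of a supposed counterexample; the value of [e] chosen below costs
   only [q / 2] of it. *)
pose q := ln (cabs (G (u +i* v))) - ln K - N * u.
have q0 : 0 < q.
  rewrite /q subr_gt0 ltrBrDr -ltr_expR expRD !lnK//.
  by rewrite mulrC.
pose E := expR (kap * u) * cos (kap * (v - c)).
have E0 : 0 < E by rewrite mulr_gt0 ?expR_gt0//; apply: lt_le_trans (ck _ vh).
have e0 : 0 < q / 2 / E by rewrite !divr_gt0.
have := key _ e0; rewrite cH -/E divfK ?gt_eqF// -[X in X * _](lnK P0) -expRD -[X in _ <= X](lnK K0).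
rewrite ler_expR /q in q0 *; lra.
Qed.

End PhragmenLindelof.

(** * Measurability in the plane and the Fock integral *)

Section PlanarIntegral.
Variable R : realType.
Local Notation C := R[i].
Local Notation mu := (@lebesgue_measure R).
Local Notation mu2 := (@lebesgue_measure R \x @lebesgue_measure R)%E.
Implicit Types (F : C -> C) (z w : C).

(* Superlevel sets are countable unions of open rational squares. *)
Lemma measurable_fun_planar (g : R * R -> R) :
  (forall x y e : R, 0 < e -> exists2 d : R, 0 < d & forall x' y', `|x' - x| < d -> `|y' - y| < d ->
      g (x, y) - e < g (x', y')) ->
  measurable_fun [set: R * R] g.
Proof.
move=> Hg; apply: (measurability _ (@RGenOInfty.measurableE R)).
move=> _ [_ [r ->] <-]; rewrite setTI.
pose box (i : rat * rat * nat) : set (R * R) :=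
  (`]ratr i.1.1 - i.2.+1%:R^-1, ratr i.1.1 + i.2.+1%:R^-1[ : set R)
  `*` (`]ratr i.1.2 - i.2.+1%:R^-1, ratr i.1.2 + i.2.+1%:R^-1[ : set R).
set A := _ @^-1` _.
have -> : A = \bigcup_(i : rat * rat * nat) (if pselect (box i `<=` A) then box i else set0).
  apply/seteqP; split => [[x y]|[x y] [i _]]; last by case: pselect => // h; exact: h.
  rewrite /A /= in_itv/= andbT => rg.
  have [d d0 Hd] : exists2 d, 0 < d & forall x' y', `|x' - x| < d -> `|y' - y| < d -> r < g (x', y').
    have e0 : 0 < g (x, y) - r by lra.
    have [d d0 H] := Hg x y _ e0; exists d => // x' y' h1 h2.
    by have := H _ _ h1 h2; rewrite opprB addrC subrK.
  have [n [k [kE k0 kd]]] : exists n k, [/\ n.+1%:R^-1 = k :> R, 0 < k & 2 * k < d].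
    exists (Num.truncn (2 / d)), (Num.truncn (2 / d)).+1%:R^-1; split => //.
    have : 2 / d < (Num.truncn (2 / d)).+1%:R by exact: truncnS_gt.
    by rewrite ltr_pdivrMr// mulrC -ltr_pdivrMr// mulrC.
  have [qx] : exists q, ratr q \in `]x - k, x + k[.
    by apply: rat_in_itvoo; rewrite ltrBlDr -addrA ltrDl addr_gt0.
  rewrite in_itv/= => /andP[qx1 qx2].
  have [qy] : exists q, ratr q \in `]y - k, y + k[.
    by apply: rat_in_itvoo; rewrite ltrBlDr -addrA ltrDl addr_gt0.
  rewrite in_itv/= => /andP[qy1 qy2].
  exists ((qx, qy), n) => //; case: pselect => [?|[]].
    by split; rewrite /= in_itv/= kE; clear - qx1 qx2 qy1 qy2; apply/andP; split; lra.
  move=> [x' y'] []; rewrite /= !in_itv/= kE => /andP[h1 h2] /andP[h3 h4].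
  rewrite andbT; apply: Hd; rewrite ltr_norml; clear - qx1 qx2 qy1 qy2 h1 h2 h3 h4 kd.
    by apply/andP; split; lra.
  by apply/andP; split; lra.
apply: countable_bigcupT_measurable => // i.
case: pselect => ?; last exact: measurable0.
by rewrite /box /=; apply: measurableX; exact: measurable_itv.
Qed.

Lemma measurable_cabs F : (forall z, ccont F z) ->
  measurable_fun [set: R * R] (fun xy : R * R => cabs (F (xy.1 +i* xy.2))).
Proof.
move=> cF; apply: measurable_fun_planar => x y e e0 /=.
have e2 : 0 < e / 2 by lra.
have [d d0 H] := cF (x +i* y) _ e2.
exists (d / 2) => [|x' y' h1 h2]; first by lra.
have : cabs ((x' +i* y') - (x +i* y)) < d.
  by apply: le_lt_trans (cabs_le_ReIm _) _; rewrite /=; clear - h1 h2; lra.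
move=> /H; rewrite subrKC => h.
have := cabs_dist (F (x' +i* y')) (F (x +i* y)); rewrite ler_norml => /andP[h3 _].
by clear - h h3 e0; lra.
Qed.

Lemma integral_inv_1Dsqr :
  (\int[mu]_x ((1 + x ^+ 2)^-1)%:E)%E = pi%:E.
Proof.
have p1 (x : R) : 0 < 1 + x ^+ 2 by rewrite ltr_pwDl// sqr_ge0.
have cf : continuous (fun x : R => (1 + x ^+ 2)^-1) by exact: continuous_oneDsqrV.
rewrite (@ge0_symfun_integralT R (fun x => (1 + x ^+ 2)^-1))//=.
- rewrite (_ : [set x | _] = `[0, +oo[%classic); last first.
    by apply/seteqP; split => x/=; rewrite in_itv/= andbT.
  by rewrite (integral0y_oneDsqr R) -EFinM mulrCA mulfV// mulr1.
- by move=> x; rewrite invr_ge0 ltW.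
- by move=> x /=; rewrite sqrrN.
Qed.

Section Weighted.
Variables p alpha a : R.
Hypotheses (p1 : 1 <= p) (alpha1 : 1 <= alpha) (a0 : 0 < a).

Let p_gt0 : 0 < p. Proof. exact: lt_le_trans ltr01 p1. Qed.

Definition fock_dens F (xy : R * R) : R :=
  Normc.normc (F (xy.1 +i* xy.2)) `^ p * expR (- (a * Normc.normc (xy.1 +i* xy.2) `^ alpha)).

Definition fock_int F : \bar R := (\int[mu2]_xy (fock_dens F xy)%:E)%E.

Lemma fock_dens_ge0 F xy : 0 <= fock_dens F xy.
Proof. by rewrite mulr_ge0 ?powR_ge0 ?expR_ge0. Qed.

Lemma fock_int_ge0 F : (0 <= fock_int F)%E.
Proof. by apply: integral_ge0 => xy _; rewrite lee_fin fock_dens_ge0. Qed.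

Lemma measurable_fock_dens F : (forall z, ccont F z) -> measurable_fun [set: R * R] (fock_dens F).
Proof.
move=> cF; apply: measurable_funM.
  by apply: (measurableT_comp (measurable_powR p)); exact: measurable_cabs.
apply: (measurableT_comp (@measurable_expR R)).
apply: measurableT_comp => //; apply: measurable_funM => //.
apply: (measurableT_comp (measurable_powR alpha)).
exact: (measurable_cabs (fun z => cderiv_ccont (cderiv_id z))).
Qed.

Lemma fock_normE F : fock_norm p alpha a F = (fock_int F `^ p^-1)%E.
Proof. by []. Qed.

Lemma fock_norm_lty F : (fock_norm p alpha a F < +oo)%E <-> (fock_int F < +oo)%E.
Proof.
have pV : p^-1 != 0 by rewrite invr_neq0// gt_eqF.
rewrite fock_normE; split; last exact: poweR_lty.
exact: lty_poweRy.
Qed.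

Lemma fock_norm_lt F (e : R) : (fock_norm p alpha a F < e%:E)%E -> (fock_int F <= (e `^ p)%:E)%E.
Proof.
have p0 : p != 0 by rewrite gt_eqF.
move=> H; have := fock_int_ge0 F; move: H; rewrite fock_normE.
case: (fock_int F) => [r||//].
  rewrite lte_fin !lee_fin => re r0.
  have -> : r = (r `^ p^-1) `^ p by rewrite -powRrM mulVf// powRr1.
  have h : 0 <= r `^ p^-1 by exact: powR_ge0.
  apply: ge0_ler_powR; rewrite ?nnegrE ?(ltW p_gt0)//; first exact: ltW (le_lt_trans h re).
  exact: ltW.
by rewrite poweRyr ?invr_neq0// => /ltW; rewrite leye_eq.
Qed.

(** The crude inequality [(u + v)^p <= 2^p (u^p + v^p)], from [u + v <= 2 max(u, v)]; it suffices
    for finiteness and for bounds that are uniform in the functions. *)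
Lemma fock_int_lincomb (c : C) F G : (forall z, ccont F z) -> (forall z, ccont G z) ->
  (forall z, ccont (fun z => c * F z + G z) z) ->
  (fock_int (fun z => c * F z + G z)%R <=
    (2 `^ p * (cabs c `^ p + 1))%:E * (fock_int F + fock_int G))%E.
Proof.
move=> cF cG cH.
have mF := measurable_fock_dens cF; have mG := measurable_fock_dens cG.
have k0 : 0 <= 2 `^ p * (cabs c `^ p + 1) by rewrite mulr_ge0 ?addr_ge0 ?powR_ge0.
rewrite /fock_int -ge0_integralD//; last 4 first.
- by move=> xy _; rewrite lee_fin fock_dens_ge0.
- exact/measurable_EFinP.
- by move=> xy _; rewrite lee_fin fock_dens_ge0.
- exact/measurable_EFinP.
rewrite -ge0_integralZl_EFin//; last 2 first.
- by move=> xy _; rewrite adde_ge0// lee_fin fock_dens_ge0.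
- by apply: emeasurable_funD; exact/measurable_EFinP.
apply: ge0_le_integral => //.
- by move=> xy _; rewrite lee_fin fock_dens_ge0.
- apply/measurable_EFinP; exact: (measurable_fock_dens cH).
- by apply: measurable_funeM; apply: emeasurable_funD; exact/measurable_EFinP.
move=> xy _; rewrite -EFinD -EFinM lee_fin /fock_dens -mulrDl mulrA ler_wpM2r ?expR_ge0//.
set f := F _; set g := G _; rewrite -!/(cabs _).
have p0 : 0 <= p by exact: ltW.
have B (u v : R) : 0 <= u -> 0 <= v -> (u + v) `^ p <= 2 `^ p * (u `^ p + v `^ p).
  move=> u0 v0; rewrite mulrDr -!powRM//.
  have [uv|/ltW vu] := leP u v.
    apply: (@le_trans _ _ ((2 * v) `^ p)); last by rewrite lerDr powR_ge0.
    by apply: ge0_ler_powR; rewrite ?nnegrE//; lra.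
  apply: (@le_trans _ _ ((2 * u) `^ p)); last by rewrite lerDl powR_ge0.
  by apply: ge0_ler_powR; rewrite ?nnegrE//; lra.
apply: (@le_trans _ _ ((cabs c * cabs f + cabs g) `^ p)).
  apply: ge0_ler_powR; rewrite ?nnegrE ?addr_ge0 ?mulr_ge0 ?cabs_ge0//.
  by rewrite -cabsM cabsD.
apply: le_trans (B _ _ _ _) _; rewrite ?mulr_ge0 ?cabs_ge0// -mulrA ler_wpM2l ?powR_ge0//.
rewrite powRM ?cabs_ge0// -subr_ge0.
have -> : (cabs c `^ p + 1) * (cabs f `^ p + cabs g `^ p) - (cabs c `^ p * cabs f `^ p + cabs g `^ p)
  = cabs c `^ p * cabs g `^ p + cabs f `^ p by ring.
by rewrite addr_ge0 ?mulr_ge0 ?powR_ge0.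
Qed.

(** The exponential cancels the Fock weight. As [p >= 1], what is left is at most [(1 + |z|)^-4],
    hence at most [1 / ((1 + x^2) (1 + y^2))], a product with finite integral. *)
Lemma fock_int_small F (K : R) : (forall z, ccont F z) -> 0 <= K ->
  (forall z, cabs (F z) <= K * expR (a / p * cabs z `^ alpha) / (1 + cabs z) ^+ 4) ->
  (fock_int F < +oo)%E.
Proof.
move=> cF K0 HF; have p0 := p_gt0.
pose h (x : R) : R := (1 + x ^+ 2)^-1.
have h0 x : 0 < h x by rewrite invr_gt0 ltr_pwDl// sqr_ge0.
have mh : measurable_fun setT h by apply: continuous_measurable_fun; exact: continuous_oneDsqrV.
pose H (xy : R * R) := K `^ p * (h xy.1 * h xy.2).
have mH : measurable_fun setT H.
  apply: measurable_funM => //; apply: measurable_funM.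
    by apply: (measurableT_comp mh); exact: measurable_fst.
  by apply: (measurableT_comp mh); exact: measurable_snd.
have H0 xy : 0 <= H xy by rewrite mulr_ge0 ?powR_ge0// mulr_ge0// ltW.
apply: (@le_lt_trans _ _ (\int[mu2]_xy (H xy)%:E)%E).
  apply: ge0_le_integral => //.
  - by move=> xy _; rewrite lee_fin fock_dens_ge0.
  - apply/measurable_EFinP; exact: (measurable_fock_dens cF).
  - exact/measurable_EFinP.
  move=> [x y] _; rewrite lee_fin /fock_dens -!/(cabs _) /H /=.
  set z := x +i* y; have r0 := cabs_ge0 z.
  have E0 : 0 < expR (a / p * cabs z `^ alpha) by exact: expR_gt0.
  have D0 : 0 < (1 + cabs z) ^+ 4 by rewrite exprn_gt0//; lra.
  apply: (@le_trans _ _ ((K * expR (a / p * cabs z `^ alpha) / (1 + cabs z) ^+ 4) `^ p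
      * expR (- (a * cabs z `^ alpha)))).
    rewrite ler_wpM2r ?expR_ge0//; apply: ge0_ler_powR; rewrite ?nnegrE ?cabs_ge0 ?(ltW p0)//.
    apply: mulr_ge0; last by rewrite invr_ge0 (ltW D0).
    by apply: mulr_ge0 => //; exact: ltW.
  rewrite powRM ?mulr_ge0 ?invr_ge0 ?(ltW E0) ?(ltW D0)// powRM ?(ltW E0)//.
  have -> : expR (a / p * cabs z `^ alpha) `^ p = expR (a * cabs z `^ alpha).
    by rewrite -expRM; congr expR; field; rewrite gt_eqF.
  rewrite mulrAC -[X in X * _]mulrA -expRD subrr expR0 mulr1 ler_wpM2l ?powR_ge0//.
  apply: (@le_trans _ _ (((1 + cabs z) ^+ 4)^-1)).
    by apply: ge1r_powR => //; rewrite invr_gt0 D0 /= invf_le1// exprn_ege1// lerDl.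
  rewrite /h -invfM lef_pV2 ?posrE ?mulr_gt0 ?ltr_pwDl ?sqr_ge0//.
  have X2 : x ^+ 2 <= cabs z ^+ 2 by rewrite sqr_cabs /= lerDl sqr_ge0.
  have Y2 : y ^+ 2 <= cabs z ^+ 2 by rewrite sqr_cabs /= lerDr sqr_ge0.
  have S : 1 + cabs z ^+ 2 <= (1 + cabs z) ^+ 2 by rewrite sqrrD expr1n mul1r lerD2r lerDl mulrn_wge0.
  rewrite (exprM _ 2 2) [leRHS]expr2.
  by apply: ler_pM; rewrite ?addr_ge0 ?sqr_ge0//; apply: le_trans S; rewrite lerD2l.
have -> : (\int[mu2]_xy (H xy)%:E = \int[mu]_x \int[mu]_y (H (x, y))%:E)%E.
  have mEH : measurable_fun setT (EFin \o H) by exact/measurable_EFinP.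
  have EH0 xy : (0 <= (EFin \o H) xy)%E by rewrite lee_fin.
  have FT := @fubini_tonelli1 _ _ _ _ R mu mu (EFin \o H) mEH EH0.
  exact: FT.
have -> : (fun x => \int[mu]_y (H (x, y))%:E)%E = (fun x => (K `^ p * pi * h x)%:E).
  apply/funext => x; rewrite /H /=.
  under eq_integral do rewrite mulrA EFinM.
  rewrite ge0_integralZl_EFin//; last 3 first.
  - by move=> y _; rewrite lee_fin ltW.
  - exact/measurable_EFinP.
  - by rewrite mulr_ge0 ?powR_ge0// ltW.
  by rewrite integral_inv_1Dsqr -EFinM mulrAC.
under eq_integral do rewrite EFinM.
rewrite ge0_integralZl_EFin//; last 3 first.
- by move=> y _; rewrite lee_fin ltW.
- exact/measurable_EFinP.
- by rewrite mulr_ge0 ?powR_ge0 ?pi_ge0.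
by rewrite integral_inv_1Dsqr -EFinM ltry.
Qed.

End Weighted.
End PlanarIntegral.

(** * Pointwise bounds by the Fock integral *)

Section PointEvaluation.
Variable R : realType.
Local Notation C := R[i].
Local Notation mu := (@lebesgue_measure R).
Local Notation mu2 := (@lebesgue_measure R \x @lebesgue_measure R)%E.
Implicit Types (F f : C -> C) (z w : C).

(** Otherwise the integral over [[u, v]] would be at least [2 J]; the factor 2 supplies the strict
    inequality. *)
Lemma exists_le_average (Phi : R -> \bar R) (u v J : R) : u < v -> 0 < J ->
  measurable_fun setT Phi -> (forall t, (0 <= Phi t)%E) ->
  (\int[mu]_t Phi t <= J%:E)%E ->
  exists2 t, u <= t <= v & (Phi t <= (2 * J / (v - u))%:E)%E.
Proof.
move=> uv J0 mPhi Phi0 HJ; apply: contrapT => H.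
have vu : 0 < v - u by rewrite subr_gt0.
have : ((2 * J)%:E <= \int[mu]_t Phi t)%E.
  apply: (@le_trans _ _ (\int[mu]_(t in `[u, v]) Phi t)%E); last first.
    by apply: ge0_subset_integral => //; exact: measurable_itv.
  have -> : ((2 * J)%:E = \int[mu]_(t in `[u, v]) (cst (2 * J / (v - u))%:E) t)%E.
    rewrite integral_cst; last exact: measurable_itv.
    by rewrite /= lebesgue_measure_itv /= lte_fin uv -EFinB -EFinM divfK// gt_eqF.
  apply: ge0_le_integral => //.
  - by move=> t _; rewrite lee_fin divr_ge0 ?mulr_ge0// ltW.
  - exact: measurable_funS mPhi.
  move=> t; rewrite /= in_itv /= => ht; rewrite leNgt; apply/negP => /ltW h.
  by apply: H; exists t.
move=> /le_trans /(_ HJ); rewrite lee_fin; lra.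
Qed.

(** Evaluates the bound of [ckernel_im_ge] on rectangles with both sides between [d] and [2 d]. *)
Lemma aspect_ratio (d p q : R) : 0 < d -> d <= p -> p <= 2 * d -> d <= q -> q <= 2 * d ->
  4^-1 <= 2 * p * q / (p ^+ 2 + q ^+ 2).
Proof.
move=> d0 p1 p2 q1 q2.
have D0 : 0 < p ^+ 2 + q ^+ 2 by rewrite addr_gt0// exprn_gt0//; lra.
rewrite ler_pdivlMr// mulrC ler_pdivrMr//.
have A1 : 0 <= p * (2 * q - p) by rewrite mulr_ge0//; lra.
have A2 : 0 <= q * (2 * p - q) by rewrite mulr_ge0//; lra.
have A3 : 0 <= p * q by rewrite mulr_ge0//; lra.
rewrite !expr2; lra.
Qed.

Lemma measurable_in_box (u v d : R) (g : R * R -> R) : measurable_fun [set: R * R] g ->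
  measurable_fun [set: R * R] (fun xy => if (`|xy.1 - u| <= d) && (`|xy.2 - v| <= d) then g xy else 0).
Proof.
move=> mg; apply: measurable_fun_ifT => //; apply: measurable_and.
  apply: measurable_fun_ler => //; apply: measurableT_comp => //.
  by apply: measurable_funB => //; exact: measurable_fst.
apply: measurable_fun_ler => //; apply: measurableT_comp => //.
by apply: measurable_funB => //; exact: measurable_snd.
Qed.

Definition box_dens f z0 (d : R) (xy : R * R) : R :=
  if (`|xy.1 - Re z0| <= d) && (`|xy.2 - Im z0| <= d) then cabs (f (xy.1 +i* xy.2)) else 0.

Lemma measurable_box_dens f z0 d : holo f -> measurable_fun [set: R * R] (box_dens f z0 d).
Proof.
by move=> hf; apply: measurable_in_box; apply: measurable_cabs => z; exact: holo_ccont.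
Qed.

(** Averaging selects two vertical and two horizontal lines, one in each outer quarter of the box,
    on which the integral of [|f|] inside the box is at most [4 J / d]. They bound a rectangle whose
    sides are between [d] and [2 d] long and at distance at least [d / 2] from [z0], so Cauchy's
    formula applies with a kernel of modulus at least [1/4]. *)
Lemma box_eval f z0 (d J : R) : holo f -> 0 < d -> 0 < J ->
  (\int[mu2]_xy (box_dens f z0 d xy)%:E <= J%:E)%E ->
  cabs (f z0) <= 256 * J / d ^+ 2.
Proof.
move=> hf d0 J0 HJ.
pose F (xy : R * R) := (box_dens f z0 d xy)%:E.
have mF : measurable_fun setT F by apply/measurable_EFinP; exact: measurable_box_dens.
have F0 xy : (0 <= F xy)%E.
  by rewrite lee_fin /box_dens; case: ifP => // _; exact: cabs_ge0.
have HX : (\int[mu]_x fubini_F mu F x <= J%:E)%E.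
  by rewrite -(@fubini_tonelli1 _ _ _ _ R mu mu F).
have HY : (\int[mu]_y fubini_G mu F y <= J%:E)%E.
  by rewrite -(@fubini_tonelli2 _ _ _ _ R mu mu F).
have mX : measurable_fun setT (fubini_F mu F) by exact: measurable_fun_fubini_tonelli_F.
have mY : measurable_fun setT (fubini_G mu F) by exact: measurable_fun_fubini_tonelli_G.
have X0 x : (0 <= fubini_F mu F x)%E by apply: integral_ge0.
have Y0 y : (0 <= fubini_G mu F y)%E by apply: integral_ge0.
have avg Phi (c : R) : measurable_fun setT Phi -> (forall t, (0 <= Phi t)%E) ->
    (\int[mu]_t Phi t <= J%:E)%E ->
    exists2 t : R, c <= t <= c + d / 2 & (Phi t <= (4 * J / d)%:E)%E.
  move=> m P0 HP; have cd : c < c + d / 2 by lra.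
  have [t ht Ht] := exists_le_average cd J0 m P0 HP.
  exists t => //; apply: le_trans Ht _; rewrite lee_fin addrAC subrr add0r.
  by apply: le_of_eq; field; rewrite gt_eqF.
pose a := Re z0; pose b := Im z0.
have [x0 hx0 Hx0] := avg _ (a - d) mX X0 HX.
have [x1 hx1 Hx1] := avg _ (a + d / 2) mX X0 HX.
have [y0 hy0 Hy0] := avg _ (b - d) mY Y0 HY.
have [y1 hy1 Hy1] := avg _ (b + d / 2) mY Y0 HY.
move/andP: hx0 => [hx01 hx02]; move/andP: hx1 => [hx11 hx12].
move/andP: hy0 => [hy01 hy02]; move/andP: hy1 => [hy11 hy12].
have ix : x0 < Re z0 < x1 by rewrite -/a; apply/andP; split; lra.
have iy : y0 < Im z0 < y1 by rewrite -/b; apply/andP; split; lra.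
have nl := strictly_inside_lines ix iy.
have df : diff_on_lines (fun z => f z * (z - z0)^-1) x0 x1 y0 y1.
  by apply: dolM; [exact: dol_entire|exact: dol_inv].
have [c1 c2 c3 c4] := dol_rcont df.
have far z : on_lines x0 x1 y0 y1 z -> d / 2 <= cabs (z - z0).
  by apply: on_lines_dist; rewrite -/a -/b; lra.
have bnd z : on_lines x0 x1 y0 y1 z -> cabs (f z * (z - z0)^-1) <= 2 / d * cabs (f z).
  move=> /far h; rewrite cabsM cabsV mulrC ler_wpM2r ?cabs_ge0//.
  have -> : 2 / d = (d / 2)^-1 by rewrite invf_div.
  by rewrite lef_pV2// posrE; lra.
have side (g : R -> C) (k : R -> R) (u v : R) (G : \bar R) : u <= v -> (forall t, rcont g t) ->
    measurable_fun setT k -> (forall t, 0 <= k t) ->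
    (forall t, u <= t <= v -> cabs (g t) <= 2 / d * k t) ->
    (\int[mu]_t (k t)%:E <= (4 * J / d)%:E)%E -> cabs (cint g u v) <= 2 / d * (4 * J / d).
  move=> uv cg mk k0 hg hG.
  have := cint_le_Rintegral uv cg.
  have mg : measurable_fun setT (fun t => cabs (g t)).
    by apply: continuous_measurable_fun; exact: rcont_continuous_cabs.
  have d2 : 0 <= 2 / d by rewrite divr_ge0// ltW.
  have : (\int[mu]_(t in `[u, v]) (cabs (g t))%:E <= (2 / d)%:E * \int[mu]_t (k t)%:E)%E.
    rewrite -ge0_integralZl_EFin//; last 2 first.
    - by move=> t _; rewrite lee_fin k0.
    - exact/measurable_EFinP.
    apply: (@le_trans _ _ (\int[mu]_(t in `[u, v]) ((2 / d)%:E * (k t)%:E)%E)%E).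
      apply: ge0_le_integral => //.
      - by move=> t _; rewrite lee_fin cabs_ge0.
      - by apply/measurable_EFinP; exact: measurable_funS mg.
      - by apply: measurable_funeM; apply/measurable_EFinP; exact: measurable_funS mk.
    apply: ge0_subset_integral => //.
    - by apply: measurable_funeM; exact/measurable_EFinP.
    - by move=> t _; rewrite mule_ge0// lee_fin.
  move=> h1 h2; have := le_trans h2 (le_trans h1 (lee_wpmul2l _ hG)).
  by rewrite lee_fin -EFinM lee_fin; apply.
have mh y : measurable_fun setT (fun x => box_dens f z0 d (x, y)).
  exact: (measurableT_comp (measurable_box_dens z0 d hf) (measurable_pair2 y)).
have mv x : measurable_fun setT (fun y => box_dens f z0 d (x, y)).
  exact: (measurableT_comp (measurable_box_dens z0 d hf) (measurable_pair1 x)).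
have bp xy : 0 <= box_dens f z0 d xy by rewrite -lee_fin; exact: F0.
have bdE s t : x0 <= s <= x1 -> y0 <= t <= y1 -> box_dens f z0 d (s, t) = cabs (f (s +i* t)).
  move=> /andP[s0 s1] /andP[t0 t1]; rewrite /box_dens /= ifT// -/a -/b.
  by apply/andP; split; rewrite ler_norml; apply/andP; split; lra.
have ol s t : (t == y0) || (t == y1) || (s == x0) || (s == x1) -> on_lines x0 x1 y0 y1 (s +i* t).
  by rewrite /on_lines /= -!orbA.
have xx : x0 <= x1 by lra. have yy : y0 <= y1 by lra.
have SH y : (y == y0) || (y == y1) ->
    cabs (cint (fun t => f (t +i* y) * (t +i* y - z0)^-1) x0 x1) <= 2 / d * (4 * J / d).
  move=> hy; apply: (side _ (fun x => box_dens f z0 d (x, y))) => //.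
  - exact: 0%E.
  - by case/orP: hy => /eqP ->.
  - move=> t ht; rewrite bdE//; first by apply: bnd; apply: ol; rewrite hy.
    by case/orP: hy => /eqP ->; rewrite ?lexx ?yy.
  - by case/orP: hy => /eqP ->.
have SV x : (x == x0) || (x == x1) ->
    cabs (cint (fun t => f (x +i* t) * (x +i* t - z0)^-1) y0 y1) <= 2 / d * (4 * J / d).
  move=> hx; apply: (side _ (fun y => box_dens f z0 d (x, y))) => //.
  - exact: 0%E.
  - by case/orP: hx => /eqP ->.
  - move=> t ht; rewrite bdE//; first by apply: bnd; apply: ol; rewrite -orbA hx !orbT.
    by case/orP: hx => /eqP ->; rewrite ?lexx ?xx.
  - by case/orP: hx => /eqP ->.
have I4 : 4^-1 <= cabs (ckernel z0 x0 x1 y0 y1).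
  apply: le_trans (le_trans (ler_norm _) (normr_Im_le _)).
  apply: le_trans (ckernel_im_ge ix iy).
  set p := x1 - x0; set q := y1 - y0.
  have p1 : d <= p by rewrite /p; lra. have p2 : p <= 2 * d by rewrite /p; lra.
  have q1 : d <= q by rewrite /q; lra. have q2 : q <= 2 * d by rewrite /q; lra.
  exact: (@aspect_ratio d).
have T : cabs (f z0) * cabs (ckernel z0 x0 x1 y0 y1) <= 4 * (2 / d * (4 * J / d)).
  rewrite -cabsM -(cauchy_formula hf ix iy) /rint.
  move: (SH y0) (SH y1) (SV x0) (SV x1); rewrite !eqxx !orbT => /(_ isT) + /(_ isT) + /(_ isT) + /(_ isT).
  set A := cint _ _ _; set B := cint _ _ _; set D := cint _ _ _; set E := cint _ _ _.
  move=> hA hB hD hE.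
  have := cabsD A ('i%C * E); have := cabsB (A + 'i%C * E) B.
  have := cabsB (A + 'i%C * E - B) ('i%C * D).
  by rewrite !cabsM !cabs_i !mul1r; lra.
have := ler_wpM2l (cabs_ge0 (f z0)) I4.
have -> : 256 * J / d ^+ 2 = 8 * (4 * (2 / d * (4 * J / d))) by field; rewrite gt_eqF.
move: T; set X := _ * cabs (ckernel _ _ _ _ _); set Y := 2 / d * _.
have : 0 <= Y by rewrite mulr_ge0 ?divr_ge0 ?mulr_ge0 ?(ltW d0) ?(ltW J0).
lra.
Qed.

Lemma powR_ge1 (x s : R) : 1 <= x -> 0 <= s -> 1 <= x `^ s.
Proof. by move=> x1 s0; rewrite -[leLHS](powRr0 x) ler_powR. Qed.

(** Takes the place of Hoelder's inequality in passing from [|f|^p] to [|f|]: beyond [lam],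
    [x = x^(1-p) x^p] and [x^(1-p) <= lam^(1-p)]. *)
Lemma le_add_powR (p lam x : R) : 1 <= p -> 0 < lam -> 0 <= x ->
  x <= lam + lam `^ (1 - p) * x `^ p.
Proof.
move=> p1 l0 x0; have [xl|lx] := leP x lam.
  by apply: le_trans xl _; rewrite lerDl mulr_ge0 ?powR_ge0.
apply: (@le_trans _ _ (lam `^ (1 - p) * x `^ p)); last by rewrite lerDr ltW.
have xp : 0 < x by exact: lt_trans lx.
have -> : 1 - p = - (p - 1) by ring.
rewrite powRN mulrC ler_pdivlMr ?powR_gt0//.
rewrite -[X in _ <= X](@mulr_powRB1 _ x p)//; last by lra.
by rewrite ler_wpM2l//; apply: ge0_ler_powR; rewrite ?nnegrE ?subr_ge0// ltW.
Qed.

Lemma expR_le_quad (y : R) : 0 <= y -> expR y <= 1 + y * expR y.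
Proof.
move=> y0; have := expR_ge1Dx (- y); rewrite expRN => h.
have e0 := expR_gt0 y; have := ler_wpM2r (ltW e0) h; rewrite mulVf ?gt_eqF//; lra.
Qed.

(** The derivative of [r^alpha] grows like [r^(alpha-1)], so steps of size [(1 + r)^(-alpha)] change
    [r^alpha] by a bounded amount. For [r <= 1] the radius [x] is at most 3; for larger [r],
    [1 + s <= exp s] is applied to the ratio of the radii. *)
Lemma powR_shift_le (alpha r x : R) : 1 <= alpha -> 0 <= r -> 0 <= x ->
  x <= r + 2 * (1 + r) `^ (- alpha) ->
  x `^ alpha <= r `^ alpha + (3 `^ alpha + 2 * alpha * expR (2 * alpha)).
Proof.
move=> al r0 x0 hx; have al0 : 0 < alpha by lra.
have q0 : 0 <= 2 * alpha * expR (2 * alpha) by rewrite !mulr_ge0 ?expR_ge0//; lra.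
have d1 : (1 + r) `^ (- alpha) <= 1.
  by rewrite powRN invf_le1 ?powR_gt0 ?powR_ge1//; lra.
set d := _ `^ (- alpha) in hx d1; have d0 : 0 <= d by exact: powR_ge0.
have [r1|r1] := leP r 1.
  apply: (@le_trans _ _ (3 `^ alpha)).
    by apply: ge0_ler_powR; rewrite ?nnegrE //; lra.
  have := powR_ge0 r alpha; lra.
have rp : 0 < r by lra.
apply: (@le_trans _ _ (r `^ alpha + 2 * alpha * expR (2 * alpha))); last first.
  by have := powR_ge0 (3 : R) alpha; lra.
have E : r + 2 * d = r * (1 + 2 * d / r) by field; rewrite gt_eqF.
have u0 : 0 <= 2 * d / r by rewrite divr_ge0 ?mulr_ge0.
apply: (@le_trans _ _ ((r * (1 + 2 * d / r)) `^ alpha)).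
  by apply: ge0_ler_powR; rewrite ?nnegrE -?E//; lra.
rewrite powRM//; last by lra.
pose y := 2 * d / r * alpha; have y0 : 0 <= y by rewrite mulr_ge0//; lra.
have y2 : y <= 2 * alpha.
  rewrite /y ler_wpM2r//; first lra.
  by rewrite ler_pdivrMr//; lra.
have H1 : (1 + 2 * d / r) `^ alpha <= expR y.
  rewrite /y expRM; apply: ge0_ler_powR; rewrite ?nnegrE ?expR_ge0//; try lra.
  exact: expR_ge1Dx.
have H2 : expR y <= 1 + y * expR (2 * alpha).
  by apply: le_trans (expR_le_quad y0) _; rewrite lerD2l ler_wpM2l// ler_expR.
have rd : r `^ alpha * d <= 1.
  rewrite /d powRN ler_pdivrMr ?powR_gt0//; last by lra.
  by rewrite mul1r; apply: ge0_ler_powR; rewrite ?nnegrE; lra.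
apply: le_trans (ler_wpM2l (powR_ge0 _ _) (le_trans H1 H2)) _.
rewrite mulrDr mulr1 lerD2l mulrA ler_wpM2r ?expR_ge0//.
have -> : r `^ alpha * y = 2 * alpha * ((r `^ alpha * d) / r) by rewrite /y; field; rewrite gt_eqF.
rewrite -[leRHS]mulr1 ler_wpM2l//; first lra.
by rewrite ler_pdivrMr//; lra.
Qed.

Lemma integral_box_cst (u v d lam : R) : 0 < d -> 0 <= lam ->
  (\int[mu2]_xy (if (`|xy.1 - u| <= d) && (`|xy.2 - v| <= d) then lam else 0)%:E
    = (lam * (2 * d * (2 * d)))%:E)%E.
Proof.
move=> d0 l0.
pose D : set (R * R) := (`[u - d, u + d] : set R) `*` (`[v - d, v + d] : set R).
have mD : measurable D by apply: measurableX; exact: measurable_itv.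
have mI (w : R) : mu `[w - d, w + d] = (2 * d)%:E.
  rewrite lebesgue_measure_itv /= lte_fin ifT; last by lra.
  by rewrite -EFinB; congr _%:E; ring.
have -> : (\int[mu2]_xy (if (`|xy.1 - u| <= d) && (`|xy.2 - v| <= d) then lam else 0)%:E
    = \int[mu2]_xy (lam%:E * (\1_D xy)%:E))%E.
  apply: eq_integral => -[x y] _ /=; rewrite indicE -EFinM; congr _%:E.
  have -> : ((x, y) \in D) = (`|x - u| <= d) && (`|y - v| <= d).
    rewrite !ler_norml; apply/idP/idP; rewrite inE /D /= !in_itv /=.
      by move=> [/andP[? ?] /andP[? ?]]; apply/andP; split; apply/andP; split; lra.
    by move=> /andP[/andP[? ?] /andP[? ?]]; split; apply/andP; split; lra.
  by case: (_ && _); rewrite ?mulr1 ?mulr0.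
rewrite ge0_integralZl_EFin//; last first.
  by apply/measurable_EFinP; exact: measurable_indic.
have mA : measurable (`[u - d, u + d] : set R) by exact: measurable_itv.
have mB : measurable (`[v - d, v + d] : set R) by exact: measurable_itv.
rewrite integral_indic// setIT /D.
rewrite EFinM; congr (_ * _)%E.
apply: (eq_trans (@product_measure1E _ _ _ _ R mu mu _ _ mA mB)).
by rewrite EFinM; congr (_ * _)%E; exact: mI.
Qed.

(** The box has half-side [(1 + |z|)^(-alpha)], small enough for the Fock weight to be constant on
    it up to a factor; dividing by its area produces the power [2 alpha]. *)
Lemma point_eval (p alpha a : R) : 1 <= p -> 1 <= alpha -> 0 < a ->
  exists2 K : R, 0 < K & forall (f : C -> C) (L : R), holo f -> 0 < L ->
  (fock_int p alpha a f <= L%:E)%E -> forall z,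
  cabs (f z) <= K * (1 + cabs z) `^ (2 * alpha) * (expR (a / p * cabs z `^ alpha) * L `^ p^-1).
Proof.
move=> p1 alpha1 a0.
pose c := 3 `^ alpha + 2 * alpha * expR (2 * alpha).
have p0 : 0 < p by lra.
have E0 : 0 < expR (a * c) by exact: expR_gt0.
exists (256 * (4 + expR (a * c))) => [|f L hf L0 HL z]; first by rewrite mulr_gt0//; lra.
set r := cabs z; have r0 : 0 <= r by exact: cabs_ge0.
(* Balances the two terms of [le_add_powR]: since [lam^p = expR (a r^alpha) L], the term with
   [lam^(1-p)] integrates to a constant times [lam] as well. *)
pose lam := expR (a / p * r `^ alpha) * L `^ p^-1.
have lam0 : 0 < lam by rewrite mulr_gt0 ?expR_gt0 ?powR_gt0.
have lamp : lam `^ p = expR (a * r `^ alpha) * L.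
  rewrite powRM ?expR_ge0 ?powR_ge0// -expRM -powRrM mulVf ?gt_eqF// powRr1 ?(ltW L0)//.
  by congr (expR _ * _); field; rewrite gt_eqF.
pose d := (1 + r) `^ (- alpha); have d0 : 0 < d by rewrite powR_gt0//; lra.
pose J := lam * (4 * d ^+ 2 + expR (a * c)).
have J0 : 0 < J by rewrite mulr_gt0// addr_gt0// mulr_gt0// exprn_gt0.
have cf w : ccont f w by exact: holo_ccont.
have HJ : (\int[mu2]_xy (box_dens f z d xy)%:E <= J%:E)%E.
  pose k1 (xy : R * R) : R := if (`|xy.1 - Re z| <= d) && (`|xy.2 - Im z| <= d) then lam else 0.
  pose k := lam `^ (1 - p) * expR (a * (r `^ alpha + c)).
  have k0 : 0 <= k by rewrite mulr_ge0 ?powR_ge0 ?expR_ge0.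
  have mk1 : measurable_fun [set: R * R] k1 by exact: (measurable_in_box _ _ _ (measurable_cst lam)).
  have md := measurable_fock_dens p alpha a cf.
  have k10 xy : 0 <= k1 xy by rewrite /k1; case: ifP => // _; exact: ltW.
  apply: (@le_trans _ _ (\int[mu2]_xy ((k1 xy)%:E + k%:E * (fock_dens p alpha a f xy)%:E))%E).
    apply: ge0_le_integral => //.
    - by move=> xy _; rewrite lee_fin /box_dens; case: ifP => // _; exact: cabs_ge0.
    - by apply/measurable_EFinP; exact: measurable_box_dens.
    - apply: emeasurable_funD; first exact/measurable_EFinP.
      by apply: measurable_funeM; exact/measurable_EFinP.
    move=> [x y] _; rewrite -EFinM -EFinD lee_fin /box_dens /k1 /=.
    case: ifP => [/andP[hx hy]|_]; last by rewrite add0r mulr_ge0 ?fock_dens_ge0.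
    rewrite /fock_dens /= -!/(cabs _); set w := x +i* y.
    have wz : cabs w <= r + 2 * d.
      have := cabsD (w - z) z; rewrite subrK => h; apply: le_trans h _; rewrite addrC lerD2l.
      apply: le_trans (cabs_le_ReIm _) _; rewrite reD imD reN imN /=; lra.
    have := powR_shift_le alpha1 r0 (cabs_ge0 w) wz; rewrite -/c => W.
    apply: le_trans (le_add_powR p1 lam0 (cabs_ge0 _)) _; rewrite lerD2l /k.
    have -> : lam `^ (1 - p) * expR (a * (r `^ alpha + c)) * (cabs (f w) `^ p * expR (- (a * cabs w `^ alpha)))
      = lam `^ (1 - p) * cabs (f w) `^ p * expR (a * (r `^ alpha + c) - a * cabs w `^ alpha).
      by rewrite expRD; ring.
    rewrite -[X in X <= _]mulr1 ler_wpM2l ?mulr_ge0 ?powR_ge0// -expR0 ler_expR.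
    by rewrite -mulrBr mulr_ge0 ?(ltW a0)// subr_ge0.
  rewrite ge0_integralD//; last 4 first.
  - by move=> xy _; rewrite lee_fin.
  - exact/measurable_EFinP.
  - by move=> xy _; rewrite -EFinM lee_fin mulr_ge0 ?fock_dens_ge0.
  - by apply: measurable_funeM; exact/measurable_EFinP.
  rewrite integral_box_cst ?(ltW lam0)// ge0_integralZl_EFin//; last 2 first.
  - by move=> xy _; rewrite lee_fin fock_dens_ge0.
  - exact/measurable_EFinP.
  rewrite -/(fock_int p alpha a f).
  have k0E : (0 <= k%:E)%E by rewrite lee_fin.
  apply: le_trans (leeD2l _ (lee_wpmul2l k0E HL)) _.
  rewrite -EFinM -EFinD lee_fin /J /k mulrDr expRD; apply: le_of_eq.
  have -> : lam * (4 * d ^+ 2 + expR (a * c)) = lam * (2 * d * (2 * d)) + lam * expR (a * c) by ring.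
  congr (_ + _).
  have -> : lam `^ (1 - p) * (expR (a * r `^ alpha) * expR (a * c)) * L
     = lam `^ (1 - p) * lam `^ p * expR (a * c) by rewrite lamp; ring.
  rewrite -powRD; last by apply/implyP => _; rewrite gt_eqF.
  by rewrite subrK powRr1// ltW.
have := box_eval hf d0 J0 HJ; rewrite -/r => H; apply: le_trans H _.
have D2 : d ^- 2 = (1 + r) `^ (2 * alpha).
  rewrite /d -powR_mulrn ?powR_ge0// -powRrM -powRN; congr (_ `^ _); ring.
have G1 : 1 <= d ^- 2.
  by rewrite D2 powR_ge1//; lra.
rewrite -D2 /J -/lam.
have -> : 256 * (lam * (4 * d ^+ 2 + expR (a * c))) / d ^+ 2
   = 256 * lam * (4 + expR (a * c) * d ^- 2) by field; rewrite gt_eqF.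
have -> : 256 * (4 + expR (a * c)) * d ^- 2 * lam = 256 * lam * (4 * d ^- 2 + expR (a * c) * d ^- 2).
  by ring.
apply: ler_wpM2l; first by rewrite mulr_ge0// ltW.
by rewrite lerD2r; move: G1; clear; lra.
Qed.

End PointEvaluation.

(** * Decay in the small sector and its uniform version *)

Section SectorDecay.
Variable R : realType.
Local Notation C := R[i].
Implicit Types (f g : C -> C) (u v : R).

(* In the coordinate [w = u +i* v] with [z = exp w], this is
   exp (b z^alpha - z^(alpha/2)), free of any branch of the powers. *)
Definition weight (alpha b : R) (w : C) : C :=
  cexp (b%:C * cexp (alpha%:C * w) - cexp ((alpha / 2)%:C * w)).

Definition lifted (alpha b : R) f (w : C) : C := f (cexp w) * weight alpha b w.

Lemma cabs_weight alpha b u v : cabs (weight alpha b (u +i* v)) =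
  expR (b * (expR (alpha * u) * cos (alpha * v)) - expR (alpha / 2 * u) * cos (alpha / 2 * v)).
Proof.
rewrite /weight cabs_cexp; congr expR.
by rewrite reD reN (reZl b) !reCexp (reZl alpha) (imZl alpha) (reZl (alpha / 2)) (imZl (alpha / 2)).
Qed.

Lemma holo_lifted alpha b f : holo f -> holo (lifted alpha b f).
Proof.
move=> hf; have hl (c : C) : holo (fun w => c * w) by apply: holoZ; exact: holo_id.
apply: holoM; first by apply: holo_comp hf; apply: holo_cexp; exact: holo_id.
apply: holo_cexp; apply: holoB; last by apply: holo_cexp; exact: hl.
by apply: holoZ; apply: holo_cexp; exact: hl.
Qed.

Lemma cabs_cexp_uv u v : cabs (cexp (u +i* v)) = expR u.
Proof. by rewrite cabs_cexp. Qed.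

(** [expR (N * u)] is [|z|^N] for [|z| = expR u >= 1]. [K] and [N] may depend on [f];
    [uniform_sector_bound] makes up for this. *)
Definition sector_bounded (alpha b : R) f := exists K N : R, forall u v, 0 <= u ->
  `|v| <= pi / (4 * alpha) -> cabs (lifted alpha b f (u +i* v)) <= K * expR (N * u).

Lemma expR_le_mono (N N' u : R) : 0 <= u -> N <= N' -> expR (N * u) <= expR (N' * u).
Proof. by move=> u0 NN; rewrite ler_expR ler_wpM2r. Qed.

Lemma sector_bounded_pos (alpha b : R) f : sector_bounded alpha b f -> exists K N : R, [/\ 0 < K, 0 <= N &
  forall u v, 0 <= u -> `|v| <= pi / (4 * alpha) ->
    cabs (lifted alpha b f (u +i* v)) <= K * expR (N * u)].
Proof.
move=> [K [N H]]; exists (`|K| + 1), `|N|; split => // u v u0 hv; apply: le_trans (H u v u0 hv) _.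
apply: (@le_trans _ _ (`|K| * expR (N * u))).
  by rewrite ler_wpM2r ?expR_ge0// ler_norm.
apply: ler_pM; rewrite ?expR_ge0//; first by rewrite lerDl.
by apply: expR_le_mono => //; exact: ler_norm.
Qed.

Lemma sector_bounded_lincomb (alpha b : R) (c : C) f g :
  sector_bounded alpha b f -> sector_bounded alpha b g ->
  sector_bounded alpha b (fun z => c * f z + g z).
Proof.
move=> /sector_bounded_pos[K1 [N1 [k1 n1 H1]]] /sector_bounded_pos[K2 [N2 [k2 n2 H2]]].
exists (cabs c * K1 + K2), (N1 + N2) => u v u0 hv.
have -> : lifted alpha b (fun z => c * f z + g z) (u +i* v)
  = c * lifted alpha b f (u +i* v) + lifted alpha b g (u +i* v) by rewrite /lifted; ring.
apply: le_trans (cabsD _ _) _; rewrite cabsM mulrDl; apply: lerD.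
  rewrite -mulrA ler_wpM2l ?cabs_ge0//; apply: le_trans (H1 _ _ u0 hv) _.
  by rewrite ler_wpM2l ?(ltW k1)//; apply: expR_le_mono => //; rewrite lerDl.
apply: le_trans (H2 _ _ u0 hv) _.
by rewrite ler_wpM2l ?(ltW k2)//; apply: expR_le_mono => //; rewrite lerDr.
Qed.

Lemma holo_bounded g (r : R) : holo g ->
  exists2 M : R, 0 < M & forall z : C, cabs z <= r -> cabs (g z) <= M.
Proof.
move=> hg; pose T := `|r| + 1.
have T0 : 0 < T by rewrite ltr_pwDr.
have [M M0 HM] := dol_bounded (dol_entire (x0 := - T) (x1 := T) (y0 := - T) (y1 := T) hg).
exists M => // z zr.
have zT : cabs z < T by apply: le_lt_trans zr _; rewrite /T ltr_pwDr// ler_norm.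
have hr : - T < Re z < T by rewrite -ltr_norml; exact: le_lt_trans (normr_Re_le z) zT.
have hi : - T < Im z < T by rewrite -ltr_norml; exact: le_lt_trans (normr_Im_le z) zT.
exact: (maximum_principle hr hi hg HM).
Qed.

Lemma cos_half_ge0 (alpha : R) (al1 : 1 <= alpha) v : `|v| <= pi / alpha -> 0 <= cos (alpha / 2 * v).
Proof.
have al0 : 0 < alpha := lt_le_trans ltr01 al1.
move=> hv; have pi0 := pi_gt0 R.
have : `|alpha / 2 * v| <= pi / 2.
  rewrite normrM gtr0_norm ?divr_gt0//.
  have h : alpha * `|v| <= pi by rewrite mulrC -ler_pdivlMr.
  by clear - h; lra.
move=> h; rewrite -(cos_pihalf R); apply: cos_ge_of_norm_le => //; lra.
Qed.

(** For [|v| <= pi / alpha] the real part of [z^(alpha/2)] is nonnegative, so the second exponential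
    only helps. *)
Lemma cabs_weight_le (alpha b : R) (al1 : 1 <= alpha) (b0 : 0 < b) u v : `|v| <= pi / alpha ->
  cabs (weight alpha b (u +i* v)) <= expR (b * expR (alpha * u)).
Proof.
move=> hv; rewrite cabs_weight ler_expR.
apply: (@le_trans _ _ (b * (expR (alpha * u) * cos (alpha * v)))).
  by rewrite gerBl mulr_ge0 ?expR_ge0// (cos_half_ge0 al1).
by rewrite ler_wpM2l ?(ltW b0)// -[leRHS]mulr1 ler_wpM2l ?expR_ge0// cos_le1.
Qed.

Lemma quarter_le (alpha : R) (al1 : 1 <= alpha) : pi / (4 * alpha) <= pi / alpha.
Proof.
have al0 : 0 < alpha := lt_le_trans ltr01 al1.
rewrite ler_wpM2l ?pi_ge0// lef_pV2 ?posrE ?mulr_gt0//.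
by rewrite ler_peMl ?(ltW al0)// ler1n.
Qed.

(** Where [|z| > |w0| + 1] the divisor has modulus at least 1 and the bound of [f] passes to [g]; on
    the remaining disc everything is bounded. *)
Lemma sector_bounded_divide (alpha b : R) (al1 : 1 <= alpha) (b0 : 0 < b) f g (w0 : C) :
  holo g -> (forall z, f z = (z - w0) * g z) ->
  sector_bounded alpha b f -> sector_bounded alpha b g.
Proof.
have al0 : 0 < alpha := lt_le_trans ltr01 al1.
move=> hg E /sector_bounded_pos[K [N [K0 N0 H]]].
pose r := cabs w0 + 1.
have [M M0 HM] := holo_bounded r hg.
exists (K + M * expR (b * r `^ alpha)), N => u v u0 hv.
have hv' := le_trans hv (quarter_le al1).
have e1 : 1 <= expR (N * u) by rewrite -expR0 ler_expR mulr_ge0.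
have p1 : 0 <= M * expR (b * r `^ alpha) by rewrite mulr_ge0 ?expR_ge0 ?ltW.
rewrite mulrDl; have [ur|ur] := leP (expR u) r.
  apply: (@le_trans _ _ (M * expR (b * r `^ alpha))).
    rewrite /lifted cabsM; apply: ler_pM; rewrite ?cabs_ge0//.
      by apply: HM; rewrite cabs_cexp_uv.
    apply: le_trans (cabs_weight_le al1 b0 u hv') _; rewrite ler_expR ler_wpM2l ?(ltW b0)//.
    rewrite mulrC expRM; apply: ge0_ler_powR; rewrite ?nnegrE ?expR_ge0 ?(ltW al0)//.
    exact: le_trans (expR_ge0 u) ur.
  apply: (@le_trans _ _ (M * expR (b * r `^ alpha) * expR (N * u))).
    by rewrite -[leLHS]mulr1 ler_wpM2l.
  by rewrite lerDr mulr_ge0 ?expR_ge0 ?ltW.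
apply: (@le_trans _ _ (K * expR (N * u))); last by rewrite lerDl mulr_ge0 ?expR_ge0.
apply: le_trans (H _ _ u0 hv); rewrite /lifted E.
rewrite 2!(cabsM _ (weight alpha b (u +i* v))) (cabsM (_ - _)); apply: ler_wpM2r; first exact: cabs_ge0.
rewrite -[leLHS]mul1r; apply: ler_wpM2r; first exact: cabs_ge0.
have := cabsD (cexp (u +i* v) - w0) w0; rewrite subrK cabs_cexp_uv.
by move: ur; rewrite /r; clear; lra.
Qed.

(** Gathers all constants into the single one of the a priori hypothesis of [phragmen_lindelof]; the
    power factor is absorbed by [N u <= (N / L) expR (L u)]. *)
Lemma le_double_exp (A B L N u : R) : 0 < A -> 0 <= B -> 0 < L -> 0 <= N -> 0 <= u ->
  A * (expR (N * u) * expR (B * expR (L * u)))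
  <= (A + B + N / L) * expR ((A + B + N / L) * expR (L * u)).
Proof.
move=> A0 B0 L0 N0 u0; have NL : 0 <= N / L by rewrite divr_ge0// ltW.
rewrite -expRD; apply: ler_pM; rewrite ?expR_ge0 ?(ltW A0)//; first by rewrite -addrA lerDl addr_ge0.
rewrite ler_expR.
have e1 : L * u <= expR (L * u) by have := expR_ge1Dx (L * u); lra.
have := ler_wpM2l NL e1; have -> : N / L * (L * u) = N * u by field; rewrite gt_eqF.
have : 0 <= A * expR (L * u) by rewrite mulr_ge0 ?expR_ge0 ?ltW.
by clear; lra.
Qed.

(* The Phragmen-Lindelof step: an a priori bound of Fock type and any polynomial
   bound in the small sector give a uniform polynomial bound in the sector of
   opening 2 pi / alpha, on whose edges [weight] exactly compensates the Fock growth. *)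
Lemma uniform_sector_bound (alpha b : R) (al1 : 1 <= alpha) (b0 : 0 < b) f (A : R) : holo f -> 0 < A ->
  (forall z, cabs (f z) <= A * (1 + cabs z) `^ (2 * alpha) * expR (b * cabs z `^ alpha)) ->
  sector_bounded alpha b f ->
  forall u v, 0 <= u -> `|v| <= pi / alpha ->
    cabs (lifted alpha b f (u +i* v)) <=
      A * 2 `^ (2 * alpha) * expR (2 * b) * expR (2 * alpha * u).
Proof.
have al0 : 0 < alpha := lt_le_trans ltr01 al1.
move=> hf A0 Hf /sector_bounded_pos[K [N [K0 N0 HK]]].
have pi0 := pi_gt0 R.
pose A2 := A * 2 `^ (2 * alpha).
have A20 : 0 < A2 by rewrite mulr_gt0 ?powR_gt0.
have Hfu u v : 0 <= u -> cabs (f (cexp (u +i* v))) <=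
    A2 * (expR (2 * alpha * u) * expR (b * expR (alpha * u))).
  move=> u0; apply: le_trans (Hf _) _; rewrite cabs_cexp_uv -expRM [u * _]mulrC /A2.
  rewrite mulrA ler_wpM2r ?expR_ge0// -!mulrA ler_wpM2l ?(ltW A0)//.
  have -> : 2 * (alpha * u) = u * (2 * alpha) by ring.
  rewrite expRM -powRM ?expR_ge0//; apply: ge0_ler_powR;
    rewrite ?nnegrE ?addr_ge0 ?mulr_ge0 ?expR_ge0 ?(ltW al0)//.
  by rewrite mulrDl mul1r lerD2r -expR0 ler_expR.
pose K2 := A2 * expR (2 * b).
have K20 : 0 < K2 by rewrite mulr_gt0 ?expR_gt0.
have left v : `|v| <= pi / alpha -> cabs (lifted alpha b f (0 +i* v)) <= K2.
  move=> hv; have := Hfu 0 v (lexx _); rewrite !mulr0 expR0 mul1r mulr1 => h1.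
  have := cabs_weight_le al1 b0 0 hv; rewrite mulr0 expR0 mulr1 => h2.
  rewrite /lifted cabsM; apply: le_trans (ler_pM (cabs_ge0 _) (cabs_ge0 _) h1 h2) _.
  by rewrite -mulrA -expRD /K2 (_ : b + b = 2 * b)//; ring.
have A2K2 : A2 <= K2 by rewrite /K2 -[leLHS]mulr1 ler_wpM2l ?(ltW A20)// -expR0 ler_expR mulr_ge0// ltW.
have edge u v : 0 <= u -> `|v| = pi / alpha ->
    cabs (lifted alpha b f (u +i* v)) <= K2 * expR (2 * alpha * u).
  move=> u0 hv; rewrite /lifted cabsM.
  have av : `|alpha * v| = pi by rewrite normrM hv gtr0_norm// mulrC divfK// gt_eqF.
  have cosn (x : R) : cos x = cos `|x| by have [//|x0] := ger0P x; rewrite cosN.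
  have c1 : cos (alpha * v) = -1 by rewrite cosn av cospi.
  have c2 : cos (alpha / 2 * v) = 0.
    rewrite cosn (_ : alpha / 2 * v = (alpha * v) / 2); last by ring.
    by rewrite normrM av gtr0_norm ?invr_gt0// cos_pihalf.
  rewrite cabs_weight c1 c2 mulr0 subr0 mulrN1.
  apply: le_trans (ler_wpM2r (expR_ge0 _) (Hfu u v u0)) _.
  set X := expR (alpha * u).
  have -> : A2 * (expR (2 * alpha * u) * expR (b * X)) * expR (b * - X)
    = A2 * expR (2 * alpha * u) * (expR (b * X) * expR (b * - X)) by ring.
  by rewrite -expRD mulrN subrr expR0 mulr1 ler_wpM2r ?expR_ge0.
have apriori u v : 0 <= u -> `|v| <= pi / alpha -> cabs (lifted alpha b f (u +i* v)) <=
    A2 * (expR (2 * alpha * u) * expR (2 * b * expR (alpha * u))).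
  move=> u0 hv; rewrite /lifted cabsM.
  apply: le_trans (ler_pM (cabs_ge0 _) (cabs_ge0 _) (Hfu u v u0) (cabs_weight_le al1 b0 u hv)) _.
  set X := expR (alpha * u).
  have -> : A2 * (expR (2 * alpha * u) * expR (b * X)) * expR (b * X)
    = A2 * (expR (2 * alpha * u) * (expR (b * X) * expR (b * X))) by ring.
  by rewrite -expRD (_ : b * X + b * X = 2 * b * X)//; ring.
pose K3 := K + K2. pose N3 := N + 2 * alpha.
have N30 : 0 <= N3 by rewrite /N3 addr_ge0// mulr_ge0// ltW.
have K30 : 0 < K3 by rewrite addr_gt0.
have up (k n u : R) : 0 <= u -> 0 <= k -> k <= K3 -> n <= N3 -> k * expR (n * u) <= K3 * expR (N3 * u).
  by move=> u0 k0 kk nn; apply: ler_pM; rewrite ?expR_ge0//; exact: expR_le_mono.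
have KK3 : K <= K3 by rewrite lerDl ltW.
have K2K3 : K2 <= K3 by rewrite lerDr ltW.
have NN3 : N <= N3 by rewrite lerDl mulr_ge0// ltW.
have aN3 : 2 * alpha <= N3 by rewrite lerDr.
have q1 : pi / (4 * alpha) = (pi / alpha) / 4 by field; rewrite gt_eqF.
have pa0 : 0 < pi / alpha by rewrite divr_gt0.
(* In units of [pi / alpha] the lateral strips have centres [5/8] and [- 5/8] and half-width [3/8];
   order [alpha] is below critical there, as [3 pi / 8 < pi / 2]. *)
have lh : alpha * (3 / 8 * (pi / alpha)) < pi / 2.
  have -> : alpha * (3 / 8 * (pi / alpha)) = 3 / 8 * pi by field; rewrite gt_eqF.
  by clear - pi0; lra.
pose AA := A2 + 2 * b + 2 * alpha / alpha.
have AA0 : 0 < AA by rewrite !addr_gt0 ?mulr_gt0 ?invr_gt0.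
have h30 : 0 < 3 / 8 * (pi / alpha) by rewrite mulr_gt0.
have ap2 u v : 0 <= u -> `|v| <= pi / alpha -> cabs (lifted alpha b f (u +i* v)) <=
    AA * expR (AA * expR (alpha * u)).
  move=> u0 hv; apply: le_trans (apriori u v u0 hv) _; rewrite /AA.
  by apply: le_double_exp => //; rewrite ?mulr_ge0// ltW.
have hG := holo_lifted alpha b hf.
have side (s : R) : `|s| = 1 -> forall u v, 0 <= u ->
    `|v - s * (5 / 8 * (pi / alpha))| <= 3 / 8 * (pi / alpha) ->
    cabs (lifted alpha b f (u +i* v)) <= K3 * expR (N3 * u).
  move=> s1.
  have s1' : s = 1 \/ s = -1.
    by have [s0|s0] := ger0P s; [left|right]; move: s1; [rewrite ger0_norm|rewrite ltr0_norm// => <-; rewrite opprK].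
  have inside v : `|v - s * (5 / 8 * (pi / alpha))| <= 3 / 8 * (pi / alpha) -> `|v| <= pi / alpha.
    rewrite !ler_norml => /andP[v1 v2].
    by case: s1' => e; move: v1 v2; rewrite e; move: (pi / alpha) pa0; clear => q q0 v1 v2; apply/andP; split; lra.
  have nb : `|pi / alpha / 4| = pi / alpha / 4 by rewrite gtr0_norm// divr_gt0.
  have na : `|pi / alpha| = pi / alpha by rewrite gtr0_norm.
  have bot u v : 0 <= u -> `|v| = pi / alpha / 4 -> cabs (lifted alpha b f (u +i* v)) <= K3 * expR (N3 * u).
    move=> u0 e; apply: le_trans (HK u v u0 _) _; first by rewrite e q1.
    by apply: up => //; exact: ltW.
  have top u v : 0 <= u -> `|v| = pi / alpha -> cabs (lifted alpha b f (u +i* v)) <= K3 * expR (N3 * u).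
    by move=> u0 e; apply: le_trans (edge u v u0 e) _; apply: up => //; exact: ltW.
  apply: (phragmen_lindelof h30 K30 AA0 al0 lh hG).
  - by move=> v /inside hv; apply: le_trans (left v hv) K2K3.
  - move=> u u0; case: s1' => e; rewrite e.
      by rewrite (_ : 1 * _ - _ = pi / alpha / 4); [by apply: bot; rewrite ?normrN|field; rewrite gt_eqF].
    by rewrite (_ : -1 * _ - _ = - (pi / alpha)); [by apply: top; rewrite ?normrN|field; rewrite gt_eqF].
  - move=> u u0; case: s1' => e; rewrite e.
      by rewrite (_ : 1 * _ + _ = pi / alpha); [by apply: top; rewrite ?normrN|field; rewrite gt_eqF].
    by rewrite (_ : -1 * _ + _ = - (pi / alpha / 4)); [by apply: bot; rewrite ?normrN|field; rewrite gt_eqF].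
  - by move=> u v u0 /inside hv; exact: ap2.
have all3 u v : 0 <= u -> `|v| <= pi / alpha -> cabs (lifted alpha b f (u +i* v)) <= K3 * expR (N3 * u).
  move=> u0 hv; have [hq|hq] := leP `|v| (pi / (4 * alpha)).
    by apply: le_trans (HK u v u0 hq) _; apply: up => //; exact: ltW.
  rewrite q1 in hq; have [v0|v0] := ger0P v.
    apply: (side 1) => //; first exact: normr1.
    rewrite ger0_norm// in hv hq; rewrite ler_norml mul1r.
    by move: (pi / alpha) hv hq; clear => q h1 h2; apply/andP; split; lra.
  apply: (side (-1)) => //; first by rewrite normrN normr1.
  rewrite ltr0_norm// in hv hq; rewrite ler_norml mulN1r.
  by move: (pi / alpha) hv hq; clear => q h1 h2; apply/andP; split; lra.
(* Power growth is of any positive order; [alpha / 4] is below critical for the half-width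
   [pi / alpha]. The member's own constants [K3] and [N3] now enter only the a priori hypothesis, so
   they are absent from the conclusion. *)
pose L := alpha / 4; have L0 : 0 < L by rewrite divr_gt0.
have Lh : L * (pi / alpha) < pi / 2.
  have -> : L * (pi / alpha) = pi / 4 by rewrite /L; field; rewrite gt_eqF.
  by clear - pi0; lra.
pose A4 := K3 + 0 + N3 / L.
have A40 : 0 < A4 by rewrite /A4 addr0 ltr_pwDl// divr_ge0// ltW.
move=> u v u0 hv; rewrite -/A2 -/K2.
apply: (phragmen_lindelof (c := 0) pa0 K20 A40 L0 Lh hG) => //.
- by move=> v'; rewrite subr0; exact: left.
- by move=> u' u'0; rewrite sub0r; apply: edge => //; rewrite normrN ger0_norm// ltW.
- by move=> u' u'0; rewrite add0r; apply: edge => //; rewrite ger0_norm// ltW.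
- move=> u' v' u'0; rewrite subr0 => hv'; apply: le_trans (all3 u' v' u'0 hv') _.
  have := le_double_exp (B := 0) K30 (lexx _) L0 N30 u'0.
  by rewrite mul0r expR0 mulr1.
- by rewrite subr0.
Qed.

End SectorDecay.

(** * The subspace and its properties *)

Section DecaySpace.
Variable R : realType.
Local Notation C := R[i].
Implicit Types (f g : C -> C).

Lemma poly_le_exp (alpha b : R) n : 1 <= alpha -> 0 < b ->
  exists2 K : R, 0 < K & forall r, 0 <= r -> (1 + r) ^+ n <= K * expR (b * r `^ alpha).
Proof.
move=> al1 b0; exists (n.+1`!%:R / b ^+ n.+1 * expR (2 * b)) => [|r r0].
  by rewrite mulr_gt0 ?expR_gt0// divr_gt0 ?exprn_gt0// ltr0n fact_gt0.
have rr : r <= 1 + r `^ alpha.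
  have [r1|/ltW r1] := leP r 1; first by apply: le_trans r1 _; rewrite lerDl powR_ge0.
  by apply: le_trans (le1r_powR r1 al1) _; rewrite lerDr.
apply: (@le_trans _ _ ((1 + r) ^+ n.+1)); first by rewrite exprS ler_peMl ?exprn_ge0//; lra.
have -> : (1 + r) ^+ n.+1 = n.+1`!%:R / b ^+ n.+1 * ((b * (1 + r)) ^+ n.+1 / n.+1`!%:R).
  by rewrite exprMn; field; rewrite expf_neq0 ?gt_eqF// ltr0n fact_gt0.
rewrite -[leRHS]mulrA -expRD; apply: ler_wpM2l; first by rewrite divr_ge0 ?exprn_ge0 ?ltW.
have b1 : 0 <= b * (1 + r) by rewrite mulr_ge0 ?(ltW b0)//; lra.
apply: (@le_trans _ _ (expR (b * (1 + r)))); first by have := expR_ge1Dxn n b1; lra.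
by rewrite ler_expR; have := ler_wpM2l (ltW b0) rr; lra.
Qed.

Definition fock_decay (alpha b : R) n f := exists K : R, forall z : C,
  cabs (f z) <= K * expR (b * cabs z `^ alpha) / (1 + cabs z) ^+ n.

Lemma fock_decay_pos alpha b n f : fock_decay alpha b n f -> exists2 K : R, 0 <= K & forall z : C,
  cabs (f z) <= K * expR (b * cabs z `^ alpha) / (1 + cabs z) ^+ n.
Proof.
move=> [K HK]; exists `|K| => // z; apply: le_trans (HK z) _.
by rewrite !ler_wpM2r ?invr_ge0 ?exprn_ge0 ?addr_ge0 ?cabs_ge0 ?expR_ge0// ler_norm.
Qed.

Lemma fock_decay_mul alpha b n m f (w0 : C) : fock_decay alpha b (m + n) f ->
  fock_decay alpha b n (fun z => (z - w0) ^+ m * f z).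
Proof.
move=> /fock_decay_pos[K K0 HK]; exists ((1 + cabs w0) ^+ m * K) => z.
have c0 := cabs_ge0 z; have d0 := cabs_ge0 w0.
have q0 : 0 < 1 + cabs z by lra.
have e0 := expR_ge0 (b * cabs z `^ alpha).
rewrite cabsM cabsX.
have A : cabs (z - w0) ^+ m <= (1 + cabs w0) ^+ m * (1 + cabs z) ^+ m.
  rewrite -exprMn lerXn2r ?nnegrE ?cabs_ge0 ?mulr_ge0//; try lra.
  have q1 : 0 <= cabs z * cabs w0 by rewrite mulr_ge0.
  by have := cabsB z w0; lra.
have H := HK z; apply: le_trans (ler_pM _ (cabs_ge0 _) A H) _; first by rewrite exprn_ge0 ?cabs_ge0.
rewrite exprD; apply: le_of_eq.
by field; rewrite !expf_neq0// gt_eqF.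
Qed.

Lemma sector_bounded_mul (alpha b : R) f (w0 : C) m : 1 <= alpha -> 0 < b ->
  sector_bounded alpha b f -> sector_bounded alpha b (fun z => (z - w0) ^+ m * f z).
Proof.
move=> al1 b0 /sector_bounded_pos[K [N [K0 N0 H]]].
have d0 := cabs_ge0 w0.
exists ((1 + cabs w0) ^+ m * K), (m%:R + N) => u v u0 hv.
have -> : lifted alpha b (fun z => (z - w0) ^+ m * f z) (u +i* v)
  = (cexp (u +i* v) - w0) ^+ m * lifted alpha b f (u +i* v) by rewrite /lifted mulrA.
rewrite cabsM cabsX mulrDl expRD mulrACA; apply: ler_pM; rewrite ?exprn_ge0 ?cabs_ge0//; last exact: H.
rewrite expRM_natl -exprMn lerXn2r ?nnegrE ?cabs_ge0 ?mulr_ge0 ?expR_ge0//; try lra.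
have e1 : 1 <= expR u by rewrite -expR0 ler_expR.
have := cabsB (cexp (u +i* v)) w0; rewrite cabs_cexp_uv.
have := ler_wpM2l d0 e1; lra.
Qed.

Lemma fock_holo (p alpha a : R) f : 1 <= p ->
  fock p alpha a f <-> holo f /\ (fock_int p alpha a f < +oo)%E.
Proof. by move=> p1; split=> -[/entireP h /(fock_norm_lty _ _ p1) i]; split=> //; exact/entireP. Qed.

Lemma fock_of_decay (p alpha a : R) f : 1 <= p ->
  holo f -> fock_decay alpha (a / p) 4 f -> fock p alpha a f.
Proof.
move=> p1 hf /fock_decay_pos[K K0 HK]; apply/(fock_holo _ _ _ p1); split=> //.
by apply: (fock_int_small p1 _ K0 HK) => z; exact: holo_ccont.
Qed.

Lemma fock_lincomb (p alpha a : R) (c : C) f g : 1 <= p ->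
  fock p alpha a f -> fock p alpha a g -> fock p alpha a (fun z => c * f z + g z).
Proof.
move=> p1 /(fock_holo _ _ _ p1)[hf If] /(fock_holo _ _ _ p1)[hg Ig].
have hh : holo (fun z => c * f z + g z) by apply: holoD => //; exact: holoZ.
apply/(fock_holo _ _ _ p1); split=> //.
apply: le_lt_trans (fock_int_lincomb alpha a p1 _ _ _) _; try by move=> z; exact: holo_ccont.
by rewrite lte_mul_pinfty// ?lee_fin ?mulr_ge0 ?addr_ge0 ?powR_ge0// lte_add_pinfty.
Qed.

(** Outside the unit disc around [w0] one has [|g| <= |f|]; inside it [g] is bounded, and a constant
    on the surrounding square dominates. *)
Lemma fock_divide (p alpha a : R) f g (w0 : C) : 1 <= p -> 0 < a ->
  holo g -> (forall z, f z = (z - w0) * g z) -> fock p alpha a f -> fock p alpha a g.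
Proof.
move=> p1 a0 hg E /(fock_holo _ _ _ p1)[hf If]; apply/(fock_holo _ _ _ p1); split=> //.
have p0 : 0 < p by lra.
have [M M0 HM] := holo_bounded (cabs w0 + 1) hg.
pose k1 (xy : R * R) : R := if (`|xy.1 - Re w0| <= 1) && (`|xy.2 - Im w0| <= 1) then M `^ p else 0.
have k10 xy : 0 <= k1 xy by rewrite /k1; case: ifP => // _; exact: powR_ge0.
have mk1 : measurable_fun [set: R * R] k1 by exact: (measurable_in_box _ _ _ (measurable_cst (M `^ p))).
have cf w : ccont f w by exact: holo_ccont.
have cg w : ccont g w by exact: holo_ccont.
have mf := measurable_fock_dens p alpha a cf.
have mg := measurable_fock_dens p alpha a cg.
have I1 := integral_box_cst (Re w0) (Im w0) ltr01 (powR_ge0 M p).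
apply: (@le_lt_trans _ _ (\int[@lebesgue_measure R \x @lebesgue_measure R]_xy
    ((k1 xy)%:E + (fock_dens p alpha a f xy)%:E))%E); last first.
  rewrite ge0_integralD//; last 4 first.
  - by move=> xy _; rewrite lee_fin.
  - exact/measurable_EFinP.
  - by move=> xy _; rewrite lee_fin fock_dens_ge0.
  - exact/measurable_EFinP.
  by rewrite I1 lte_add_pinfty// ltry.
apply: ge0_le_integral => //.
- by move=> xy _; rewrite lee_fin fock_dens_ge0.
- exact/measurable_EFinP.
- by apply: emeasurable_funD; exact/measurable_EFinP.
move=> [x y] _; rewrite -EFinD lee_fin /fock_dens /= -!/(cabs _); set z := x +i* y.
have [zw|zw] := leP (cabs (z - w0)) 1.
  have -> : k1 (x, y) = M `^ p.
    rewrite /k1 ifT//=; have := le_trans (normr_Re_le _) zw; have := le_trans (normr_Im_le _) zw.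
    by rewrite reD imD reN imN /= => -> ->.
  apply: (@le_trans _ _ (M `^ p)); last by rewrite lerDl mulr_ge0 ?powR_ge0 ?expR_ge0.
  rewrite -[leRHS]mulr1; apply: ler_pM; rewrite ?powR_ge0 ?expR_ge0//.
    apply: ge0_ler_powR; rewrite ?nnegrE ?cabs_ge0 ?(ltW M0) ?(ltW p0)//; apply: HM.
    by have := cabsD (z - w0) w0; rewrite subrK; lra.
  by rewrite -expR0 ler_expR oppr_le0 mulr_ge0 ?powR_ge0// ltW.
apply: (@le_trans _ _ (cabs (f z) `^ p * expR (- (a * cabs z `^ alpha)))); last by rewrite lerDr.
rewrite ler_wpM2r ?expR_ge0//; apply: ge0_ler_powR; rewrite ?nnegrE ?cabs_ge0 ?(ltW p0)//.
by rewrite E cabsM ler_peMl ?cabs_ge0// ltW.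
Qed.

Definition decay_space (p alpha a : R) : set (C -> C) :=
  [set f | fock p alpha a f /\ sector_bounded alpha (a / p) f].

Section Space.
Variables (p alpha a : R).
Hypotheses (p1 : 1 <= p) (al1 : 1 <= alpha) (a0 : 0 < a).
Local Notation M := (decay_space p alpha a).

Let p0 : 0 < p. Proof. exact: lt_le_trans ltr01 p1. Qed.
Let al0 : 0 < alpha. Proof. exact: lt_le_trans ltr01 al1. Qed.
Let b0 : 0 < a / p. Proof. exact: divr_gt0. Qed.

Lemma decay_space_lincomb (c : C) f g : M f -> M g -> M (fun z => c * f z + g z).
Proof.
move=> [ff sf] [fg sg]; split; first exact: fock_lincomb.
exact: sector_bounded_lincomb.
Qed.

Lemma decay_space0 : M (fun=> 0).
Proof.
have h0 : holo (fun=> 0 : C) by exact: holo_cst.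
split.
  apply: fock_of_decay => //; exists 0 => z.
  by rewrite cabs0 !mul0r.
by exists 0, 0 => u v _ _; rewrite /lifted mul0r cabs0 mul0r.
Qed.

Lemma decay_space_divide f g (w0 : C) : holo g -> (forall z, f z = (z - w0) * g z) -> M f -> M g.
Proof.
move=> hg E [ff sf]; split; first exact: (fock_divide p1 a0 hg E ff).
exact: (sector_bounded_divide al1 b0 hg E sf).
Qed.

Lemma decay_space_holo f : M f -> holo f.
Proof. by move=> [[/entireP]]. Qed.

(** All members within distance 1 of [f] have Fock integral at most [L], so [point_eval] and
    [uniform_sector_bound] give them one common bound in the sector. At each fixed point the
    approximation is arbitrarily good, again by [point_eval], and [f] inherits the bound. *)
Lemma decay_space_closed f : fock p alpha a f ->
  (forall e : R, 0 < e -> exists2 g, M g & (fock_norm p alpha a (fun z => (f z - g z)%R) < e%:E)%E) ->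
  M f.
Proof.
move=> ff H; split=> //.
have /(fock_holo _ _ _ p1)[hf If] := ff.
have [K K0 HK] := point_eval p1 al1 a0.
pose s := 2 `^ p * (cabs (-1 : C) `^ p + 1).
have s0 : 0 < s by rewrite mulr_gt0 ?powR_gt0// ltr_wpDl ?powR_ge0.
pose L := s * (1 + fine (fock_int p alpha a f)) + 1.
have If0 := fock_int_ge0 p alpha a f.
have Ifin : fock_int p alpha a f = (fine (fock_int p alpha a f))%:E.
  by rewrite fineK// ge0_fin_numE.
have L0 : 0 < L by rewrite ltr_wpDl// mulr_ge0 ?(ltW s0)// addr_ge0// fine_ge0.
pose A := K * L `^ p^-1; have A0 : 0 < A by rewrite mulr_gt0 ?powR_gt0.
pose U := A * 2 `^ (2 * alpha) * expR (2 * (a / p)).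
exists U, (2 * alpha) => u v u0 hv.
have hv' := le_trans hv (quarter_le al1).
pose w := u +i* v.
(* At the fixed [w], a Fock distance below [d] changes [lifted] by at most [k d <= e]; the condition
   [d <= 1] keeps the integral of the approximant below [L]. *)
pose k := K * (1 + cabs (cexp w)) `^ (2 * alpha) * expR (a / p * cabs (cexp w) `^ alpha)
   * cabs (weight alpha (a / p) w).
have k0 : 0 <= k by rewrite !mulr_ge0 ?powR_ge0 ?expR_ge0 ?cabs_ge0 ?(ltW K0).
apply/ler_addgt0Pr => e e0.
pose d := Num.min 1 (e / (k + 1)).
have d0 : 0 < d by rewrite lt_min ltr01 divr_gt0// ltr_wpDl.
have [g Mg Hg] := H d d0.
have hg := decay_space_holo Mg.
have Hd := fock_norm_lt p1 Hg.
have hfg : holo (fun z => f z - g z) by exact: holoB.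
have d1 : d <= 1 by rewrite ge_min lexx.
have dp1 : d `^ p <= 1.
  apply: (@le_trans _ _ (1 `^ p)); last by rewrite powR1.
  by apply: ge0_ler_powR; rewrite ?nnegrE ?(ltW p0) ?(ltW d0).
have gE : g = (fun z => (-1) * (f z - g z) + f z).
  by apply/funext => z; ring.
have Ig : (fock_int p alpha a g <= L%:E)%E.
  rewrite gE; apply: le_trans (fock_int_lincomb alpha a p1 _ _ _) _;
    try by move=> z; apply: holo_ccont; rewrite -?gE.
  rewrite -/s Ifin; apply: (@le_trans _ _ (s%:E * (1%:E + (fine (fock_int p alpha a f))%:E))%E).
    rewrite lee_wpmul2l ?lee_fin ?(ltW s0)// leeD2r//.
    by apply: le_trans Hd _; rewrite lee_fin.
  by rewrite -EFinD -EFinM lee_fin /L lerDl.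
have G1 z : cabs (g z) <= A * (1 + cabs z) `^ (2 * alpha) * expR (a / p * cabs z `^ alpha).
  apply: le_trans (HK g L hg L0 Ig z) _; rewrite /A; apply: le_of_eq; ring.
have G2 := uniform_sector_bound al1 b0 hg A0 G1 Mg.2 u0 hv'.
have D1 := HK _ _ hfg (powR_gt0 p d0) Hd (cexp w).
rewrite -powRrM mulfV ?gt_eqF// powRr1 ?(ltW d0)// in D1.
have -> : lifted alpha (a / p) f w = lifted alpha (a / p) g w + (f (cexp w) - g (cexp w)) * weight alpha (a / p) w.
  by rewrite /lifted; ring.
apply: le_trans (cabsD _ _) _; apply: lerD; first exact: G2.
rewrite (cabsM (_ - _)); apply: le_trans (ler_wpM2r (cabs_ge0 _) D1) _.
apply: (@le_trans _ _ (k * d)); first by rewrite /k; apply: le_of_eq; ring.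
have dk : d <= e / (k + 1) by rewrite ge_min lexx orbT.
apply: le_trans (ler_wpM2l k0 dk) _.
rewrite mulrCA -[leRHS]mulr1 ler_wpM2l ?(ltW e0)// ler_pdivrMr ?ltr_wpDl// mul1r.
by rewrite lerDl.
Qed.

Lemma one_in_fock : fock p alpha a (fun=> 1).
Proof.
apply: fock_of_decay => //; first exact: holo_cst.
have [K K0 HK] := poly_le_exp 4 al1 b0; exists K => z.
by rewrite cabs1 ler_pdivlMr ?mul1r ?HK ?cabs_ge0// exprn_gt0// ltr_pwDl ?cabs_ge0.
Qed.

(** On the positive axis [weight] is [exp (b r^alpha - r^(alpha/2))], which exceeds every power of
    [r]. *)
Lemma one_not_decay : ~ sector_bounded alpha (a / p) (fun=> 1).
Proof.
move=> /sector_bounded_pos[K [N [K0 N0 H]]].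
have [U U0 HU] := @expR_dominates R (alpha / 2) alpha 1 (- N) (- ln K - 1) _
  ltac:(by rewrite divr_gt0) ltac:(by rewrite ltr_pdivrMr// mulrC mulr_natl mulr2n ltrDl) ltr01 b0 0.
have := H U 0 (ltW U0).
rewrite normr0 divr_ge0 ?pi_ge0 ?mulr_ge0 ?(ltW al0)// => /(_ isT).
rewrite /lifted mul1r cabs_weight !mulr0 cos0 !mulr1 -[K](lnK K0) -expRD ler_expR.
by move: HU; lra.
Qed.

Lemma decay_space_without_zeros : (exists2 f, M f & exists z, f z != 0) -> without_common_zeros M.
Proof.
move=> [f Mf [z0 fz0]] w; apply: contrapT => H.
have vanish g : M g -> g w = 0.
  by move=> Mg; apply/eqP; apply: contrapT => /negP gw; apply: H; exists g.
have ord n : exists2 g, M g & forall z, f z = (z - w) ^+ n * g z.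
  elim: n => [|n [g Mg E]]; first by exists f => // z; rewrite expr0 mul1r.
  have [h hh Eh] := holo_divide (decay_space_holo Mg) (vanish g Mg).
  exists h; first exact: (decay_space_divide hh Eh Mg).
  by move=> z; rewrite E Eh exprSr mulrA.
move: fz0; rewrite (@infinite_order_zero _ f w (decay_space_holo Mf) _ z0) ?eqxx// => n.
by have [g Mg E] := ord n; exists g => //; exact: decay_space_holo.
Qed.

Lemma decay_space_near_invariant : nearly_invariant M.
Proof.
move=> f Mf f0; have [g hg E] := holo_divide (decay_space_holo Mf) f0.
exists g; first exact: (decay_space_divide hg E Mf).
by move=> z z0; rewrite E subr0 mulrAC mulfV// mul1r.
Qed.

(** Were [n] elements to span, the [n + 1] products of [f] with powers of [z - z0] would be
    dependent, that is, a nonzero polynomial would vanish wherever [f] does not, in particular at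
    all points near [z0]. *)
Lemma decay_space_infinite :
  (forall n, exists f, [/\ holo f, exists z, f z != 0, fock_decay alpha (a / p) n f
     & sector_bounded alpha (a / p) f]) -> infinite_dimensional M.
Proof.
move=> ker [n [e [Me He]]].
(* Decay of order 4 must survive multiplication by powers up to the [n]-th. *)
have [f [hf [z0 fz0] df sf]] := ker (n + 4)%N.
have MP (j : 'I_n.+1) : M (fun z => (z - z0) ^+ j * f z).
  have hj : holo (fun z => (z - z0) ^+ j * f z).
    by apply: holoM => //; apply: holoX; apply: holoB; [exact: holo_id|exact: holo_cst].
  split; last exact: sector_bounded_mul.
  apply: fock_of_decay => //; apply: fock_decay_mul.
  have [K K0 HK] := fock_decay_pos df; exists K => z; apply: le_trans (HK z) _.
  have c1 : 1 <= 1 + cabs z by rewrite lerDl cabs_ge0.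
  rewrite ler_wpM2l ?mulr_ge0 ?expR_ge0// lef_pV2 ?posrE ?exprn_gt0 ?(lt_le_trans ltr01)//.
  by rewrite ler_weXn2l// leq_add2r -ltnS.
have [c Hc] := choice (fun j => He _ (MP j)).
(* One more row than columns: the left kernel contains the coefficients of a nonzero dependence. *)
pose A : 'M[C]_(n.+1, n) := \matrix_(j, i) c j i.
have : kermx A != 0.
  rewrite -mxrank_eq0 mxrank_ker subn_eq0 -ltnNge ltnS; exact: rank_leq_col.
move=> /rowV0Pn[d /sub_kermxP dA d0].
pose P : {poly C} := \poly_(j < n.+1) d 0 (inord j).
have P0 : P != 0.
  apply: contra d0 => /eqP PE; apply/eqP/rowP => j; rewrite mxE.
  by have := coef_poly n.+1 (fun j => d 0 (inord j)) j; rewrite -/P PE coef0 ltn_ord inord_val.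
have Pf z : P.[z - z0] * f z = 0.
  rewrite horner_poly mulr_suml.
  transitivity (\sum_(j < n.+1) \sum_(i < n) d 0 j * c j i * e i z).
    by apply: eq_bigr => j _; rewrite inord_val -mulrA Hc mulr_sumr; apply: eq_bigr => i _; rewrite mulrA.
  rewrite exchange_big /= big1 // => i _; rewrite -mulr_suml.
  have := congr1 (fun B : 'rV_n => B 0 i) dA; rewrite !mxE => dAi.
  rewrite (_ : \sum_(j < n.+1) d 0 j * c j i = 0) ?mul0r// -[RHS]dAi.
  by apply: eq_bigr => j _; rewrite mxE.
have fe : 0 < cabs (f z0) / 2 by rewrite divr_gt0// cabs_gt0.
have [del del0 Hdel] := holo_ccont z0 hf fe.
(* As many distinct roots as [size P], one too many for a nonzero polynomial; [k.+2] places them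
   strictly within [del]. *)
pose xs : seq C := [seq (del / (k.+2)%:R)%:C | k <- iota 0 (size P)].
have xsU : uniq xs.
  rewrite map_inj_uniq ?iota_uniq// => k1 k2 [] /(mulfI (lt0r_neq0 del0))/invr_inj/eqP.
  by rewrite eqr_nat => /eqP[].
have xsR : all (root P) xs.
  apply/allP => _ /mapP[k _ ->]; set x := _%:C.
  have := Pf (z0 + x); rewrite addrAC subrr add0r => /eqP; rewrite mulf_eq0 => /orP[//|/eqP fx].
  have xd : cabs x < del.
    rewrite cabs_real gtr0_norm ?divr_gt0// ltr_pdivrMr// ltr_pMr// ltr1n//.
  have := Hdel x xd; rewrite fx sub0r cabsN.
  have : 0 < cabs (f z0) by rewrite cabs_gt0.
  lra.
have := max_poly_roots P0 xsR xsU; rewrite size_map size_iota ltnn.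
by [].
Qed.

Lemma decay_space_nontrivial : (exists2 f, M f & exists z, f z != 0) ->
  nontrivial_subspace p alpha a M.
Proof.
move=> [f Mf [z fz]]; split => [E|E].
  by move: Mf; rewrite E /= => fE; move: fz; rewrite fE eqxx.
by have := one_in_fock; rewrite -E => -[_]; exact: one_not_decay.
Qed.

End Space.
End DecaySpace.

(** * Contour integrals that furnish members of the subspace *)

Section Kernel.
Variable R : realType.
Local Notation C := R[i].
Implicit Types (z w h s : C) (A B nu kap U u v phi : R) (m : nat).

Lemma cexp_sub1_le s : cabs (cexp s - 1) <= cabs s * expR (cabs s).
Proof.
pose p (t : R) := cexp (0 + t%:C * s).
have dp t : rderiv p t (cexp (0 + t%:C * s) * s) by apply: rderiv_affine; exact: cderiv_cexp.
have := @cmean_value_bound _ p (fun t => cexp (0 + t%:C * s) * s) 0 1 (cabs s * expR (cabs s)) ler01.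
have -> : p 0 = 1 by rewrite /p (_ : 0%:C = 0)// mul0r addr0 cexp0.
have -> : p 1 = cexp s by rewrite /p (_ : 1%:C = 1)// mul1r add0r.
rewrite subr0 mulr1; apply => [t _|t /andP[t0 t1]]; first exact: dp.
rewrite cabsM cabs_cexp add0r reZl mulrC ler_wpM2l ?cabs_ge0// ler_expR.
apply: le_trans (ler_norm _) _; rewrite normrM ger0_norm//.
by apply: le_trans (ler_wpM2l t0 (normr_Re_le s)) _; rewrite ler_piMl ?cabs_ge0.
Qed.

Lemma cexp_sub1_sub_le s : cabs (cexp s - 1 - s) <= cabs s ^+ 2 * expR (cabs s).
Proof.
pose p (t : R) := cexp (0 + t%:C * s) - (0 + t%:C * s).
have dp t : rderiv p t (cexp (0 + t%:C * s) * s - 1 * s).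
  apply: rderivB; first by apply: rderiv_affine; exact: cderiv_cexp.
  by apply: (rderiv_affine (f := id)); exact: cderiv_id.
have := @cmean_value_bound _ p (fun t => cexp (0 + t%:C * s) * s - 1 * s) 0 1
  (cabs s ^+ 2 * expR (cabs s)) ler01.
have -> : p 0 = 1 by rewrite /p (_ : 0%:C = 0)// mul0r addr0 cexp0 subr0.
have -> : p 1 = cexp s - s by rewrite /p (_ : 1%:C = 1)// mul1r add0r.
rewrite subr0 mulr1 => H.
have -> : cexp s - 1 - s = cexp s - s - 1 by ring.
apply: H => [t _|t /andP[t0 t1]]; first exact: dp.
rewrite add0r -mulrBl cabsM expr2 mulrAC [leRHS]mulrAC -mulrA.
rewrite [leRHS](_ : _ = cabs s * expR (cabs s) * cabs s); last by ring.
rewrite ler_wpM2r ?cabs_ge0//; apply: le_trans (cexp_sub1_le _) _.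
have st : cabs (t%:C * s) <= cabs s.
  by rewrite cabsM cabs_real ger0_norm// ler_piMl ?cabs_ge0.
by apply: ler_pM; rewrite ?cabs_ge0 ?expR_ge0// ler_expR.
Qed.

(** The exponent [kap] is real rather than a natural number because each derivative in [z] lowers it
    by [nu]. *)
Definition kexp A B nu kap z w : C :=
  cexp (A%:C * cexp w - B%:C * (z * cexp (nu%:C * w)) - kap%:C * w).

Lemma holo_kexp A B nu kap z : holo (kexp A B nu kap z).
Proof.
have hl (c : C) : holo (fun w => c * w) by apply: holoZ; exact: holo_id.
apply: holo_cexp; apply: holoB; last exact: hl.
apply: holoB; first by apply: holoZ; apply: holo_cexp; exact: holo_id.
by do 2 apply: holoZ; apply: holo_cexp; exact: hl.
Qed.

Lemma cabs_kexp A B nu kap z u v : cabs (kexp A B nu kap z (u +i* v)) =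
  expR (A * (expR u * cos v) - B * Re (z * cexp (nu%:C * (u +i* v))) - kap * u).
Proof. by rewrite /kexp cabs_cexp !reD !reN (reZl A) (reZl B) (reZl kap) reCexp. Qed.

Lemma cabs_kexp_le A B nu kap z u v : cabs (kexp A B nu kap z (u +i* v)) <=
  expR (A * (expR u * cos v) + `|B| * (cabs z * expR (nu * u)) - kap * u).
Proof.
rewrite cabs_kexp ler_expR lerD2r lerD2l -mulNr; apply: le_trans (ler_norm _) _.
rewrite normrM normrN ler_wpM2l//; apply: le_trans (normr_Re_le _) _.
by rewrite cabsM cabs_cexp reZl.
Qed.

Lemma rcont_kexp_vert A B nu kap z U t : rcont (fun v => kexp A B nu kap z (U +i* v)) t.
Proof. by apply: rcont_vert; exact/holo_ccont/holo_kexp. Qed.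

Lemma rcont_kexp_horiz A B nu kap z v t : rcont (fun u => kexp A B nu kap z (u +i* v)) t.
Proof. by apply: rcont_horiz; exact/holo_ccont/holo_kexp. Qed.

(** Integrated in [dv], so the contour integral over the segment is [i] times this value. *)
Definition kint A B nu kap z U phi : C :=
  cint (fun v => kexp A B nu kap z (U +i* v)) (- phi) phi.

Lemma kexp_shift A B nu kap z w :
  cexp (nu%:C * w) * kexp A B nu kap z w = kexp A B nu (kap - nu) z w.
Proof. by rewrite /kexp -cexpD realcB; congr cexp; ring. Qed.

(** Differentiation under the integral: for [cabs h <= 1] the second-order remainder of the
    exponential is uniformly [O(|h|^2)] on the segment, where [|B exp (nu w)|] is the constant
    [c]. *)
Lemma cderiv_kint A B nu kap z U phi : 0 <= phi ->
  cderiv (fun z => kint A B nu kap z U phi) z (- B%:C * kint A B nu (kap - nu) z U phi).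
Proof.
move=> phi0.
have [M M0 HM] := rcont_bounded (- phi) phi (@rcont_kexp_vert A B nu kap z U).
pose c := `|B| * expR (nu * U).
have c0 : 0 <= c by rewrite mulr_ge0 ?expR_ge0.
pose k := M * (c ^+ 2 * expR c) * (2 * phi) + 1.
have k0 : 0 < k by rewrite ltr_wpDl// !mulr_ge0 ?expR_ge0 ?exprn_ge0// ltW.
move=> e e0; exists (Num.min 1 (e / k)); first by rewrite lt_min ltr01 divr_gt0.
move=> h; rewrite lt_min => /andP[h1 he].
have rc kap' z' : forall t, rcont (fun v => kexp A B nu kap' z' (U +i* v)) t.
  by move=> t; exact: rcont_kexp_vert.
rewrite /kint -mulrA [_ * h]mulrC mulrA -cintZ//.
rewrite -cintB// -cintB//; last 2 first.
- by move=> t; exact: rcontB.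
- by move=> t; exact: rcontZ.
have -> : e * cabs h = e * cabs h / (2 * phi + 1) * (2 * phi + 1).
  by rewrite divfK// gt_eqF// ltr_wpDl// mulr_ge0.
have hc := cabs_ge0 h.
apply: (@le_trans _ _ (M * (c ^+ 2 * expR c) * cabs h ^+ 2 * (phi - - phi))).
  apply: cint_le; first by lra.
    by move=> t; apply: rcontB; [exact: rcontB|exact: rcontZ].
  move=> t /HM Mt; pose s := - B%:C * h * cexp (nu%:C * (U +i* t)).
  have -> : kexp A B nu kap (z + h) (U +i* t) - kexp A B nu kap z (U +i* t)
     - - B%:C * h * kexp A B nu (kap - nu) z (U +i* t)
     = kexp A B nu kap z (U +i* t) * (cexp s - 1 - s).
    rewrite -kexp_shift.
    have -> : kexp A B nu kap (z + h) (U +i* t) = kexp A B nu kap z (U +i* t) * cexp s.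
      by rewrite /kexp -cexpD /s; congr cexp; ring.
    by rewrite /s; ring.
  have sE : cabs s = c * cabs h.
    by rewrite /s cabsM (cabsM _ h) cabsN cabs_real cabs_cexp reZl /= /c; ring.
  rewrite (cabsM (kexp _ _ _ _ _ _)) -[leRHS]mulrA; apply: ler_pM; rewrite ?cabs_ge0//.
  apply: le_trans (cexp_sub1_sub_le s) _; rewrite sE.
  have -> : c ^+ 2 * expR c * cabs h ^+ 2 = (c * cabs h) ^+ 2 * expR c by ring.
  apply: ler_wpM2l; first exact: sqr_ge0.
  by rewrite ler_expR ler_piMr// ltW.
have -> : M * (c ^+ 2 * expR c) * cabs h ^+ 2 * (phi - - phi)
   = M * (c ^+ 2 * expR c) * (2 * phi) * cabs h * cabs h by ring.
rewrite divfK; last by rewrite gt_eqF// ltr_wpDl// mulr_ge0.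
rewrite ler_wpM2r//; apply: (@le_trans _ _ (k * cabs h)).
  by rewrite ler_wpM2r// lerDl.
by rewrite mulrC -ler_pdivlMr// ltW.
Qed.

Lemma kint_shift A B nu kap z U U' phi : 0 <= phi -> U <= U' ->
  'i%C * (kint A B nu kap z U' phi - kint A B nu kap z U phi) =
  cint (fun u => kexp A B nu kap z (u +i* phi)) U U'
  - cint (fun u => kexp A B nu kap z (u +i* (- phi))) U U'.
Proof.
move=> phi0 UU; have hk := holo_kexp A B nu kap z.
have := @goursat _ (kexp A B nu kap z) U U' (- phi) phi UU _ (fun z => holo_ccont z hk) (fun _ _ _ _ => hk _).
rewrite /rint /kint => H; have {}H := H ltac:(lra).
apply/eqP; rewrite -subr_eq0; apply/eqP; rewrite -[RHS]H; ring.
Qed.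

(** By Cauchy's theorem only the two horizontal sides matter, each at most the integral of
    [K exp (- kap u)] from [U] to infinity. *)
Lemma kint_shift_le A B nu kap z U U' phi (K : R) : 0 <= phi -> U <= U' -> 0 < kap -> 0 <= K ->
  (forall u, U <= u -> cabs (kexp A B nu kap z (u +i* phi)) <= K * expR (- (kap * u))) ->
  (forall u, U <= u -> cabs (kexp A B nu kap z (u +i* (- phi))) <= K * expR (- (kap * u))) ->
  cabs (kint A B nu kap z U' phi - kint A B nu kap z U phi) <= 2 * K / kap * expR (- (kap * U)).
Proof.
move=> phi0 UU k0 K0 H1 H2.
pose q u := - (K / kap) * expR (- (kap * u)).
have dq u : is_derive u (1 : R^o) (q : R^o -> R^o) (K * expR (- (kap * u))).
  have D1 : is_derive u (1 : R^o) ((fun u => - (kap * u)) : R^o -> R^o) (- kap).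
    have -> : (fun u => - (kap * u)) = (fun u => - kap * u) by apply/funext => x; rewrite mulNr.
    exact: is_derive_mull.
  have D2 := @is_derive1_comp R expR (fun u => - (kap * u)) u _ _ (is_derive_expR (- (kap * u))) D1.
  have := is_deriveZ (- (K / kap)) D2.
  rewrite /GRing.scale/=; congr is_derive.
  by field; rewrite gt_eqF.
have HB v : (forall u, U <= u -> cabs (kexp A B nu kap z (u +i* v)) <= K * expR (- (kap * u))) ->
    cabs (cint (fun u => kexp A B nu kap z (u +i* v)) U U') <= K / kap * expR (- (kap * U)).
  move=> H; apply: (@le_trans _ _ (q U' - q U)).
    apply: (@cint_le_primitive _ _ U U' q (fun u => K * expR (- (kap * u)))) => //.
    - by move=> t; exact: rcont_kexp_horiz.
    - by move=> t /andP[Ut _]; exact: H.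
  have : 0 <= K / kap * expR (- (kap * U')) by rewrite mulr_ge0 ?expR_ge0// divr_ge0// ltW.
  rewrite /q !mulNr; lra.
have := kint_shift A B nu kap z phi0 UU => /(congr1 cabs); rewrite cabsM cabs_i mul1r => ->.
apply: le_trans (cabsB _ _) _.
have -> : 2 * K / kap * expR (- (kap * U)) = K / kap * expR (- (kap * U)) + K / kap * expR (- (kap * U)) by ring.
by apply: lerD; exact: HB.
Qed.

Lemma cexpMn m w : cexp (m%:R * w) = cexp w ^+ m.
Proof.
elim: m => [|m IH]; first by rewrite mul0r cexp0 expr0.
by rewrite -natr1 mulrDl mul1r cexpD IH exprSr.
Qed.

Lemma natCE m : (m%:R : R)%:C = m%:R :> C.
Proof. exact: rmorph_nat. Qed.

Lemma cexp_pi u : cexp (u +i* pi) = cexp (u +i* (- pi)).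
Proof. by apply: cplx_ext; rewrite ?reCexp ?imCexp /= ?cosN ?sinN ?sinpi ?oppr0. Qed.

Lemma kexp0_pi A B nu m u : kexp A B nu m%:R 0 (u +i* pi) = kexp A B nu m%:R 0 (u +i* (- pi)).
Proof. by rewrite /kexp !mul0r !mulr0 !subr0 !natCE !cexpD !cexpN !cexpMn cexp_pi. Qed.

(** Periodicity makes the two horizontal sides cancel: the integral runs over a full circle in
    [exp w], whose radius is then free. *)
Lemma kint_const A B nu kap z U U' :
  (forall u, kexp A B nu kap z (u +i* pi) = kexp A B nu kap z (u +i* (- pi))) ->
  kint A B nu kap z U' pi = kint A B nu kap z U pi.
Proof.
move=> per; have W V V' : V <= V' -> kint A B nu kap z V' pi = kint A B nu kap z V pi.
  move=> VV; have := kint_shift A B nu kap z (pi_ge0 R) VV.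
  rewrite (funext per) subrr => /eqP; rewrite mulf_eq0 subr_eq0 => /orP[/eqP i0|/eqP//].
  by have := cabs_i R; rewrite i0 cabs0 => /eqP; rewrite eq_sym oner_eq0.
by have [UU|/ltW UU] := leP U U'; [|symmetry]; exact: W.
Qed.

(** With [s = exp w] this is the integral of [exp (A s)] over the angle on a circle about 0. On a
    circle so small that [|exp (A s) - 1| < 1], it differs from [2 pi] by less than [2 pi]. *)
Lemma kint0_0_neq0 A B nu U : kint A B nu 0 0 U pi != 0.
Proof.
have small : exists2 V, V <= U & `|A| * expR V * expR (`|A| * expR V) < 1.
  have [V VU V1] : exists2 V, V <= U & V <= - (2 + 2 * `|A|).
    by exists (Num.min U (- (2 + 2 * `|A|))); rewrite ge_min lexx ?orbT.
  exists V => //; have a0 := normr_ge0 A.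
  have e1 : expR V * (3 + 2 * `|A|) <= 1.
    have h1 := expR_ge1Dx (2 + 2 * `|A|).
    apply: (@le_trans _ _ (expR V * expR (2 + 2 * `|A|))); last first.
      by rewrite -expRD -[leRHS]expR0 ler_expR; lra.
    by rewrite ler_wpM2l ?expR_ge0//; lra.
  have e2 := expR_gt0 V.
  set x := `|A| * expR V.
  have x0 : 0 <= x by rewrite mulr_ge0// ltW.
  have x2 : 2 * x < 1 by rewrite /x; lra.
  have h1 := expR_le_quad x0.
  have h2 : x * expR x < 2^-1 * expR x by rewrite ltr_pM2r ?expR_gt0//; lra.
  by move: h1 h2; move: (expR x) (x * expR x) => y xy h1 h2; lra.
have [V VU HV] := small; rewrite (kint_const V U (kexp0_pi A B nu 0)).
set J := kint _ _ _ _ _ _ _.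
have cst1 : cint (fun=> 1 : C) (- pi) pi = (2 * pi)%:C.
  rewrite (@cint_FTC _ (fun t : R => t%:C)) => [|t].
    by rewrite -realcB; congr _%:C; ring.
  move=> e e0; exists 1 => // s _.
  rewrite (_ : (t + s)%:C - t%:C - 1 * s%:C = 0); last by rewrite realcD; ring.
  by rewrite cabs0 mulr_ge0// ltW.
have : cabs (J - (2 * pi)%:C) < 2 * pi.
  rewrite -cst1 -cintB; [|by move=> t; exact: rcont_kexp_vert|by move=> t; exact: rcont_cst].
  apply: (@le_lt_trans _ _ (`|A| * expR V * expR (`|A| * expR V) * (pi - - pi))).
    apply: cint_le; first by have := pi_ge0 R; lra.
      by move=> t; apply: rcontB; [exact: rcont_kexp_vert|exact: rcont_cst].
    move=> t _; rewrite /kexp !mul0r !mulr0 !subr0; apply: le_trans (cexp_sub1_le _) _.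
    by rewrite cabsM cabs_real cabs_cexp /=.
  have p0 := pi_gt0 R.
  have -> : pi - - pi = 2 * pi :> R by ring.
  by rewrite gtr_pMl// mulr_gt0.
by apply: contraTneq => ->; rewrite sub0r cabsN cabs_real gtr0_norm ?ltxx// mulr_gt0 ?pi_gt0.
Qed.

(* Integration by parts: [A * J_m = (m + 1) * J_(m+1)] for [J_m := kint A B nu m 0 U pi]. *)
Lemma kint0_neq0 A B nu m U : A != 0 -> kint A B nu m%:R 0 U pi != 0.
Proof.
move=> A0; elim: m => [|m IH]; first exact: kint0_0_neq0.
apply: contra IH => /eqP J0; apply/eqP.
pose g v := kexp A B nu m.+1%:R 0 (U +i* v).
have dk w : cderiv (kexp A B nu m.+1%:R 0) w
    (A%:C * kexp A B nu m%:R 0 w - m.+1%:R * kexp A B nu m.+1%:R 0 w).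
  have E : kexp A B nu m.+1%:R 0 = fun w => cexp (A%:C * cexp w - m.+1%:R * w).
    by apply/funext => x; rewrite /kexp mul0r mulr0 subr0 natCE.
  have Em : kexp A B nu m%:R 0 w = cexp w * kexp A B nu m.+1%:R 0 w.
    by rewrite /kexp -cexpD mul0r mulr0 !subr0 !natCE -natr1; congr cexp; ring.
  rewrite Em E.
  have -> : A%:C * (cexp w * cexp (A%:C * cexp w - m.+1%:R * w))
      - m.+1%:R * cexp (A%:C * cexp w - m.+1%:R * w)
    = cexp (A%:C * cexp w - m.+1%:R * w) * (A%:C * cexp w - m.+1%:R * 1) by ring.
  apply: cderiv_cexp_comp; apply: cderivB; first by apply: cderivZ; exact: cderiv_cexp.
  by apply: cderivZ; exact: cderiv_id.
have H : cint (fun v => (A%:C * kexp A B nu m%:R 0 (U +i* v)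
    - m.+1%:R * kexp A B nu m.+1%:R 0 (U +i* v)) * 'i%C) (- pi) pi = 0.
  rewrite (@cint_FTC _ g) => [|t]; first by rewrite /g kexp0_pi subrr.
  by apply: rderiv_vert; exact: dk.
have c1 t : rcont (fun v => A%:C * kexp A B nu m%:R 0 (U +i* v)) t.
  by apply: rcontZ; exact: rcont_kexp_vert.
have c2 t : rcont (fun v => m.+1%:R * kexp A B nu m.+1%:R 0 (U +i* v)) t.
  by apply: rcontZ; exact: rcont_kexp_vert.
move: H; have -> : (fun v => (A%:C * kexp A B nu m%:R 0 (U +i* v)
    - m.+1%:R * kexp A B nu m.+1%:R 0 (U +i* v)) * 'i%C) = (fun v => 'i%C *
    (A%:C * kexp A B nu m%:R 0 (U +i* v) - m.+1%:R * kexp A B nu m.+1%:R 0 (U +i* v))).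
  by apply/funext => v; rewrite mulrC.
rewrite cintZ; last by move=> t; exact: rcontB.
rewrite cintB// !cintZ; try by move=> t; exact: rcont_kexp_vert.
move: J0; rewrite /kint => ->; rewrite mulr0 subr0 => /eqP; rewrite !mulf_eq0.
move=> /or3P[/eqP i0|/eqP AC|/eqP//].
  by have := cabs_i R; rewrite i0 cabs0 => /eqP; rewrite eq_sym oner_eq0.
by move: A0; rewrite (complexI AC) eqxx.
Qed.

Lemma fock_decay_large (alpha b : R) n (f : C -> C) (K : R) : 0 < b -> holo f -> 0 <= K ->
  (forall z, 1 <= cabs z -> cabs (f z) <= K * expR (b * cabs z `^ alpha) / cabs z ^+ n) ->
  fock_decay alpha b n f.
Proof.
move=> b0 hf K0 H; have [M M0 HM] := holo_bounded 1 hf.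
exists ((K + M) * 2 ^+ n) => z.
have q0 : 0 < 1 + cabs z by rewrite ltr_pwDl ?cabs_ge0.
have e1 : 1 <= expR (b * cabs z `^ alpha) by rewrite -expR0 ler_expR mulr_ge0 ?powR_ge0// ltW.
rewrite ler_pdivlMr ?exprn_gt0//.
have [z1|/ltW z1] := leP (cabs z) 1.
  apply: (@le_trans _ _ (M * 2 ^+ n)).
    apply: ler_pM; rewrite ?cabs_ge0 ?exprn_ge0 ?(ltW q0)//; first exact: HM.
    by rewrite lerXn2r ?nnegrE ?(ltW q0)//; lra.
  apply: (@le_trans _ _ ((K + M) * 2 ^+ n)); first by rewrite ler_wpM2r ?exprn_ge0// lerDr.
  by rewrite ler_peMr// mulr_ge0 ?exprn_ge0// addr_ge0// ltW.
have zp : 0 < cabs z by exact: lt_le_trans z1.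
apply: (@le_trans _ _ (K * expR (b * cabs z `^ alpha) / cabs z ^+ n * (2 * cabs z) ^+ n)).
  apply: ler_pM; rewrite ?cabs_ge0 ?exprn_ge0 ?(ltW q0)//; first exact: H.
  by rewrite lerXn2r ?nnegrE ?(ltW q0) ?mulr_ge0 ?(ltW zp)//; lra.
have -> : K * expR (b * cabs z `^ alpha) / cabs z ^+ n * (2 * cabs z) ^+ n
   = K * 2 ^+ n * expR (b * cabs z `^ alpha).
  by rewrite exprMn; field; rewrite expf_neq0// gt_eqF.
rewrite ler_wpM2r ?expR_ge0// ler_wpM2r ?exprn_ge0// lerDl; exact: ltW.
Qed.

End Kernel.

(** * Members for order one *)

Section KernelOrderOne.
Variable R : realType.
Local Notation C := R[i].

Lemma cauchy_schwarz_circle (a d c k : R) : c ^+ 2 + k ^+ 2 = 1 -> (a * c + d * k) ^+ 2 <= a ^+ 2 + d ^+ 2.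
Proof.
move=> ck; rewrite -[leRHS]mulr1 -ck -subr_ge0.
have -> : (a ^+ 2 + d ^+ 2) * (c ^+ 2 + k ^+ 2) - (a * c + d * k) ^+ 2 = (a * k - d * c) ^+ 2 by ring.
exact: sqr_ge0.
Qed.

Lemma le_of_sqr_le (x y : R) : 0 <= y -> x ^+ 2 <= y ^+ 2 -> x <= y.
Proof.
move=> y0 h; apply: le_trans (ler_norm _) _.
by rewrite -(ler_pXn2r (n := 2)) ?nnegrE// real_normK ?num_real.
Qed.

Lemma kexpN1_pi (A B u : R) (m : nat) (z : C) :
  kexp A B (-1) m%:R z (u +i* pi) = kexp A B (-1) m%:R z (u +i* (- pi)).
Proof.
have E (w : C) : (-1)%:C * w = - w by rewrite realcN mulN1r.
by rewrite /kexp !natCE !cexpD !cexpN !E !cexpN !cexpMn cexp_pi.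
Qed.

(* The integrand is [exp (s + z / (4 s)) s^(-2n)] with [s = exp w]; the circle
   [|s| = sqrt |z| / 2] is the steepest one. *)
Lemma kintN1_le (n : nat) (z : C) : 1 <= cabs z ->
  cabs (kint 1 (- 4^-1) (-1) (2 * n)%:R z 0 pi) <=
    2 * pi * 4 ^+ n * expR (Num.sqrt ((cabs z + Re z) / 2)) / cabs z ^+ n.
Proof.
move=> z1; set r := cabs z in z1 *; set x := Re z; pose y := Im z.
have rp : 0 < r by exact: lt_le_trans z1.
have xr : - r <= x by have := normr_Re_le z; rewrite ler_norml => /andP[].
set q := Num.sqrt _; have q0 : 0 <= q by exact: sqrtr_ge0.
have q2 : q ^+ 2 = (r + x) / 2 by rewrite sqr_sqrtr// divr_ge0//; lra.
pose s := Num.sqrt r / 2; have s0 : 0 < s by rewrite divr_gt0// sqrtr_gt0.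
have s2 : s ^+ 2 = r / 4 by rewrite /s expr_div_n sqr_sqrtr ?(ltW rp)//; congr (_ / _); ring.
pose U := ln s; have eU : expR U = s by rewrite lnK.
rewrite (kint_const U 0 (fun u => kexpN1_pi _ _ u _ _)).
have pp := pi_gt0 R.
have -> : 2 * pi * 4 ^+ n * expR q / r ^+ n = 4 ^+ n * expR q / r ^+ n * (pi - - pi) by ring.
apply: cint_le; [lra|by move=> t; exact: rcont_kexp_vert|move=> t _].
rewrite cabs_kexp mul1r mulNr opprK expRD eU.
have reE : Re (z * cexp ((-1)%:C * (U +i* t))) = (x * cos t + y * sin t) / s.
  rewrite reM reCexp imCexp reZl imZl /= !mulN1r cosN sinN expRN eU -/x -/y.
  by field; rewrite gt_eqF.
rewrite reE.
have -> : expR (- ((2 * n)%:R * U)) = 4 ^+ n / r ^+ n.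
  rewrite expRN expRM_natl eU exprM s2 expr_div_n invf_div.
  by [].
have -> : 4 ^+ n * expR q / r ^+ n = expR q * (4 ^+ n / r ^+ n) by ring.
rewrite ler_wpM2r ?divr_ge0 ?exprn_ge0 ?(ltW rp)// ler_expR.
(* The largest value over the angle [t], by Cauchy-Schwarz; with [s ^+ 2 = r / 4] its square is
   [(r + x) / 2]. *)
apply: le_of_sqr_le => //; rewrite q2.
have -> : s * cos t + 4^-1 * ((x * cos t + y * sin t) / s)
   = (s + x / (4 * s)) * cos t + y / (4 * s) * sin t by field; rewrite gt_eqF.
apply: le_trans (cauchy_schwarz_circle _ _ (cos2Dsin2 t)) _.
have r2 : r ^+ 2 = x ^+ 2 + y ^+ 2 by rewrite /r sqr_cabs.
have -> : (s + x / (4 * s)) ^+ 2 + (y / (4 * s)) ^+ 2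
   = s ^+ 2 + x / 2 + (x ^+ 2 + y ^+ 2) / (16 * s ^+ 2) by field; rewrite gt_eqF.
rewrite -r2 s2; apply: le_of_eq; field; rewrite gt_eqF//.
Qed.

(** [J] is a constant multiple of [z^(-n) I_{2n}(sqrt z)], with [I] the modified Bessel function. By
    [kintN1_le] it is at most a multiple of [|z|^(-n) exp (Re (sqrt z))], since
    [(Re (sqrt z))^2 = (|z| + Re z) / 2]. The square root in [weight] compensates exactly this
    growth. *)
Lemma kernel_order_one (b : R) n : 0 < b -> exists f : C -> C,
  [/\ holo f, exists z, f z != 0, fock_decay 1 b n f & sector_bounded 1 b f].
Proof.
move=> b0.
pose J (z : C) := kint 1 (- 4^-1) (-1) (2 * n)%:R z 0 pi.
have hJ : holo J by move=> z; eexists; apply: cderiv_kint; exact: pi_ge0.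
have hf : holo (fun z => cexp (- b%:C * z) * J z).
  by apply: holoM => //; apply: holo_cexp; apply: holoZ; exact: holo_id.
have cf z : 1 <= cabs z -> cabs (cexp (- b%:C * z) * J z) <=
    expR (- (b * Re z)) * (2 * pi * 4 ^+ n * expR (Num.sqrt ((cabs z + Re z) / 2)) / cabs z ^+ n).
  move=> z1; rewrite (cabsM (cexp _)) cabs_cexp mulNr reN reZl.
  by rewrite ler_wpM2l ?expR_ge0// kintN1_le.
exists (fun z => cexp (- b%:C * z) * J z); split => //.
- exists 0; rewrite mulf_neq0 ?cexp_neq0//; apply: kint0_neq0; exact: oner_neq0.
- apply: (@fock_decay_large _ _ _ _ _ (2 * pi * 4 ^+ n * expR (1 / (8 * b)))) => //.
    by rewrite !mulr_ge0 ?pi_ge0 ?expR_ge0 ?exprn_ge0.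
  move=> z z1; apply: le_trans (cf z z1) _; rewrite powRr1 ?cabs_ge0//.
  set r := cabs z in z1 *; set x := Re z; set q := Num.sqrt _.
  have xr : - r <= x by have := normr_Re_le z; rewrite ler_norml => /andP[].
  have q2 : q ^+ 2 = (r + x) / 2 by rewrite sqr_sqrtr// divr_ge0//; lra.
  have -> : expR (- (b * x)) * (2 * pi * 4 ^+ n * expR q / r ^+ n)
     = 2 * pi * 4 ^+ n / r ^+ n * expR (- (b * x) + q) by rewrite expRD; ring.
  have -> : 2 * pi * 4 ^+ n * expR (1 / (8 * b)) * expR (b * r) / r ^+ n
     = 2 * pi * 4 ^+ n / r ^+ n * expR (1 / (8 * b) + b * r) by rewrite expRD; ring.
  apply: ler_wpM2l; first by rewrite divr_ge0 ?exprn_ge0 ?mulr_ge0 ?pi_ge0 ?cabs_ge0.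
  rewrite ler_expR -subr_ge0.
  (* Since [x = 2 q^2 - r], the exponent is [b r + q - 2 b q^2], and [q - 2 b q^2] has maximum
     [1 / (8 b)]: this is the constant announced above. *)
  have -> : 1 / (8 * b) + b * r - (- (b * x) + q) = 2 * b * (q - 1 / (4 * b)) ^+ 2.
    have xE : x = 2 * q ^+ 2 - r by rewrite q2; field.
    by rewrite xE; field; rewrite gt_eqF.
  by rewrite mulr_ge0 ?sqr_ge0// mulr_ge0// ltW.
exists (2 * pi * 4 ^+ n), 0 => u v u0 hv; rewrite mul0r expR0 mulr1.
have pp := pi_gt0 R; rewrite mulr1 in hv.
set z := cexp (u +i* v).
have rE : cabs z = expR u by exact: cabs_cexp.
have xE : Re z = expR u * cos v by exact: reCexp.
have z1 : 1 <= cabs z by rewrite rE -expR0 ler_expR.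
rewrite /lifted (cabsM (_ * _)) cabs_weight -/z.
apply: le_trans (ler_wpM2r (expR_ge0 _) (cf z z1)) _; rewrite rE xE.
(* The half-angle formula identifies the square root with [Re (exp (w / 2))], the term subtracted in
   [weight]. *)
have -> : Num.sqrt ((expR u + expR u * cos v) / 2) = expR (1 / 2 * u) * cos (1 / 2 * v).
  have -> : (expR u + expR u * cos v) / 2 = (expR (1 / 2 * u) * cos (1 / 2 * v)) ^+ 2.
    rewrite exprMn -expRM_natl (_ : 2%:R * (1 / 2 * u) = u); last by field.
    have -> : cos v = 2 * cos (1 / 2 * v) ^+ 2 - 1.
      rewrite {1}(_ : v = 1 / 2 * v + 1 / 2 * v); last by field.
      rewrite cosD; have := cos2Dsin2 (1 / 2 * v); rewrite !expr2; lra.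
    by field.
  rewrite sqrtr_sqr ger0_norm// mulr_ge0 ?expR_ge0//.
  apply: (@cos_half_ge0 _ 1) => //; rewrite divr1; apply: le_trans hv _; lra.
rewrite !mul1r; set Q := expR (2^-1 * u) * _; set X := expR u * cos v.
have -> : expR (- (b * X)) * (2 * pi * 4 ^+ n * expR Q / expR u ^+ n) * expR (b * X - Q)
   = 2 * pi * 4 ^+ n / expR u ^+ n * (expR (- (b * X)) * expR Q * expR (b * X - Q)) by ring.
rewrite -!expRD (_ : - (b * X) + Q + (b * X - Q) = 0); last by ring.
rewrite expR0 mulr1 ler_pdivrMr ?exprn_gt0 ?expR_gt0//.
rewrite ler_peMr// ?exprn_ege1// ?mulr_ge0 ?pi_ge0 ?exprn_ge0//.
by rewrite -expR0 ler_expR.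
Qed.

End KernelOrderOne.

(** * Concavity of the cosine *)

Section CosConcave.
Variable R : realType.

Lemma cos_tangent (x y : R) : `|x| <= pi / 2 -> `|y| <= pi / 2 -> cos y <= cos x - sin x * (y - x).
Proof.
move=> hx hy; move: (hx) (hy); rewrite !ler_norml => /andP[x1 x2] /andP[y1 y2].
pose g (t : R) := (- sin x) * t - cos t.
have dg (t : R) : is_derive t (1 : R^o) (g : R^o -> R^o) (- sin x - - sin t).
  by apply: is_deriveB; exact: is_derive_mull.
have sin_le (s t : R) : - (pi / 2) <= s -> t <= pi / 2 -> s <= t -> sin s <= sin t.
  move=> s1 t2 st; rewrite leNgt; apply/negP => h.
  have tI : t \in `[(- (pi / 2)), (pi / 2)]%R by rewrite in_itv/=; apply/andP; split; lra.
  have sI : s \in `[(- (pi / 2)), (pi / 2)]%R by rewrite in_itv/=; apply/andP; split; lra.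
  by move: h; rewrite ltr_sin// ltNge st.
suff : g x <= g y by rewrite /g; lra.
have [xy|/ltW yx] := leP x y.
  apply: (@derive_ge0_le _ g (fun t => - sin x - - sin t) x y xy) => t /andP[t1 t2].
  by rewrite opprK addrC subr_ge0; apply: sin_le => //; lra.
rewrite -lerN2; apply: (@derive_ge0_le _ (fun t => - g t) (fun t => - (- sin x - - sin t)) y x yx) => t /andP[t1 t2].
by rewrite opprD !opprK subr_ge0; apply: sin_le => //; lra.
Qed.

Lemma cos_concave (l x y : R) : 0 <= l <= 1 -> `|x| <= pi / 2 -> `|y| <= pi / 2 ->
  l * cos x + (1 - l) * cos y <= cos (l * x + (1 - l) * y).
Proof.
move=> /andP[l0 l1] hx hy; set z := l * x + _.
have hz : `|z| <= pi / 2.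
  have l1' : 0 <= 1 - l by lra.
  apply: le_trans (ler_normD _ _) _; rewrite !normrM (ger0_norm l0) (ger0_norm l1').
  by have := ler_wpM2l l0 hx; have := ler_wpM2l l1' hy; lra.
have := ler_wpM2l l0 (cos_tangent hz hx).
have l1' : 0 <= 1 - l by lra.
have := ler_wpM2l l1' (cos_tangent hz hy) => h2 h1.
apply: le_trans (lerD h1 h2) _.
by apply: le_of_eq; rewrite /z; ring.
Qed.

End CosConcave.

(** * Members for order greater than one *)

Section KernelHigherOrder.
Variable R : realType.
Local Notation C := R[i].
Implicit Types (z w h : C) (U u v r kap : R).

(** A limit with an explicit error: for real sequences the supremum of the [x k - e k] lies within
    [e k] of every [x k], and the real and imaginary parts together account for the factor 2. *)
Lemma dominated_limit (s : nat -> C) (e : nat -> R) :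
  (forall k l, (k <= l)%N -> cabs (s l - s k) <= e k) ->
  exists L, forall k, cabs (L - s k) <= 2 * e k.
Proof.
move=> H.
have e0 k : 0 <= e k by apply: le_trans (H k k (leqnn k)); exact: cabs_ge0.
have W (x : nat -> R) : (forall k l, (k <= l)%N -> `|x l - x k| <= e k) ->
    exists L, forall k, `|L - x k| <= e k.
  move=> Hx; pose S := range (fun k => x k - e k).
  have ub k l : x l - e l <= x k + e k.
    have [kl|/ltnW lk] := leqP k l.
      by have := Hx k l kl; rewrite ler_norml => /andP[_]; have := e0 l; lra.
    by have := Hx l k lk; rewrite ler_norml => /andP[+ _]; have := e0 k; lra.
  exists (sup S) => k; rewrite ler_norml; apply/andP; split.
    by rewrite lerBrDl; apply: ub_le_sup; [exists (x k + e k) => _ [l _ <-]|exists k].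
  by rewrite lerBlDr addrC; apply: ge_sup; [exists (x 0%N - e 0%N), 0%N | move=> _ [l _ <-]].
have [a Ha] : exists L, forall k, `|L - Re (s k)| <= e k.
  by apply: W => k l kl; rewrite -reN -reD; apply: le_trans (normr_Re_le _) (H k l kl).
have [b Hb] : exists L, forall k, `|L - Im (s k)| <= e k.
  by apply: W => k l kl; rewrite -imN -imD; apply: le_trans (normr_Im_le _) (H k l kl).
exists (a +i* b) => k; apply: le_trans (cabs_le_ReIm _) _; rewrite reD imD reN imN /=.
by have := Ha k; have := Hb k; lra.
Qed.

Lemma limit_bound (s : nat -> C) (L : C) (D X k0 kap : R) : 0 < kap -> 0 <= D ->
  (forall k, k0 <= k%:R -> cabs (L - s k) <= D * expR (- (kap * k%:R))) ->
  (forall k, k0 <= k%:R -> cabs (s k) <= X) -> cabs L <= X.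
Proof.
move=> kp D0 HL HX; apply/ler_addgt0Pr => e e0.
pose k := (Num.truncn (Num.max k0 (D / (e * kap)))).+1.
have : Num.max k0 (D / (e * kap)) < k%:R by exact: truncnS_gt.
rewrite gt_max => /andP[/ltW k1 k2].
rewrite -(subrK (s k) L) addrC; apply: le_trans (cabsD _ _) _; apply: lerD; first exact: HX.
apply: le_trans (HL k k1) _; rewrite expRN ler_pdivrMr ?expR_gt0//.
have := expR_ge1Dx (kap * k%:R) => h.
rewrite ltr_pdivrMr ?mulr_gt0// in k2.
have := ler_wpM2l (ltW e0) h; rewrite mulrDr mulr1.
by move: k2; move: (k%:R : R) => x k2; lra.
Qed.

(** A quadratic remainder with a constant read off the second derivative passes to pointwise limits
    of functions, which is how the limit is shown to be differentiable. *)
Lemma taylor2_bound (g g' g'' : C -> C) z (M : R) :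
  (forall w, cderiv g w (g' w)) -> (forall w, cderiv g' w (g'' w)) ->
  (forall w, cabs (w - z) <= 1 -> cabs (g'' w) <= M) ->
  forall h, cabs h <= 1 -> cabs (g (z + h) - g z - g' z * h) <= M * cabs h ^+ 2.
Proof.
move=> dg dg' HM h h1.
have c0 := cabs_ge0 h.
have inside (t : R) : 0 <= t <= 1 -> cabs (z + t%:C * h - z) <= 1.
  move=> /andP[t0 t1]; rewrite addrAC subrr add0r cabsM cabs_real ger0_norm//.
  by apply: le_trans h1; rewrite ler_piMl.
have M0 : 0 <= M by apply: le_trans (cabs_ge0 _) (HM z _); rewrite subrr cabs0.
have d1 (t : R) : 0 <= t <= 1 -> cabs (g' (z + t%:C * h) - g' z) <= M * cabs h.
  move=> /andP[t0 t1].
  have := @cmean_value_bound _ (fun s : R => g' (z + s%:C * h)) (fun s : R => g'' (z + s%:C * h) * h) 0 t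
    (M * cabs h) t0.
  rewrite (_ : 0%:C = 0)// mul0r addr0 subr0 => H.
  apply: le_trans (H _ _) _.
  - by move=> s _; exact: rderiv_affine.
  - move=> s /andP[s0 st]; rewrite cabsM ler_wpM2r//; apply: HM; apply: inside.
    by rewrite s0 (le_trans st).
  by rewrite ler_piMr// mulr_ge0.
have := @cmean_value_bound _ (fun s : R => g (z + s%:C * h) - s%:C * (g' z * h))
  (fun s : R => g' (z + s%:C * h) * h - g' z * h) 0 1 (M * cabs h ^+ 2) ler01.
rewrite (_ : 0%:C = 0)// (_ : 1%:C = 1)// !mul0r !mul1r addr0 !subr0 mulr1 => H.
have -> : g (z + h) - g z - g' z * h = g (z + h) - g' z * h - g z by ring.
apply: H => [t _|t t01].
  apply: rderivB; first exact: rderiv_affine.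
  have := @rderiv_affine _ id 0 (g' z * h) t 1 (cderiv_id _); rewrite mul1r.
  by move=> H e /H[d d0 {}H]; exists d => // s /H; rewrite !add0r.
by rewrite -mulrBl cabsM expr2 mulrA ler_wpM2r// d1.
Qed.

Variables alpha b : R.
(** In [s = exp w] the exponent [A s - B z s^nu] has its saddle point at [s = z^alpha], with value
    [- b z^alpha]; the three constants are chosen for this. *)
Let A := b * (alpha - 1).
Let B := b * alpha.
Let nu := 1 - alpha^-1.
Local Notation E := (kexp A B nu).
Local Notation V := (kint A B nu).

(** Young's inequality with exponents [alpha] and [q = alpha / (alpha - 1)]; [nu q = 1] turns the
    second power into [expR u]. *)
Lemma young_exp r u : 1 < alpha -> 0 <= r ->
  alpha * (r * expR (nu * u)) <= r `^ alpha + (alpha - 1) * expR u.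
Proof.
move=> al1 r0; have al0 : 0 < alpha by lra.
have am0 : 0 < alpha - 1 by lra.
pose q := alpha / (alpha - 1); have q0 : 0 < q by rewrite divr_gt0.
have := @conjugate_powR R r (expR (nu * u)) alpha q r0 (expR_ge0 _) al0 q0.
have -> : alpha^-1 + q^-1 = 1 by rewrite /q; field; rewrite !gt_eqF.
move=> /(_ erefl); rewrite -expRM.
have -> : nu * u * q = u by rewrite /nu /q; field; rewrite !gt_eqF.
move=> h; have := ler_wpM2l (ltW al0) h.
have -> : alpha * (r `^ alpha / alpha + expR u / q) = r `^ alpha + (alpha - 1) * expR u.
  by rewrite /q; field; rewrite !gt_eqF.
by [].
Qed.

(** [young_exp] at [u + ln g], with [r] rescaled by [g^(-nu)]; meant for angles where [cos v] is
    only known to be at most [- g]. *)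
Lemma young_exp_scaled r u (g : R) : 1 < alpha -> 0 <= b -> 0 <= r -> 0 < g ->
  - (A * (expR u * g)) + B * (r * expR (nu * u)) <= b * (r * expR (- (nu * ln g))) `^ alpha.
Proof.
move=> al1 b0 r0 g0.
have r0' : 0 <= r * expR (- (nu * ln g)) by rewrite mulr_ge0 ?expR_ge0.
have := ler_wpM2l b0 (young_exp (u + ln g) al1 r0').
rewrite (mulrDr nu) !expRD lnK// => h.
have E1 : r * expR (- (nu * ln g)) * (expR (nu * u) * expR (nu * ln g)) = r * expR (nu * u).
  have -> : r * expR (- (nu * ln g)) * (expR (nu * u) * expR (nu * ln g))
    = r * expR (nu * u) * (expR (- (nu * ln g)) * expR (nu * ln g)) by ring.
  by rewrite -expRD addNr expR0 mulr1.
rewrite E1 in h; rewrite /A /B; move: h; rewrite mulrDr; lra.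
Qed.

(** Here [exp w = - exp u], so the term with [A] is negative and [young_exp] bounds the rest by
    [b |z|^alpha], for every argument of [z]. *)
Lemma kexp_pi_le kap z u (s : R) : 1 < alpha -> 0 < b -> s = pi \/ s = - pi ->
  cabs (E kap z (u +i* s)) <= expR (b * cabs z `^ alpha) * expR (- (kap * u)).
Proof.
move=> al1 b0 hs; apply: le_trans (cabs_kexp_le _ _ _ _ _ _ _) _.
have -> : cos s = -1 by case: hs => ->; rewrite ?cosN cospi.
rewrite -expRD ler_expR lerD2r.
have B0 : 0 <= B by rewrite mulr_ge0//; lra.
have := ler_wpM2l (ltW b0) (young_exp u al1 (cabs_ge0 z)).
by rewrite mulrDr /A /B in B0 *; rewrite (ger0_norm B0); lra.
Qed.

Lemma kint_shift_pi kap z U U' : 1 < alpha -> 0 < b -> 0 < kap -> U <= U' ->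
  cabs (V kap z U' pi - V kap z U pi) <= 2 * expR (b * cabs z `^ alpha) / kap * expR (- (kap * U)).
Proof.
move=> al1 b0 k0 UU; apply: kint_shift_le; rewrite ?pi_ge0 ?expR_ge0//.
  by move=> u _; apply: kexp_pi_le => //; left.
by move=> u _; apply: kexp_pi_le => //; right.
Qed.

(** Uniform in [U >= 0] and in [z] on a disc, as required for the second derivatives in
    [taylor2_bound]. *)
Lemma kint_pi_bounded kap z U (rho : R) : 1 < alpha -> 0 < b -> 0 < kap -> 0 <= U -> cabs z <= rho ->
  cabs (V kap z U pi) <= expR (A + B * rho) * (2 * pi) + 2 * expR (b * rho `^ alpha) / kap.
Proof.
move=> al1 b0 k0 U0 zr; have pp := pi_gt0 R; have z0 := cabs_ge0 z.
have A0 : 0 <= A by rewrite mulr_ge0 ?(ltW b0)//; lra.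
have B0 : 0 <= B by rewrite mulr_ge0 ?(ltW b0)//; lra.
rewrite -(subrKC (V kap z 0 pi) (V kap z U pi)); apply: le_trans (cabsD _ _) _; apply: lerD.
  have -> : 2 * pi = pi - - pi :> R by ring.
  apply: cint_le; [lra|by move=> t; exact: rcont_kexp_vert|move=> t _].
  apply: le_trans (cabs_kexp_le _ _ _ _ _ _ _) _; rewrite ler_expR !mulr0 expR0 subr0 mul1r mulr1.
  rewrite ger0_norm//; apply: lerD; last by rewrite ler_wpM2l.
  by rewrite -[leRHS]mulr1 ler_wpM2l// cos_le1.
apply: le_trans (kint_shift_pi z al1 b0 k0 U0) _; rewrite mulr0 oppr0 expR0 mulr1.
rewrite ler_wpM2r ?invr_ge0 ?(ltW k0)// ler_wpM2l// ler_expR ler_wpM2l ?(ltW b0)//.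
by apply: ge0_ler_powR; rewrite ?nnegrE//; lra.
Qed.

Definition kint_limit kap (f : C -> C) := forall z (k : nat),
  cabs (f z - V kap z k%:R pi) <= 4 * expR (b * cabs z `^ alpha) / kap * expR (- (kap * k%:R)).

(* The limit is the integral over the Hankel-type contour [Im w = - pi], [Im w = pi]:
   moving the vertical segment to the right costs two horizontal pieces, which
   [young_exp] makes exponentially small. *)
Lemma kint_pi_limit kap : 1 < alpha -> 0 < b -> 0 < kap -> exists f : C -> C, kint_limit kap f.
Proof.
move=> al1 b0 k0.
have /boolp.choice[f Hf] (z : C) : exists L, forall k : nat, cabs (L - V kap z k%:R pi)
     <= 2 * (2 * expR (b * cabs z `^ alpha) / kap * expR (- (kap * k%:R))).
  apply: (dominated_limit (s := fun k => V kap z k%:R pi)) => k l kl.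
  by apply: kint_shift_pi => //; rewrite ler_nat.
exists f => z k; apply: le_trans (Hf z k) _.
by apply: le_of_eq; ring.
Qed.

(** The second-order estimate for the segment integrals is uniform in [k] and passes to the limit.
    Two derivatives lower the exponent [m] by [2 nu <= 2], so [m >= 3] keeps it positive. *)
Lemma kint_limit_holo (f : C -> C) (m : nat) : 1 < alpha -> 0 < b -> (3 <= m)%N ->
  kint_limit m%:R f -> holo f.
Proof.
move=> al1 b0 m3 Hf z.
have pp := pi_gt0 R.
have n1 : nu <= 1 by rewrite /nu lerBlDr lerDl invr_ge0; lra.
have n0 : 0 <= nu by rewrite /nu subr_ge0 invf_le1; lra.
have m3' : 3 <= m%:R :> R by rewrite ler_nat.
have k1 : 0 < m%:R - nu by lra.
have k2 : 0 < m%:R - nu - nu by lra.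
have m0 : 0 < m%:R :> R by lra.
have [g Hg] := kint_pi_limit al1 b0 k1.
pose rho := cabs z + 1.
pose W := expR (A + B * rho) * (2 * pi) + 2 * expR (b * rho `^ alpha) / (m%:R - nu - nu).
have W0 : 0 <= W by rewrite addr_ge0// ?mulr_ge0 ?expR_ge0 ?invr_ge0 ?(ltW pp) ?(ltW k2).
pose M := B ^+ 2 * W + 1.
have M0 : 0 < M by rewrite ltr_wpDl// mulr_ge0 ?sqr_ge0.
have key h : cabs h <= 1 -> cabs (f (z + h) - f z - (- B%:C * g z) * h) <= M * cabs h ^+ 2.
  move=> h1.
  pose s k := V m%:R (z + h) k%:R pi - V m%:R z k%:R pi - (- B%:C * V (m%:R - nu) z k%:R pi) * h.
  pose D := 4 * expR (b * cabs (z + h) `^ alpha) / m%:R + 4 * expR (b * cabs z `^ alpha) / m%:R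
    + `|B| * (4 * expR (b * cabs z `^ alpha) / (m%:R - nu)).
  have D0 : 0 <= D by rewrite !addr_ge0 ?mulr_ge0 ?expR_ge0 ?invr_ge0 ?(ltW m0) ?(ltW k1).
  apply: (@limit_bound s _ D _ 0 (m%:R - nu)) => // k _.
    have e1 : expR (- (m%:R * k%:R)) <= expR (- ((m%:R - nu) * k%:R)).
      by rewrite ler_expR lerN2 ler_wpM2r//; lra.
    have a1 := Hf (z + h) k; have a2 := Hf z k; have a3 := Hg z k.
    have -> : f (z + h) - f z - (- B%:C * g z) * h - s k
      = (f (z + h) - V m%:R (z + h) k%:R pi) - (f z - V m%:R z k%:R pi)
        + B%:C * (g z - V (m%:R - nu) z k%:R pi) * h by rewrite /s; ring.
    apply: le_trans (cabsD _ _) _; rewrite /D mulrDl; apply: lerD.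
      apply: le_trans (cabsB _ _) _; rewrite mulrDl; apply: lerD.
        by apply: le_trans a1 _; rewrite ler_wpM2l// mulr_ge0 ?mulr_ge0 ?expR_ge0 ?invr_ge0.
      by apply: le_trans a2 _; rewrite ler_wpM2l// mulr_ge0 ?mulr_ge0 ?expR_ge0 ?invr_ge0.
    rewrite (cabsM _ h) (cabsM B%:C) cabs_real -[leRHS]mulr1; apply: ler_pM => //.
    - by rewrite mulr_ge0 ?cabs_ge0.
    - exact: cabs_ge0.
    by rewrite -[leRHS]mulrA ler_wpM2l.
  rewrite /s; apply: le_trans (_ : _ <= B ^+ 2 * W * cabs h ^+ 2) _; last first.
    by rewrite ler_wpM2r ?sqr_ge0// /M lerDl.
  apply: (@taylor2_bound (fun z => V m%:R z k%:R pi) (fun z => - B%:C * V (m%:R - nu) z k%:R pi)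
    (fun z => - B%:C * (- B%:C * V (m%:R - nu - nu) z k%:R pi)) z) => //.
  - by move=> w; apply: cderiv_kint; exact: pi_ge0.
  - by move=> w; apply: cderivZ; apply: cderiv_kint; exact: pi_ge0.
  move=> w wz; rewrite mulrA (cabsM (_ * _)) cabsM cabsN cabs_real -expr2 real_normK ?num_real//.
  rewrite ler_wpM2l ?sqr_ge0//; apply: kint_pi_bounded => //.
  by have := cabsD (w - z) z; rewrite subrK /rho; lra.
exists (- B%:C * g z) => e e0; exists (Num.min 1 (e / M)); first by rewrite lt_min ltr01 divr_gt0.
move=> h; rewrite lt_min => /andP[/ltW h1 h2]; apply: le_trans (key h h1) _.
rewrite expr2 mulrA ler_wpM2r ?cabs_ge0// mulrC -ler_pdivlMr//; exact: ltW.
Qed.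

(** The vertical side is put where [exp (Re w)] is a fixed multiple of [|z|^alpha]; the factor
    [exp (- m w)] is then [O(|z|^(- alpha m))] there and smaller to the right. *)
Lemma kint_limit_decay (f : C -> C) (m : nat) : 1 < alpha -> 0 < b -> (3 <= m)%N ->
  kint_limit m%:R f ->
  exists2 K : R, 0 <= K & forall z, 1 <= cabs z -> cabs (f z) <= K * expR (b * cabs z `^ alpha) / cabs z ^+ m.
Proof.
move=> al1 b0 m3 Hf; have pp := pi_gt0 R; have al0 : 0 < alpha by lra.
have A0 : 0 <= A by rewrite mulr_ge0 ?(ltW b0)//; lra.
have B0 : 0 <= B by rewrite mulr_ge0 ?(ltW b0)//; lra.
have n0 : 0 < nu by rewrite /nu subr_gt0 invf_lt1//; lra.
have n1 : nu <= 1 by rewrite /nu lerBlDr lerDl invr_ge0 ltW.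
have m0 : 0 < m%:R :> R by rewrite ltr0n; apply: leq_trans m3.
(* With this [t], [expR U] and [r * expR (nu * U)] are both at most [r^alpha / (2 alpha)], so the
   exponent is at most [(A + B) r^alpha / (2 alpha)], which is below [b r^alpha] because
   [A + B = b (2 alpha - 1)]. *)
pose t := ln (2 * alpha) / nu.
have t0 : 0 <= t by rewrite divr_ge0 ?(ltW n0)// ln_ge0//; lra.
have et : expR (- (nu * t)) = (2 * alpha)^-1.
  by rewrite /t mulrCA mulfV ?gt_eqF// mulr1 expRN lnK// posrE; lra.
have et' : expR (- t) <= (2 * alpha)^-1 by rewrite -et ler_expR lerN2 ler_piMl.
pose K := (2 * pi + 2 / m%:R) * expR (m%:R * t).
have K0 : 0 <= K by rewrite mulr_ge0 ?expR_ge0// addr_ge0 ?mulr_ge0 ?invr_ge0 ?(ltW pp) ?(ltW m0).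
exists K => // z z1; set r := cabs z in z1 *; have rp : 0 < r by lra.
pose U := alpha * ln r - t.
have ra : r `^ alpha = expR (alpha * ln r) by rewrite mulrC expRM lnK.
have eU : expR U = r `^ alpha * expR (- t) by rewrite /U expRD ra.
have enU : r * expR (nu * U) = r `^ alpha * (2 * alpha)^-1.
  rewrite -et ra -{1}(lnK rp) -!expRD; congr expR; rewrite /U /nu; field; rewrite gt_eqF//.
have ekU : expR (- (m%:R * U)) <= expR (m%:R * t) / r ^+ m.
  have -> : - (m%:R * U) = m%:R * t - m%:R * (alpha * ln r) by rewrite /U; ring.
  rewrite expRB ler_wpM2l ?expR_ge0// lef_pV2 ?posrE ?expR_gt0 ?exprn_gt0//.
  rewrite -{1}(lnK rp) -expRM_natl ler_expR ler_wpM2l ?(ltW m0)// ler_peMl ?ln_ge0//; lra.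
have R0 := powR_ge0 r alpha.
have vert : cabs (V m%:R z U pi) <= expR (b * r `^ alpha) * expR (- (m%:R * U)) * (2 * pi).
  have -> : 2 * pi = pi - - pi :> R by ring.
  apply: cint_le; [lra|by move=> s; exact: rcont_kexp_vert|move=> s _].
  apply: le_trans (cabs_kexp_le _ _ _ _ _ _ _) _.
  rewrite -expRD ler_expR lerD2r ger0_norm// -/r enU.
  have h1 : A * (expR U * cos s) <= A * (r `^ alpha * (2 * alpha)^-1).
    rewrite ler_wpM2l//; apply: (@le_trans _ _ (expR U)).
      by rewrite -[leRHS]mulr1 ler_wpM2l ?expR_ge0// cos_le1.
    by rewrite eU ler_wpM2l.
  apply: le_trans (lerD h1 (lexx _)) _.
  have -> : A * (r `^ alpha * (2 * alpha)^-1) + B * (r `^ alpha * (2 * alpha)^-1)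
     = b * r `^ alpha * (1 - (2 * alpha)^-1) by rewrite /A /B; field; rewrite gt_eqF.
  rewrite -[leRHS]mulr1 ler_wpM2l ?mulr_ge0 ?(ltW b0)//.
  by rewrite lerBlDr lerDl invr_ge0 mulr_ge0// ltW.
rewrite -/r; apply: (@limit_bound (fun k => V m%:R z k%:R pi) _
  (4 * expR (b * r `^ alpha) / m%:R) _ U m%:R) => //.
move=> k Uk; rewrite -(subrKC (V m%:R z U pi) (V m%:R z k%:R pi)).
apply: le_trans (cabsD _ _) _.
apply: le_trans (lerD vert (kint_shift_pi z al1 b0 m0 Uk)) _; rewrite -/r.
have -> : expR (b * r `^ alpha) * expR (- (m%:R * U)) * (2 * pi)
    + 2 * expR (b * r `^ alpha) / m%:R * expR (- (m%:R * U))
  = (2 * pi + 2 / m%:R) * expR (b * r `^ alpha) * expR (- (m%:R * U)) by ring.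
have -> : K * expR (b * r `^ alpha) / r ^+ m
   = (2 * pi + 2 / m%:R) * expR (b * r `^ alpha) * (expR (m%:R * t) / r ^+ m) by rewrite /K; ring.
by rewrite ler_wpM2l// mulr_ge0 ?expR_ge0// addr_ge0 ?mulr_ge0 ?invr_ge0 ?(ltW pp) ?(ltW m0).
Qed.

Lemma norm_quarter v' : 1 < alpha -> `|v'| <= pi / (4 * alpha) -> alpha * `|v'| <= pi / 4.
Proof.
move=> al1 h; have al0 : 0 < alpha by lra.
have := ler_wpM2l (ltW al0) h.
by have -> : alpha * (pi / (4 * alpha)) = pi / 4 by field; rewrite gt_eqF.
Qed.

(** The angle [v' + nu v] is the mean of [alpha v'] and [v] with weights [1 / alpha] and [nu];
    [alpha |v'| <= pi / 4] keeps it in the range of concavity. *)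
Lemma cone_cos v' v : 1 < alpha -> `|v'| <= pi / (4 * alpha) -> `|v| <= pi / 2 ->
  cos (alpha * v') + (alpha - 1) * cos v <= alpha * cos (v' + nu * v).
Proof.
move=> al1 hv' hv; have al0 : 0 < alpha by lra.
have hx : `|alpha * v'| <= pi / 2.
  rewrite normrM gtr0_norm//; have := norm_quarter al1 hv'; have := pi_gt0 R; lra.
have l01 : 0 <= alpha^-1 <= 1 by rewrite invr_ge0 (ltW al0) invf_le1// ltW.
have := ler_wpM2l (ltW al0) (cos_concave l01 hx hv).
rewrite mulrA mulVf ?gt_eqF// mul1r -/nu mulrDr mulrA mulfV ?gt_eqF// mul1r.
by rewrite mulrA mulrBr mulfV ?gt_eqF// mulr1.
Qed.

Lemma cone_cos_ge0 v' : 1 < alpha -> `|v'| <= pi / (4 * alpha) -> 0 <= cos (alpha * v').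
Proof.
move=> al1 hv'; have al0 : 0 < alpha by lra.
have pp := pi_gt0 R.
rewrite -(cos_pihalf R); apply: cos_ge_of_norm_le; last by lra.
by rewrite normrM gtr0_norm//; have := norm_quarter al1 hv'; lra.
Qed.

Lemma cabs_kexp_cexp kap u' v' u v : cabs (E kap (cexp (u' +i* v')) (u +i* v)) =
  expR (A * (expR u * cos v) - B * (expR (u' + nu * u) * cos (v' + nu * v))) * expR (- (kap * u)).
Proof.
rewrite cabs_kexp -expRD -cexpD reCexp reD imD (reZl nu) (imZl nu).
by [].
Qed.

(** On these lines [A exp w] is imaginary and [cone_cos] reduces to
    [cos (alpha v') <= alpha cos (v' + nu v)]; to the right of [alpha u'], [|z| exp (nu u)] is at
    least [|z|^alpha]. *)
Lemma cone_horizontal kap u' v' u v : 1 < alpha -> 0 < b -> `|v'| <= pi / (4 * alpha) ->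
  alpha * u' <= u -> v = pi / 2 \/ v = - (pi / 2) ->
  cabs (E kap (cexp (u' +i* v')) (u +i* v)) <=
    expR (- (b * (expR (alpha * u') * cos (alpha * v')))) * expR (- (kap * u)).
Proof.
move=> al1 b0 hv' uu hv; have pp := pi_gt0 R; have al0 : 0 < alpha by lra.
have cv : cos v = 0 by case: hv => ->; rewrite ?cosN cos_pihalf.
have nv : `|v| <= pi / 2 by case: hv => ->; rewrite ?normrN ger0_norm//; lra.
rewrite cabs_kexp_cexp cv !mulr0 sub0r; apply: ler_wpM2r; first exact: expR_ge0.
rewrite ler_expR lerN2 /B -mulrA; apply: ler_wpM2l; first exact: ltW.
have := cone_cos al1 hv' nv; rewrite cv mulr0 addr0 => h.
rewrite mulrCA; apply: ler_pM; rewrite ?expR_ge0 ?cone_cos_ge0//.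
rewrite ler_expR; have n0 : 0 <= nu by rewrite /nu subr_ge0 invf_le1// ltW.
have := ler_wpM2l n0 uu; have -> : nu * (alpha * u') = alpha * u' - u'.
  by rewrite /nu; field; rewrite gt_eqF.
lra.
Qed.

Lemma cone_vertical kap u' v' v : 1 < alpha -> 0 < b -> `|v'| <= pi / (4 * alpha) -> `|v| <= pi / 2 ->
  cabs (E kap (cexp (u' +i* v')) ((alpha * u') +i* v)) <=
    expR (- (b * (expR (alpha * u') * cos (alpha * v')))) * expR (- (kap * (alpha * u'))).
Proof.
move=> al1 b0 hv' nv; have al0 : 0 < alpha by lra.
rewrite cabs_kexp_cexp; apply: ler_wpM2r; first exact: expR_ge0.
have -> : u' + nu * (alpha * u') = alpha * u' by rewrite /nu; field; rewrite gt_eqF.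
rewrite ler_expR; have := ler_wpM2l (expR_ge0 (alpha * u')) (cone_cos al1 hv' nv).
by move=> /(ler_wpM2l (ltW b0)); rewrite /A /B !mulrDr; lra.
Qed.

(** Serves to discard the parts [pi / 2 <= |Im w| <= pi] of far segments: the point is the decay in
    [u] at fixed [z]. *)
Lemma cone_left kap u' v' v u : 1 < alpha -> 0 < b -> `|v'| <= pi / (4 * alpha) ->
  pi / 2 <= `|v| -> `|v| <= pi ->
  cabs (E kap (cexp (u' +i* v')) (u +i* v)) <=
    expR (b * (expR u' * expR (- (nu * ln (sin (pi / (4 * alpha)))))) `^ alpha) * expR (- (kap * u)).
Proof.
move=> al1 b0 hv' v1 v2; have pp := pi_gt0 R; have al0 : 0 < alpha by lra.
set d := pi / (4 * alpha) in hv' *.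
have d0 : 0 < d by rewrite divr_gt0// mulr_gt0.
have dal : alpha * d = pi / 4 by rewrite /d; field; rewrite gt_eqF.
have d1 : d < pi / 4 by rewrite -dal ltr_pMl.
have g0 : 0 < sin d by apply: sin_gt0_pi; rewrite d0/=; lra.
have A0 : 0 <= A by rewrite mulr_ge0 ?(ltW b0)//; lra.
have B0 : 0 <= B by rewrite mulr_ge0 ?(ltW b0)//; lra.
have n0 : 0 <= nu by rewrite /nu subr_ge0 invf_le1// ltW.
have cle (t : R) : pi / 2 <= t <= pi -> t <= `|v| -> cos v <= cos t.
  move=> /andP[t1 t2] tv; have -> : cos v = cos `|v| by case: (ger0P v); rewrite ?cosN.
  by rewrite leNgt; apply/negP; rewrite ltr_cos ?in_itv/= ?(le_trans _ t1) ?t2 ?normr_ge0 ?v2 ?ltNge ?tv//; lra.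
(* Up to [pi / 2 + d] both terms of the exponent have the favourable sign, since [v' + nu v] stays
   within [pi / 2]. Farther out [cos v <= - sin d], and [young_exp_scaled] applies with
   [g = sin d]. *)
have [vd|/ltW vd] := leP `|v| (pi / 2 + d).
  rewrite cabs_kexp_cexp; apply: ler_wpM2r; first exact: expR_ge0.
  rewrite ler_expR; apply: (@le_trans _ _ 0); last by rewrite mulr_ge0 ?powR_ge0// ltW.
  have c1 : cos v <= 0 by rewrite -(cos_pihalf R); apply: cle => //; lra.
  have c2 : 0 <= cos (v' + nu * v).
    rewrite -(cos_pihalf R); apply: cos_ge_of_norm_le; last by lra.
    apply: le_trans (ler_normD _ _) _; rewrite normrM (ger0_norm n0).
    apply: le_trans (lerD hv' (ler_wpM2l n0 vd)) _.
    have -> : d + nu * (pi / 2 + d) = nu * (pi / 2) + d * 2 - d / alpha by rewrite /nu; ring.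
    have -> : nu * (pi / 2) = pi / 2 - d * 2 by rewrite /nu /d; field; rewrite gt_eqF.
    by rewrite subrK lerBlDr lerDl divr_ge0// ltW.
  rewrite subr_le0; apply: (@le_trans _ _ 0).
    by apply: mulr_ge0_le0 => //; apply: mulr_ge0_le0 => //; exact: expR_ge0.
  by rewrite mulr_ge0// mulr_ge0// expR_ge0.
apply: le_trans (cabs_kexp_le _ _ _ _ _ _ _) _; rewrite -expRD ler_expR; apply: lerD => //.
rewrite (ger0_norm B0) cabs_cexp /=.
apply: le_trans (young_exp_scaled u al1 (ltW b0) (expR_ge0 u') g0); apply: lerD => //.
rewrite -/A -mulrN; apply: ler_wpM2l => //; rewrite -mulrN; apply: ler_wpM2l; first exact: expR_ge0.
have -> : - sin d = cos (d + pi / 2) by rewrite cosDpihalf.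
by apply: cle; lra.
Qed.

(* In the sector the contour may be pulled in to [Im w = +- pi / 2], where [exp w] is
   imaginary, with its vertical side at [exp (Re w) = |z|^alpha], where concavity of
   the cosine controls the exponent. *)
Lemma cone_bound (f : C -> C) (m : nat) : 1 < alpha -> 0 < b -> (0 < m)%N ->
  kint_limit m%:R f ->
  forall u v, 0 <= u -> `|v| <= pi / (4 * alpha) ->
  cabs (f (cexp (u +i* v))) <= (pi + 2 / m%:R) * expR (- (b * (expR (alpha * u) * cos (alpha * v)))).
Proof.
move=> al1 b0 m0' Hf u' v' u0 hv'; have pp := pi_gt0 R; have al0 : 0 < alpha by lra.
have m0 : 0 < m%:R :> R by rewrite ltr0n.
set K := expR _; have K0 : 0 <= K by exact: expR_ge0.
set z := cexp _; have rE : cabs z = expR u' by exact: cabs_cexp.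
pose D := expR (b * (expR u' * expR (- (nu * ln (sin (pi / (4 * alpha)))))) `^ alpha).
have D0 : 0 <= D by exact: expR_ge0.
apply: (@limit_bound (fun k => V m%:R z k%:R (pi / 2)) _
  (4 * expR (b * cabs z `^ alpha) / m%:R + pi * D) _ (alpha * u') m%:R) => //.
- by rewrite addr_ge0 ?mulr_ge0 ?expR_ge0 ?invr_ge0 ?(ltW m0) ?(ltW pp).
(* The segments of half-height [pi / 2] have the same limit [f z]: by [cone_left] the two cut-off
   pieces tend to 0. *)
- move=> k _; have -> : f z - V m%:R z k%:R (pi / 2)
     = (f z - V m%:R z k%:R pi) + (V m%:R z k%:R pi - V m%:R z k%:R (pi / 2)) by ring.
  apply: le_trans (cabsD _ _) _; rewrite [leRHS]mulrDl; apply: lerD; first exact: Hf.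
  rewrite /kint -(cint_cat _ (- pi) pi (- (pi / 2))) -(cint_cat _ (- (pi / 2)) pi (pi / 2)).
  set c1 := cint _ (- pi) _; set c2 := cint _ _ (pi / 2); set c3 := cint _ (pi / 2) _.
  have -> : c1 + (c2 + c3) - c2 = c1 + c3 by ring.
  apply: le_trans (cabsD _ _) _.
  have -> : pi * D * expR (- (m%:R * k%:R)) = D * expR (- (m%:R * k%:R)) * (- (pi / 2) - - pi)
      + D * expR (- (m%:R * k%:R)) * (pi - pi / 2) by field.
  rewrite -/z; apply: lerD; (apply: cint_le; [lra|by move=> t; exact: rcont_kexp_vert|]) => t /andP[t1 t2].
    by apply: cone_left => //; rewrite ler0_norm; lra.
  by apply: cone_left => //; rewrite ger0_norm; lra.
move=> k Uk; rewrite -(subrKC (V m%:R z (alpha * u') (pi / 2)) (V m%:R z k%:R (pi / 2))).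
apply: le_trans (cabsD _ _) _; rewrite [leRHS]mulrDl.
have eU : expR (- (m%:R * (alpha * u'))) <= 1.
  by rewrite -expR0 ler_expR oppr_le0 !mulr_ge0// ltW.
apply: lerD.
  have -> : pi * K = K * (pi / 2 - - (pi / 2)) by field.
  apply: cint_le; [lra|by move=> t; exact: rcont_kexp_vert|move=> t /andP[t1 t2]].
  apply: le_trans (cone_vertical _ _ al1 b0 hv' _) _; first by rewrite ler_norml t1.
  by rewrite ler_piMr.
apply: (@le_trans _ _ (2 * K / m%:R * expR (- (m%:R * (alpha * u'))))).
  apply: kint_shift_le => //; first by lra.
    by move=> u uu; apply: cone_horizontal => //; left.
  by move=> u uu; apply: cone_horizontal => //; right.
have -> : 2 / m%:R * K = 2 * K / m%:R by ring.
by rewrite ler_piMr// divr_ge0 ?mulr_ge0// ltW.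
Qed.

Lemma kernel_higher_order n : 1 < alpha -> 0 < b -> exists f : C -> C,
  [/\ holo f, exists z, f z != 0, fock_decay alpha b n f & sector_bounded alpha b f].
Proof.
move=> al1 b0; have pp := pi_gt0 R; have al0 : 0 < alpha by lra.
(* At least 3 for holomorphy and at least [n] for the decay. *)
pose m := (n + 3)%N; have m3 : (3 <= m)%N by rewrite leq_addl.
have m0' : (0 < m)%N by apply: leq_trans m3.
have m0 : 0 < m%:R :> R by rewrite ltr0n.
have [f Hf] := kint_pi_limit al1 b0 m0.
have hf := kint_limit_holo al1 b0 m3 Hf.
exists f; split => //.
(* At [z = 0] the segment integrals do not depend on [U], so [f 0] is their common value, which is
   nonzero. *)
- exists 0; apply: contraTneq (kint0_neq0 B nu m 0 (_ : A != 0)) => [f0|]; last first.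
    by rewrite mulf_neq0 ?gt_eqF//; lra.
  rewrite negbK -/(is_true _) -cabs_eq0.
  rewrite -normr_le0 ger0_norm ?cabs_ge0//.
  apply: (@limit_bound (fun=> 0) _ (4 * expR (b * cabs 0 `^ alpha) / m%:R) 0 0 m%:R) => //.
  + move=> k k0; have := Hf 0 k; rewrite f0 sub0r cabsN subr0.
    by rewrite (kint_const 0 k%:R (kexp0_pi A B nu m)).
  by move=> k _; rewrite cabs0.
- have [K K0 HK] := kint_limit_decay al1 b0 m3 Hf.
  apply: (fock_decay_large b0 hf K0) => z z1; apply: le_trans (HK z z1) _.
  rewrite ler_wpM2l ?mulr_ge0 ?expR_ge0// lef_pV2 ?posrE ?exprn_gt0 ?(lt_le_trans _ z1)//.
  by rewrite ler_weXn2l// leq_addr.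
exists (pi + 2 / m%:R), 0 => u v u0 hv; rewrite mul0r expR0 mulr1.
have K0 : 0 <= pi + 2 / m%:R :> R by rewrite addr_ge0 ?divr_ge0 ?(ltW pp) ?(ltW m0).
(* [weight] cancels the bound [exp (- b Re (z^alpha))], and the surviving factor
   [exp (- z^(alpha/2))] has modulus at most 1 here. *)
have := cone_bound al1 b0 m0' Hf u0 hv; set X := expR (alpha * u) * _ => H.
rewrite /lifted (cabsM (f _)) cabs_weight -/X.
apply: le_trans (ler_wpM2r (expR_ge0 _) H) _; rewrite -[leLHS]mulrA -expRD ler_piMr//.
rewrite -[leRHS]expR0 ler_expR addrA addNr add0r oppr_le0 mulr_ge0 ?expR_ge0//.
apply: (cos_half_ge0 (ltW al1)); apply: le_trans hv (quarter_le (ltW al1)).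
Qed.

End KernelHigherOrder.

(** * Assembly of the theorem *)

Lemma kernel_exists (R : realType) (alpha b : R) n : 1 <= alpha -> 0 < b -> exists f : R[i] -> R[i],
  [/\ holo f, exists z, f z != 0, fock_decay alpha b n f & sector_bounded alpha b f].
Proof.
rewrite le_eqVlt => /orP[/eqP <-|al1 b0]; first exact: kernel_order_one.
exact: kernel_higher_order.
Qed.

Theorem theorem1p5 (R : realType) (p alpha a : R)
    (hp : 1 <= p) (halpha : 1 <= alpha) (ha : 0 < a) :
  exists M : set (R[i] -> R[i]),
    [/\ closed_subspace p alpha a M,
        nontrivial_subspace p alpha a M,
        infinite_dimensional M,
        nearly_invariant M &
        without_common_zeros M].
Proof.
have b0 : 0 < a / p by rewrite divr_gt0// (lt_le_trans ltr01).
have ker n := kernel_exists n halpha b0.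
have nz : exists2 f, decay_space p alpha a f & exists z, f z != 0.
  have [f [hf fz df sf]] := ker 4%N; exists f => //.
  by split => //; exact: fock_of_decay.
exists (decay_space p alpha a); split.
- split.
  + by move=> f [].
  + exact: decay_space0.
  + by move=> c f g; exact: decay_space_lincomb.
  + by move=> f; exact: decay_space_closed.
- exact: decay_space_nontrivial.
- exact: decay_space_infinite.
- exact: decay_space_near_invariant.
- exact: decay_space_without_zeros.
Qed.
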